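(* Let $\{\phi_1^t\}$ and $\{\phi_2^t\}$ be smooth area preserving isotopies of $(D^2,\omega)$ starting at the identity, each generated by a one-periodic smooth Hamiltonian compactly supported in the interior of the closed unit disk $D^2$, with time-one maps $\phi_1$ and $\phi_2$. Then the helicity of their double suspension $X(\{\phi_1^t\},\{\phi_2^t\})$ with respect to the standard volume form $dV$ on the unit three-sphere $S^3$ equals $$\mathcal H\left(X(\{\phi_1^t\},\{\phi_2^t\})\right)=2\pi^2\cdot\left(\mathrm{Cal}(\phi_1)+\mathrm{Cal}(\phi_2)+2\pi^2\right).$$
   Context: Let $\omega=r\,dr\wedge d\theta$ be the standard area form on $D^2$. An isotopy $\{\phi^t\}$ is generated by $F_t$ (one-periodic in $t$, compactly supported in the interior of $D^2$) if $\frac{d}{dt}\phi^t=X_{F_t}\circ\phi^t$, $\phi^0=\mathrm{id}$, $\iota_{X_{F_t}}\omega=dF_t$. The Calabi invariant of $\phi=\phi^1$ is $\mathrm{Cal}(\phi)=\int_0^1\int_{D^2}F_t\,\omega\,dt$; it depends only on $\phi$. The suspension of $\{\phi^t\}$ is the vector field $X+\frac{\partial}{\partial t}$ on $D^2\times\mathbb R/\mathbb Z$ with $X(x,t)=X_{F_t}(x)$. Hopf coordinates $(\eta,\xi_1,\xi_2)$ on $S^3\subset\mathbb C^2$: $z_1=e^{i\xi_1}\sin\eta$, $z_2=e^{i\xi_2}\cos\eta$, $0\le\eta\le\pi/2$, $\xi_1,\xi_2\in\mathbb R/2\pi\mathbb Z$, with $dV=\frac12\sin(2\eta)\,d\eta\wedge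 d\xi_1\wedge d\xi_2$. The solid torus is embedded in $S^3$ by $$\tau^1((r,\theta),t)=(\arcsin(r/\sqrt2),\ \theta+2\pi t,\ 2\pi t),\qquad \tau^2((r,\theta),t)=(\tfrac{\pi}{2}-\arcsin(r/\sqrt2),\ 2\pi t,\ \theta+2\pi t)$$ (in coordinates $(\eta,\xi_1,\xi_2)$), with images $\{\eta\le\pi/4\}$ and $\{\eta\ge\pi/4\}$, and $(\tau^i)^*dV=\pi\,\omega\wedge dt$. The double suspension $X(\{\phi_1^t\},\{\phi_2^t\})$ is the smooth vector field on $S^3$ equal to $\tau^1_*(X_1+\frac{\partial}{\partial t})$ on $\{\eta\le\pi/4\}$ and $\tau^2_*(X_2+\frac{\partial}{\partial t})$ on $\{\eta\ge\pi/4\}$, where $X_i+\frac{\partial}{\partial t}$ is the suspension of $\{\phi_i^t\}$; both coincide with $2\pi(\frac{\partial}{\partial\xi_1}+\frac{\partial}{\partial\xi_2})$ near $\{\eta=\pi/4\}$. It is divergence-free with respect to $dV$. The helicity of a divergence-free vector field $Y$ on $S^3$ with respect to $dV$ is $\mathcal H(Y)=\int_{S^3}\beta\wedge d\beta$ for any one-form $\beta$ with $d\beta=\iota_Y dV$. *)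

(* Defs.v *)
From Stdlib Require Import Reals Lra ClassicalEpsilon.
From Coquelicot Require Import Coquelicot.
Open Scope R_scope.

Definition dirD {V : NormedModule R_AbsRing} (f : V -> R) (p v : V) : R :=
  Derive (fun s : R => f (plus p (scal s v))) 0.

(* C^k on an open set [U] of a finite-dimensional space: all iterated
   directional derivatives up to order [k] exist and are continuous. *)
Fixpoint Ck (k : nat) {V : NormedModule R_AbsRing}
    (U : V -> Prop) (f : V -> R) : Prop :=
  (forall p, U p -> continuous f p) /\
  match k with
  | O => True
  | S k' => forall v : V,
      (forall p, U p -> ex_derive (fun s : R => f (plus p (scal s v))) 0) /\
      Ck k' U (fun p => dirD f p v)
  end.

Definition smooth {V : NormedModule R_AbsRing} (U : V -> Prop) (f : V -> R) :=
  forall k, Ck k U f.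

Definition plane : Type := (R * R)%type.

Definition det2 (u v : plane) : R := fst u * snd v - snd u * fst v.
Definition normsq2 (u : plane) : R := fst u ^ 2 + snd u ^ 2.
Definition disk (x : plane) : Prop := normsq2 x <= 1.

(* A one-periodic Hamiltonian compactly supported in the interior of the
   disk, extended by zero to the plane. *)
Record hamiltonian (F : R -> plane -> R) : Prop := {
  ham_smooth : smooth (fun _ : R * (R * R) => True) (fun q => F (fst q) (snd q));
  ham_periodic : forall t x, F (t + 1) x = F t x;
  ham_support : exists rho, 0 < rho < 1 /\
    forall t x, rho ^ 2 < normsq2 x -> F t x = 0 }.

(* [iota_X omega = dF] with [omega = dx /\ dy] reads [X = (F_y, - F_x)]. *)
Definition ham_vf (F : R -> plane -> R) (t : R) (x : plane) : R * R :=
  (dirD (F t : R * R -> R) x (0, 1), - dirD (F t : R * R -> R) x (1, 0)).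

(* Smooth area preserving isotopies of the disk starting at the identity,
   extended by the identity to the plane; this loses nothing, since those
   generated by a Hamiltonian as above are the identity near the boundary.
   Bijectivity of [phi t] on the plane then amounts to bijectivity on the
   disk. *)
Record disk_isotopy (phi : R -> plane -> plane) : Prop := {
  iso_smooth1 : smooth (fun _ : R * (R * R) => True)
                  (fun q => fst (phi (fst q) (snd q)));
  iso_smooth2 : smooth (fun _ : R * (R * R) => True)
                  (fun q => snd (phi (fst q) (snd q)));
  iso_start : forall x, phi 0 x = x;
  iso_outside : forall t x, ~ disk x -> phi t x = x;
  iso_bijective : forall t, exists psi : plane -> plane,
    (forall x, psi (phi t x) = x) /\ (forall x, phi t (psi x) = x);
  iso_area : forall t (x : R * R),
    det2 (dirD (fun y : R * R => fst (phi t y)) x (1, 0),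
          dirD (fun y : R * R => snd (phi t y)) x (1, 0))
         (dirD (fun y : R * R => fst (phi t y)) x (0, 1),
          dirD (fun y : R * R => snd (phi t y)) x (0, 1)) = 1 }.

Definition generates (F : R -> plane -> R) (phi : R -> plane -> plane) : Prop :=
  (forall x, phi 0 x = x) /\
  forall t x, is_derive (fun s => (phi s x : R * R)) t (ham_vf F t (phi t x)).

Definition disk_integral (f : plane -> R) : R :=
  RInt (fun r => RInt (fun theta => f (r * cos theta, r * sin theta) * r)
                   0 (2 * PI)) 0 1.

(* [c = Cal(f)] for a map [f] of the disk: [c] is the Calabi integral of a
   Hamiltonian generating some isotopy with time-one map [f]. *)
Definition is_calabi (f : plane -> plane) (c : R) : Prop :=
  exists (F : R -> plane -> R) (phi : R -> plane -> plane),
    hamiltonian F /\ disk_isotopy phi /\ generates F phi /\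
    (forall x, phi 1 x = f x) /\
    c = RInt (fun t => disk_integral (F t)) 0 1.

(* [((x1, y1), (x2, y2))] stands for [(z1, z2) = (x1 + i y1, x2 + i y2)]. *)
Definition R4 : Type := ((R * R) * (R * R))%type.

Definition dot4 (u v : R4) : R :=
  fst (fst u) * fst (fst v) + snd (fst u) * snd (fst v) +
  fst (snd u) * fst (snd v) + snd (snd u) * snd (snd v).
Definition S3 (p : R4) : Prop := dot4 p p = 1.
Definition tangentS3 (p v : R4) : Prop := dot4 p v = 0.

Definition D4 (g : R -> R4) (s : R) : R4 :=
  ((Derive (fun x => fst (fst (g x))) s, Derive (fun x => snd (fst (g x))) s),
   (Derive (fun x => fst (snd (g x))) s, Derive (fun x => snd (snd (g x))) s)).

(* Determinant on R^4, by Laplace expansion along the first two coordinates. *)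
Definition det4 (p a b c : R4) : R :=
  det2 (fst p) (fst a) * det2 (snd b) (snd c)
  - det2 (fst p) (fst b) * det2 (snd a) (snd c)
  + det2 (fst p) (fst c) * det2 (snd a) (snd b)
  + det2 (fst a) (fst b) * det2 (snd p) (snd c)
  - det2 (fst a) (fst c) * det2 (snd p) (snd b)
  + det2 (fst b) (fst c) * det2 (snd p) (snd a).

(* The volume form at a point [p] of the sphere: the contraction of the
   Euclidean volume form by the outer normal [p] (see [dV_hopf] below). *)
Definition dV (p a b c : R4) : R := det4 p a b c.

Definition hopf (eta xi1 xi2 : R) : R4 :=
  ((sin eta * cos xi1, sin eta * sin xi1), (cos eta * cos xi2, cos eta * sin xi2)).
Definition hopf_eta (eta xi1 xi2 : R) : R4 := D4 (fun s => hopf s xi1 xi2) eta.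
Definition hopf_xi1 (eta xi1 xi2 : R) : R4 := D4 (fun s => hopf eta s xi2) xi1.
Definition hopf_xi2 (eta xi1 xi2 : R) : R4 := D4 (fun s => hopf eta xi1 s) xi2.

Lemma dV_hopf (eta xi1 xi2 : R) :
  dV (hopf eta xi1 xi2) (hopf_eta eta xi1 xi2) (hopf_xi1 eta xi1 xi2)
     (hopf_xi2 eta xi1 xi2) = / 2 * sin (2 * eta).
Proof.
assert (Hs : forall a x, Derive (fun s => sin s * a) x = cos x * a).
{ intros a x; apply is_derive_unique; auto_derive; [easy | ring]. }
assert (Hc : forall a x, Derive (fun s => cos s * a) x = - sin x * a).
{ intros a x; apply is_derive_unique; auto_derive; [easy | ring]. }
assert (Hs' : forall a x, Derive (fun s => a * sin s) x = a * cos x).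
{ intros a x; apply is_derive_unique; auto_derive; [easy | ring]. }
assert (Hc' : forall a x, Derive (fun s => a * cos s) x = - a * sin x).
{ intros a x; apply is_derive_unique; auto_derive; [easy | ring]. }
unfold dV, det4, det2, hopf_eta, hopf_xi1, hopf_xi2, D4, hopf; simpl.
rewrite !Hs, !Hc, !Hs', !Hc', !Derive_const, sin_2a.
pose proof (sin2_cos2 eta) as E0.
pose proof (sin2_cos2 xi1) as E1; pose proof (sin2_cos2 xi2) as E2.
unfold Rsqr in *.
transitivity (sin eta * cos eta
  * (sin eta * sin eta + cos eta * cos eta)
  * (sin xi1 * sin xi1 + cos xi1 * cos xi1)
  * (sin xi2 * sin xi2 + cos xi2 * cos xi2)); [ring |].
rewrite E0, E1, E2; field.
Qed.

(* Integral of a three-form over the sphere, positively oriented by [dV]. *)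
Definition S3_integral (mu : R4 -> R4 -> R4 -> R4 -> R) : R :=
  RInt (fun eta => RInt (fun xi1 => RInt (fun xi2 =>
    mu (hopf eta xi1 xi2) (hopf_eta eta xi1 xi2)
       (hopf_xi1 eta xi1 xi2) (hopf_xi2 eta xi1 xi2))
    0 (2 * PI)) 0 (2 * PI)) 0 (PI / 2).

(* A smooth one-form on the sphere is given as the restriction of a smooth
   one-form on R^4 minus the origin. *)
Definition one_form (beta : R4 -> R4 -> R) : Prop :=
  (forall (p u v : (R * R) * (R * R)) (a : R), p <> zero ->
     beta p (plus (scal a u) v) = a * beta p u + beta p v) /\
  (forall v, smooth (fun p : (R * R) * (R * R) => p <> zero) (fun p => beta p v)).

Definition ext_d (beta : R4 -> R4 -> R) (p u v : (R * R) * (R * R)) : R :=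
  dirD (fun q => beta q v) p u - dirD (fun q => beta q u) p v.

Definition wedge12 (alpha : R4 -> R4 -> R) (sigma : R4 -> R4 -> R4 -> R)
    (p a b c : R4) : R :=
  alpha p a * sigma p b c - alpha p b * sigma p a c + alpha p c * sigma p a b.

(* [d beta = iota_Y dV] as two-forms on the sphere. *)
Definition primitive (Y : R4 -> R4) (beta : R4 -> R4 -> R) : Prop :=
  forall p u v, S3 p -> tangentS3 p u -> tangentS3 p v ->
    ext_d beta p u v = dV p (Y p) u v.

Definition is_helicity (Y : R4 -> R4) (h : R) : Prop :=
  (exists beta, one_form beta /\ primitive Y beta) /\
  forall beta, one_form beta -> primitive Y beta ->
    S3_integral (wedge12 beta (ext_d beta)) = h.

(* The solid torus [D^2 x R/Z] is represented by [D^2 x R]: both the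
   embeddings below and the suspension are one-periodic in the last variable. *)
Definition rot (s : R) (x : plane) : plane :=
  (fst x * cos s - snd x * sin s, fst x * sin s + snd x * cos s).

Definition tau1 (q : (R * R) * R) : R4 :=
  let (x, t) := q in
  (rot (2 * PI * t) (fst x / sqrt 2, snd x / sqrt 2),
   rot (2 * PI * t) (sqrt (1 - normsq2 x / 2), 0)).
Definition tau2 (q : (R * R) * R) : R4 :=
  let (x, t) := q in
  (rot (2 * PI * t) (sqrt (1 - normsq2 x / 2), 0),
   rot (2 * PI * t) (fst x / sqrt 2, snd x / sqrt 2)).

Lemma asin_polar (r : R) : 0 <= r <= 1 ->
  sin (asin (r / sqrt 2)) = r / sqrt 2 /\
  cos (asin (r / sqrt 2)) = sqrt (1 - r ^ 2 / 2).
Proof.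
intros Hr.
assert (H2 : 0 < sqrt 2) by (apply sqrt_lt_R0; lra).
assert (H2s : sqrt 2 * sqrt 2 = 2) by (apply sqrt_sqrt; lra).
assert (Hi : r / sqrt 2 * sqrt 2 = r) by (field; lra).
assert (Hb : -1 <= r / sqrt 2 <= 1) by (split; nra).
split; [now apply sin_asin |].
rewrite cos_asin by assumption; f_equal; unfold Rsqr.
replace (r / sqrt 2 * (r / sqrt 2)) with (r ^ 2 / (sqrt 2 * sqrt 2))
  by (field; lra).
now rewrite H2s.
Qed.

Lemma normsq2_polar (r theta : R) :
  normsq2 (r * cos theta, r * sin theta) = r ^ 2.
Proof.
unfold normsq2; simpl; pose proof (sin2_cos2 theta) as E; unfold Rsqr in E.
transitivity (r ^ 2 * (sin theta * sin theta + cos theta * cos theta));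
  [ring | rewrite E; ring].
Qed.

Lemma tau1_polar (r theta t : R) : 0 <= r <= 1 ->
  tau1 ((r * cos theta, r * sin theta), t) =
  hopf (asin (r / sqrt 2)) (theta + 2 * PI * t) (2 * PI * t).
Proof.
intros Hr; destruct (asin_polar r Hr) as [Es Ec].
unfold tau1, hopf, rot; rewrite normsq2_polar, Es, Ec, sin_plus, cos_plus; simpl.
unfold Rdiv; repeat apply f_equal2; ring.
Qed.

Lemma tau2_polar (r theta t : R) : 0 <= r <= 1 ->
  tau2 ((r * cos theta, r * sin theta), t) =
  hopf (PI / 2 - asin (r / sqrt 2)) (2 * PI * t) (theta + 2 * PI * t).
Proof.
intros Hr; destruct (asin_polar r Hr) as [Es Ec].
unfold tau2, hopf, rot.
rewrite normsq2_polar, sin_shift, cos_shift, Es, Ec, sin_plus, cos_plus; simpl.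
unfold Rdiv; repeat apply f_equal2; ring.
Qed.

Definition suspension (F : R -> plane -> R) (q : (R * R) * R) : (R * R) * R :=
  (ham_vf F (snd q) (fst q), 1).

(* The vector field [tau_* V] at a point of [tau (D^2 x R)]; its value does
   not depend on the preimage chosen when [tau] is [tau1] or [tau2] and [V]
   is one-periodic in the last variable. *)
Definition pushforward (tau : (R * R) * R -> R4)
    (V : (R * R) * R -> (R * R) * R) (p : R4) : R4 :=
  epsilon (inhabits p) (fun w : R4 =>
    exists q, disk (fst q) /\ tau q = p /\
      w = D4 (fun s => tau (plus q (scal s (V q)))) 0).

(* [|z1|^2 <= 1/2] is [eta <= pi/4]; the two expressions agree where
   [|z1|^2 = 1/2]. *)
Definition double_suspension (F1 F2 : R -> plane -> R) (p : R4) : R4 :=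
  if Rle_dec (normsq2 (fst p)) (1 / 2)
  then pushforward tau1 (suspension F1) p
  else pushforward tau2 (suspension F2) p.

(* Main.v *)
Require Import Defs.
From Stdlib Require Import Reals ZArith Lra Lia ClassicalEpsilon.
From Coquelicot Require Import Coquelicot.
Open Scope R_scope.

(* On the first solid torus the double suspension contracted into dV pulls back
   to PI (dF /\ dt + omega) = d (PI (F dt + lambda + 2 PI dt)), lambda being
   (x dy - y dx) / 2, and lambda + 2 PI dt is the pullback of the contact form
   alpha = x1 dy1 - y1 dx1 + x2 dy2 - y2 dx2. Hence a global primitive is
   beta = PI alpha + PI F1 dt + PI F2 dt, where the last two terms, extended by
   zero, have disjoint supports. By Stokes the pairing
   of one-forms (beta, beta') |-> int beta /\ d beta' is symmetric, so the
   helicity does not depend on the primitive and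
   int beta /\ d beta = PI^2 int alpha /\ d alpha + 2 sum_i int PI^2 Fi dt /\ d alpha,
   whose terms are 4 PI^4 and 2 PI^2 Cal(Fi).

   The Calabi integral of F depends only on the time-one map f of its flow: by
   Cartan's formula int_0^1 (F + lambda (X_F)) o phi^t dt is the compactly
   supported primitive of f^* lambda - lambda, and its integral over the disk is
   2 Cal(F), since the flow preserves area and int lambda (X_F) = int F. *)

(** * Functions of class C^k *)

(** Smoothness is given only through iterated directional derivatives, so the chain rule, the
    symmetry of second derivatives and the naturality of d under pullback are all derived from that
    form. The symmetry of the pairing serves twice: it removes the choice of primitive, and it moves
    the exterior derivative from F dt to alpha, so that no derivative of F is ever integrated. The
    self term F dt /\ d (F dt) vanishes because F dt has a single nonzero coefficient in the Hopf
    frame. Hopf coordinates degenerate at eta = 0 and eta = PI / 2. Pulled back forms remain smooth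
    there, and the boundary terms of Stokes vanish because one frame vector is zero. The delicate
    point of the global primitive is that t is an angle: it is multivalued, which periodicity of F
    repairs, and it is undefined on a core circle, from which the support of F stays away. For the
    Calabi invariant only the dx-component of Cartan's formula is needed, since a primitive
    vanishing outside the disk is recovered by integrating along horizontal lines that start outside
    it. *)

Lemma line_0 {V : NormedModule R_AbsRing} (p v : V) : plus p (scal 0 v) = p.
Proof.
transitivity (plus p zero); [f_equal; exact (scal_zero_l v) | apply plus_zero_r].
Qed.

Lemma continuous_line {V : NormedModule R_AbsRing} (p v : V) (s : R) :
  continuous (fun s : R => plus p (scal s v)) s.
Proof.
apply (continuous_plus (fun _ : R => p) (fun s : R => scal s v));
  [apply continuous_const |].
apply (continuous_scal_l (fun s : R => s) v s), continuous_id.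
Qed.

Lemma locally_line {V : NormedModule R_AbsRing} (U : V -> Prop) (p v : V) :
  open U -> U p -> locally (0 : R) (fun s : R => U (plus p (scal s v))).
Proof.
intros HU Hp; apply (continuous_line p v 0), HU; now rewrite line_0.
Qed.

Lemma Derive_line {V : NormedModule R_AbsRing} (f : V -> R) (p v : V) (s : R) :
  Derive (fun x : R => f (plus p (scal x v))) s = dirD f (plus p (scal s v)) v.
Proof.
unfold dirD.
rewrite (Derive_ext (fun x => f (plus (plus p (scal s v)) (scal x v)))
  (fun x => f (plus p (scal (x + s) v)))).
- unfold Derive; f_equal; apply Lim_ext; intros h.
  now rewrite !Rplus_0_l, (Rplus_comm h s).
- intros x; rewrite <- plus_assoc; do 2 f_equal.
  rewrite (Rplus_comm x s); symmetry; exact (scal_distr_r s x v).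
Qed.

Lemma is_derive_line {V : NormedModule R_AbsRing} (f : V -> R) (p v : V) (s : R) :
  ex_derive (fun x : R => f (plus (plus p (scal s v)) (scal x v))) 0 ->
  is_derive (fun x : R => f (plus p (scal x v))) s (dirD f (plus p (scal s v)) v).
Proof.
intros H; rewrite <- Derive_line; apply Derive_correct.
apply (ex_derive_ext (fun x => f (plus (plus p (scal s v)) (scal (x - s) v)))).
- intros x; rewrite <- plus_assoc; do 2 f_equal.
  transitivity (scal (plus s (x - s)) v); [symmetry; exact (scal_distr_r s (x - s) v) |].
  f_equal; unfold plus; simpl; ring.
- apply (ex_derive_comp (fun x : R => f (plus (plus p (scal s v)) (scal x v)))
    (fun x => x - s)).
  + now replace (s - s) with 0 by ring.
  + auto_derive; easy.
Qed.

Lemma dirD_ext_open {V : NormedModule R_AbsRing} (U : V -> Prop) (f g : V -> R) (p v : V) :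
  open U -> U p -> (forall q, U q -> f q = g q) -> dirD f p v = dirD g p v.
Proof.
intros HU Hp Hfg; apply Derive_ext_loc.
generalize (locally_line U p v HU Hp); apply filter_imp; intros s; apply Hfg.
Qed.

Lemma is_derive_dirD {V : NormedModule R_AbsRing} k (U : V -> Prop) (f : V -> R) (p v : V) :
  Ck (S k) U f -> U p ->
  is_derive (fun s : R => f (plus p (scal s v))) 0 (dirD f p v).
Proof. intros [_ H] Hp; apply Derive_correct, (H v), Hp. Qed.

Lemma Ck_continuous {V : NormedModule R_AbsRing} k (U : V -> Prop) (f : V -> R) p :
  Ck k U f -> U p -> continuous f p.
Proof. destruct k; intros [H _]; apply H. Qed.

Lemma Ck_dirD {V : NormedModule R_AbsRing} k (U : V -> Prop) (f : V -> R) v :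
  Ck (S k) U f -> Ck k U (fun p => dirD f p v).
Proof. intros [_ H]; apply H. Qed.

Lemma Ck_pred {V : NormedModule R_AbsRing} k (U : V -> Prop) (f : V -> R) :
  Ck (S k) U f -> Ck k U f.
Proof.
revert f; induction k as [|k IH]; intros f Hf.
- split; [exact (proj1 Hf) | exact I].
- split; [exact (proj1 Hf) | intros v; split; [exact (proj1 (proj2 Hf v)) |]].
  apply IH, Ck_dirD, Hf.
Qed.

Lemma Ck_subset {V : NormedModule R_AbsRing} k (U W : V -> Prop) (f : V -> R) :
  (forall p, W p -> U p) -> Ck k U f -> Ck k W f.
Proof.
intros HWU; revert f; induction k as [|k IH]; intros f [Hc Hd];
  (split; [auto |]); [exact I |].
intros v; destruct (Hd v) as [He Hk]; auto.
Qed.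

(** Serves functions whose usable formula changes from one neighbourhood to the next: [hamf], where
    the branch of the angle varies, and [ham_form], treated differently on and off an axis. *)
Lemma Ck_local {V : NormedModule R_AbsRing} k (U : V -> Prop) (f : V -> R) :
  (forall p, U p -> exists W : V -> Prop, W p /\ Ck k W f) -> Ck k U f.
Proof.
revert f; induction k as [|k IH]; intros f H.
- split; [| exact I]; intros p Hp; destruct (H p Hp) as [W [Wp Wf]].
  now apply (Ck_continuous 0 W).
- split; [| intros v; split].
  + intros p Hp; destruct (H p Hp) as [W [Wp Wf]]; now apply (proj1 Wf).
  + intros p Hp; destruct (H p Hp) as [W [Wp Wf]]; exact (proj1 (proj2 Wf v) p Wp).
  + apply IH; intros p Hp; destruct (H p Hp) as [W [Wp Wf]].
    exists W; split; [assumption | now apply Ck_dirD].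
Qed.

Lemma Ck_ext {V : NormedModule R_AbsRing} k (U : V -> Prop) (f g : V -> R) :
  open U -> (forall p, U p -> f p = g p) -> Ck k U f -> Ck k U g.
Proof.
intros HU; revert f g; induction k as [|k IH]; intros f g Hfg [Hc Hd].
- split; [| exact I]; intros p Hp; apply (continuous_ext_loc g f); [| auto].
  generalize (HU p Hp); apply filter_imp; auto.
- split; [| intros v; split].
  + intros p Hp; apply (continuous_ext_loc g f); [| auto].
    generalize (HU p Hp); apply filter_imp; auto.
  + intros p Hp; apply (ex_derive_ext_loc (fun s : R => f (plus p (scal s v)))).
    * generalize (locally_line U p v HU Hp); apply filter_imp; auto.
    * exact (proj1 (Hd v) p Hp).
  + apply (IH (fun p => dirD f p v)); [| exact (proj2 (Hd v))].
    intros p Hp; now apply (dirD_ext_open U).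
Qed.

Lemma Ck_const {V : NormedModule R_AbsRing} k (U : V -> Prop) (c : R) :
  open U -> Ck k U (fun _ => c).
Proof.
intros HU; revert c; induction k as [|k IH]; intros c.
- split; [intros p _; apply continuous_const | exact I].
- split; [intros p _; apply continuous_const | intros v; split].
  + intros p _; apply ex_derive_const.
  + apply (Ck_ext k U (fun _ => 0)); [exact HU | | apply IH].
    intros p _; symmetry; exact (Derive_const c 0).
Qed.

Lemma Ck_linear {V : NormedModule R_AbsRing} k (U : V -> Prop) (l : V -> R) :
  open U -> (forall p, continuous l p) ->
  (forall p v (s : R), l (plus p (scal s v)) = l p + s * l v) -> Ck k U l.
Proof.
intros HU Hc Hl; destruct k as [|k]; (split; [auto |]); [exact I |].
assert (H : forall p v, is_derive (fun s : R => l (plus p (scal s v))) 0 (l v)).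
{ intros p v; apply (is_derive_ext (fun s => l p + s * l v)).
  - now intros t; rewrite Hl.
  - auto_derive; [easy | ring]. }
intros v; split.
- intros p _; eexists; apply H.
- apply (Ck_ext k U (fun _ => l v)); [exact HU | | now apply Ck_const].
  intros p _; symmetry; apply is_derive_unique, H.
Qed.

Lemma Ck_plus {V : NormedModule R_AbsRing} k (U : V -> Prop) (f g : V -> R) :
  open U -> Ck k U f -> Ck k U g -> Ck k U (fun p => f p + g p).
Proof.
intros HU; revert f g; induction k as [|k IH]; intros f g Hf Hg.
- split; [| exact I]; intros p Hp; apply (continuous_plus f g);
    [now apply (proj1 Hf) | now apply (proj1 Hg)].
- split; [| intros v].
  + intros p Hp; apply (continuous_plus f g);
      [now apply (proj1 Hf) | now apply (proj1 Hg)].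
  + assert (H : forall p, U p ->
      is_derive (fun s : R => f (plus p (scal s v)) + g (plus p (scal s v))) 0
        (dirD f p v + dirD g p v)).
    { intros p Hp; apply (is_derive_plus (fun s : R => f (plus p (scal s v)))
        (fun s : R => g (plus p (scal s v)))); now apply (is_derive_dirD k U). }
    split.
    * intros p Hp; eexists; now apply H.
    * apply (Ck_ext k U (fun p => dirD f p v + dirD g p v)); [exact HU | |].
      -- intros p Hp; symmetry; now apply is_derive_unique, H.
      -- now apply IH; apply Ck_dirD.
Qed.

Lemma is_derive_line_mult {V : NormedModule R_AbsRing} k (U : V -> Prop) (f g : V -> R) p v :
  Ck (S k) U f -> Ck (S k) U g -> U p ->
  is_derive (fun s : R => f (plus p (scal s v)) * g (plus p (scal s v))) 0
    (dirD f p v * g p + f p * dirD g p v).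
Proof.
intros Hf Hg Hp.
pose proof (is_derive_mult (fun s : R => f (plus p (scal s v)))
  (fun s : R => g (plus p (scal s v))) 0 _ _
  (is_derive_dirD k U f p v Hf Hp) (is_derive_dirD k U g p v Hg Hp)
  Rmult_comm) as HM.
cbv beta in HM; rewrite !line_0 in HM; exact HM.
Qed.

Lemma Ck_mult {V : NormedModule R_AbsRing} k (U : V -> Prop) (f g : V -> R) :
  open U -> Ck k U f -> Ck k U g -> Ck k U (fun p => f p * g p).
Proof.
intros HU; revert f g; induction k as [|k IH]; intros f g Hf Hg.
- split; [| exact I]; intros p Hp; apply (continuous_mult f g);
    [now apply (proj1 Hf) | now apply (proj1 Hg)].
- split; [| intros v].
  + intros p Hp; apply (continuous_mult f g);
      [now apply (proj1 Hf) | now apply (proj1 Hg)].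
  + assert (H : forall p, U p ->
      is_derive (fun s : R => f (plus p (scal s v)) * g (plus p (scal s v))) 0
        (dirD f p v * g p + f p * dirD g p v)).
    { intros p Hp; now apply (is_derive_line_mult k U). }
    split.
    * intros p Hp; eexists; now apply H.
    * apply (Ck_ext k U (fun p => dirD f p v * g p + f p * dirD g p v)); [exact HU | |].
      -- intros p Hp; symmetry; now apply is_derive_unique, H.
      -- apply Ck_plus; [exact HU | |]; apply IH;
           solve [now apply Ck_dirD | now apply Ck_pred].
Qed.

Lemma Ck_opp {V : NormedModule R_AbsRing} k (U : V -> Prop) (f : V -> R) :
  open U -> Ck k U f -> Ck k U (fun p => - f p).
Proof.
intros HU Hf; apply (Ck_ext k U (fun p => -1 * f p)); [exact HU | intros; ring |].
apply Ck_mult; [exact HU | now apply Ck_const | exact Hf].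
Qed.

Lemma Ck_minus {V : NormedModule R_AbsRing} k (U : V -> Prop) (f g : V -> R) :
  open U -> Ck k U f -> Ck k U g -> Ck k U (fun p => f p - g p).
Proof. intros HU Hf Hg; apply Ck_plus; [| | apply Ck_opp]; assumption. Qed.

(** The derivative of the composite is [dirD f] times h' o f, so regularity climbs by one order.
    When h' is again built from h, as for the inverse, the square root, sine and cosine, this
    becomes an induction on k. *)
Lemma Ck_comp1 {V : NormedModule R_AbsRing} k (U : V -> Prop) (f : V -> R)
    (h h' : R -> R) :
  open U -> Ck (S k) U f -> (forall p, U p -> is_derive h (f p) (h' (f p))) ->
  Ck k U (fun p => h' (f p)) -> Ck (S k) U (fun p => h (f p)).
Proof.
intros HU Hf Hh Hh'; split; [| intros v].
- intros p Hp; apply (continuous_comp f h); [now apply (proj1 Hf) |].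
  apply (ex_derive_continuous h); eexists; now apply Hh.
- assert (H : forall p, U p ->
    is_derive (fun s : R => h (f (plus p (scal s v)))) 0 (dirD f p v * h' (f p))).
  { intros p Hp.
    apply (is_derive_comp h (fun s : R => f (plus p (scal s v))) 0 (h' (f p)) (dirD f p v)).
    - rewrite line_0; now apply Hh.
    - now apply (is_derive_dirD k U). }
  split.
  + intros p Hp; eexists; now apply H.
  + apply (Ck_ext k U (fun p => dirD f p v * h' (f p))); [exact HU | |].
    * intros p Hp; symmetry; now apply is_derive_unique, H.
    * apply Ck_mult; [exact HU | now apply Ck_dirD | exact Hh'].
Qed.

Lemma Ck_comp1_0 {V : NormedModule R_AbsRing} (U : V -> Prop) (f : V -> R)
    (h : R -> R) :
  Ck 0 U f -> (forall p, U p -> continuous h (f p)) -> Ck 0 U (fun p => h (f p)).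
Proof.
intros Hf Hh; split; [| exact I].
intros p Hp; apply (continuous_comp f h); [now apply (proj1 Hf) | auto].
Qed.

Lemma Ck_inv {V : NormedModule R_AbsRing} k (U : V -> Prop) (f : V -> R) :
  open U -> (forall p, U p -> f p <> 0) -> Ck k U f -> Ck k U (fun p => / f p).
Proof.
intros HU Hn; induction k as [|k IH]; intros Hf.
- apply Ck_comp1_0; [exact Hf |]; intros p Hp; now apply continuous_Rinv, Hn.
- apply (Ck_comp1 k U f Rinv (fun x => - (/ x * / x))); [exact HU | exact Hf | |].
  + intros p Hp; auto_derive; [now apply Hn |]; field; now apply Hn.
  + apply Ck_opp; [exact HU |]; apply Ck_mult; [exact HU | |];
      now apply IH, Ck_pred.
Qed.

Lemma Ck_sqrt {V : NormedModule R_AbsRing} k (U : V -> Prop) (f : V -> R) :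
  open U -> (forall p, U p -> 0 < f p) -> Ck k U f -> Ck k U (fun p => sqrt (f p)).
Proof.
intros HU Hn; induction k as [|k IH]; intros Hf.
- apply Ck_comp1_0; [exact Hf |]; intros p Hp; apply continuous_sqrt.
- apply (Ck_comp1 k U f sqrt (fun x => / (2 * sqrt x))); [exact HU | exact Hf | |].
  + intros p Hp; specialize (Hn p Hp); auto_derive; [exact Hn |].
    field; now apply Rgt_not_eq, sqrt_lt_R0.
  + apply Ck_inv; [exact HU | |].
    * intros p Hp; specialize (Hn p Hp); apply sqrt_lt_R0 in Hn; lra.
    * apply Ck_mult; [exact HU | now apply Ck_const | now apply IH, Ck_pred].
Qed.

Lemma Ck_atan {V : NormedModule R_AbsRing} k (U : V -> Prop) (f : V -> R) :
  open U -> Ck k U f -> Ck k U (fun p => atan (f p)).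
Proof.
intros HU; destruct k as [|k]; intros Hf.
- apply Ck_comp1_0; [exact Hf |]; intros p Hp; apply continuous_atan.
- apply (Ck_comp1 k U f atan (fun x => / (1 + x * x))); [exact HU | exact Hf | |].
  + intros p Hp; exact (is_derive_atan (f p)).
  + apply Ck_pred in Hf; apply Ck_inv; [exact HU | intros p _; nra |].
    apply Ck_plus; [exact HU | now apply Ck_const |]; now apply Ck_mult.
Qed.

Lemma Ck_sin_cos {V : NormedModule R_AbsRing} k (U : V -> Prop) (f : V -> R) :
  open U -> Ck k U f -> Ck k U (fun p => sin (f p)) /\ Ck k U (fun p => cos (f p)).
Proof.
intros HU; induction k as [|k IH]; intros Hf.
- split; apply Ck_comp1_0; try exact Hf; intros p Hp;
    [apply continuous_sin | apply continuous_cos].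
- destruct (IH (Ck_pred k U f Hf)) as [Hs Hc]; split.
  + apply (Ck_comp1 k U f sin cos); try assumption; intros p Hp; apply is_derive_sin.
  + apply (Ck_comp1 k U f cos (fun x => - sin x)); try assumption.
    * intros p Hp; apply is_derive_cos.
    * now apply Ck_opp.
Qed.

Lemma dirD_comp_linear {V W : NormedModule R_AbsRing} (L : V -> W) (f : W -> R) p v :
  (forall p v (s : R), L (plus p (scal s v)) = plus (L p) (scal s (L v))) ->
  dirD (fun q => f (L q)) p v = dirD f (L p) (L v).
Proof. intros HL; apply Derive_ext; intros s; now rewrite HL. Qed.

Lemma Ck_comp_linear {V W : NormedModule R_AbsRing} k (U : W -> Prop) (L : V -> W)
    (f : W -> R) :
  (forall p, continuous L p) ->
  (forall p v (s : R), L (plus p (scal s v)) = plus (L p) (scal s (L v))) ->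
  open U -> Ck k U f -> Ck k (fun p => U (L p)) (fun p => f (L p)).
Proof.
intros Hc HL HU.
assert (HU' : open (fun p => U (L p))).
{ intros p Hp; apply (Hc p), HU, Hp. }
revert f; induction k as [|k IH]; intros f Hf.
- split; [| exact I]; intros p Hp; apply (continuous_comp L f); [apply Hc |].
  now apply (proj1 Hf).
- split; [| intros v; split].
  + intros p Hp; apply (continuous_comp L f); [apply Hc |]; now apply (proj1 Hf).
  + intros p Hp; apply (ex_derive_ext (fun s : R => f (plus (L p) (scal s (L v))))).
    * intros s; now rewrite HL.
    * exact (proj1 (proj2 Hf (L v)) (L p) Hp).
  + apply (Ck_ext k _ (fun p => dirD f (L p) (L v))); [exact HU' | |].
    * intros p Hp; symmetry; now apply dirD_comp_linear.
    * apply (IH (fun p => dirD f p (L v))), Ck_dirD, Hf.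
Qed.

(** [E] is o(a), and a is O(y - s) because it vanishes at s and is differentiable there; hence [E]
    is o(y - s). *)
Lemma is_derive_zero_of_bound (E a : R -> R) (s w : R) :
  a s = 0 -> is_derive a s w ->
  (forall eps : posreal, locally s (fun y => Rabs (E y) <= eps * Rabs (a y))) ->
  is_derive E s 0.
Proof.
intros Has Ha HE.
assert (E0 : E s = 0).
{ pose proof (locally_singleton _ _ (HE (mkposreal 1 Rlt_0_1))) as H.
  cbv beta in H; rewrite Has, Rabs_R0, Rmult_0_r in H.
  pose proof (Rabs_pos (E s)); apply Rabs_eq_0; lra. }
split; [apply (is_linear_scal_l (0 : R)) |].
intros x Hx; assert (x = s)
  by (symmetry; exact (@is_filter_lim_locally_unique _ R_NormedModule s x Hx)); subst x; clear Hx.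
intros eps.
assert (Hw : 0 < Rabs w + 1) by (pose proof (Rabs_pos w); lra).
(* Near s one has |a y| <= (|w| + 1) |y - s|, which fixes the tolerance to ask of [E]. *)
assert (He : 0 < eps / (Rabs w + 1)) by (apply Rdiv_lt_0_compat; [apply eps | lra]).
specialize (HE (mkposreal _ He)).
destruct Ha as [_ Ha]; specialize (Ha s (fun P H => H) (mkposreal 1 Rlt_0_1)).
generalize (filter_and _ _ Ha HE); apply filter_imp; intros y [H1 H2].
simpl in H2; unfold norm, minus, plus, opp, scal, abs in *; simpl in *.
unfold mult, abs in *; simpl in *.
rewrite E0; rewrite Has in H1.
replace (E y + - 0 + - ((y + - s) * 0)) with (E y) by ring.
assert (H3 : Rabs (a y) <= (Rabs w + 1) * Rabs (y + - s)).
{ replace (a y) with ((a y + - 0 + - ((y + - s) * w)) + (y + - s) * w) by ring.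
  eapply Rle_trans; [apply Rabs_triang |].
  rewrite (Rabs_mult (y + - s)); lra. }
eapply Rle_trans; [exact H2 |].
transitivity (eps / (Rabs w + 1) * ((Rabs w + 1) * Rabs (y + - s))).
- apply Rmult_le_compat_l; lra.
- right; field; lra.
Qed.

(** Mean value theorem on the segment from p to p + a e: the increment is a times the directional
    derivative at an intermediate point, within eps of l. *)
Lemma increment_bound {V : NormedModule R_AbsRing} (U : V -> Prop) (f : V -> R)
    (p e : V) (a : R) (l eps : R) :
  Ck 1 U f ->
  (forall x : R, Rabs x <= Rabs a ->
     U (plus p (scal x e)) /\ Rabs (dirD f (plus p (scal x e)) e - l) <= eps) ->
  Rabs (f (plus p (scal a e)) - f p - a * l) <= eps * Rabs a.
Proof.
intros Hf H.
assert (Hd : forall x : R, Rabs x <= Rabs a ->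
  is_derive (fun x : R => f (plus p (scal x e))) x (dirD f (plus p (scal x e)) e)).
{ intros x Hx; apply is_derive_line.
  eexists; apply (is_derive_dirD 0 U); [exact Hf | now apply H]. }
assert (Hab : forall x, Rmin 0 a <= x <= Rmax 0 a -> Rabs x <= Rabs a).
{ intros x; unfold Rmin, Rmax, Rabs.
  destruct (Rle_dec 0 a), (Rcase_abs x), (Rcase_abs a); lra. }
destruct (MVT_gen (fun x : R => f (plus p (scal x e))) 0 a
  (fun x => dirD f (plus p (scal x e)) e)) as [c [Hc Hm]].
- intros x Hx; apply Hd, Hab; lra.
- intros x Hx; apply continuity_pt_filterlim.
  apply (ex_derive_continuous (fun x : R => f (plus p (scal x e)))).
  eexists; now apply Hd, Hab.
- rewrite line_0 in Hm; rewrite Hm.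
  replace (dirD f (plus p (scal c e)) e * (a - 0) - a * l)
    with ((dirD f (plus p (scal c e)) e - l) * a) by ring.
  rewrite Rabs_mult; apply Rmult_le_compat_r; [apply Rabs_pos |].
  now apply H, Hab.
Qed.

(** One step of the chain rule: a motion a(x) e in a new direction is added to a curve along which f
    is already differentiable. Continuity of [dirD f] in the base point does the work of total
    differentiability, which [Ck] does not state directly. *)
Lemma is_derive_increment {V : NormedModule R_AbsRing} (U : V -> Prop) (f : V -> R)
    (q : R -> V) (e : V) (a : R -> R) (s l w : R) :
  open U -> Ck 1 U f -> U (q s) -> continuous q s ->
  a s = 0 -> is_derive a s w -> is_derive (fun x => f (q x)) s l ->
  is_derive (fun x => f (plus (q x) (scal (a x) e))) s (l + w * dirD f (q s) e).
Proof.
intros HU Hf Hs Hq Has Ha Hl; set (d := dirD f (q s) e).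
(* The increment in the direction e is split into its linear part and a remainder, which is o(a) and
   so has derivative zero. *)
apply (is_derive_ext (fun x => f (q x) +
  ((f (plus (q x) (scal (a x) e)) - f (q x) - a x * d) + a x * d))).
{ intros x; simpl; ring. }
apply (is_derive_plus (fun x => f (q x))); [exact Hl |].
replace (w * d) with (0 + w * d) by ring.
apply (is_derive_plus
  (fun x => f (plus (q x) (scal (a x) e)) - f (q x) - a x * d) (fun x => a x * d)).
2: { apply (is_derive_ext (fun x => scal d (a x))).
     - intros x; apply Rmult_comm.
     - replace (w * d) with (scal d w) by apply Rmult_comm.
       now apply is_derive_scal. }
apply (is_derive_zero_of_bound _ a s w Has Ha); intros eps.
assert (HN : locally (q s) (fun p => U p /\ Rabs (dirD f p e - d) <= eps)).
{ apply filter_and; [now apply HU |].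
  assert (Hc : continuous (fun p => dirD f p e) (q s)).
  { apply (Ck_continuous 0 U); [now apply Ck_dirD | exact Hs]. }
  specialize (Hc (ball d eps) (locally_ball d eps)).
  unfold filtermap in Hc; revert Hc; apply filter_imp; intros p Hp.
  now apply Rlt_le. }
(* Joint continuity in the curve parameter and in the length of the step along e: it keeps the whole
   segment in the region where [dirD f] is close to its value at q s. *)
assert (Hm : continuous (fun z : R * R => plus (q (fst z)) (scal (snd z) e)) (s, 0)).
{ apply (continuous_plus (fun z : R * R => q (fst z)) (fun z : R * R => scal (snd z) e)).
  - apply (continuous_comp fst q); [apply continuous_fst | exact Hq].
  - apply (continuous_scal_l (fun z : R * R => snd z) e), continuous_snd. }
specialize (Hm (fun p => U p /\ Rabs (dirD f p e - d) <= eps)).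
cbn [fst snd] in Hm; rewrite line_0 in Hm; specialize (Hm HN).
destruct Hm as [delta Hm].
assert (Hca : continuous a s) by (apply (ex_derive_continuous a); now exists w).
specialize (Hca (ball (a s) delta) (locally_ball _ delta)).
unfold filtermap in Hca; rewrite Has in Hca.
generalize (filter_and _ _ Hca (locally_ball s delta)).
apply filter_imp; intros y [H1 H2].
apply (increment_bound U f (q y) e (a y) d eps Hf).
intros x Hx; apply (Hm (y, x)); split; [exact H2 |].
unfold ball in *; simpl in *; unfold AbsRing_ball, abs, minus, plus, opp in *; simpl in *.
rewrite Ropp_0, Rplus_0_r in *; lra.
Qed.

(** [V3] holds both the Hopf coordinates (eta, (xi1, xi2)) and space-time points (t, (x, y)); [V4]
    is the space containing the sphere. *)
Definition V3 := prod_NormedModule R_AbsRing R_NormedModule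
  (prod_NormedModule R_AbsRing R_NormedModule R_NormedModule).
Definition V2 := prod_NormedModule R_AbsRing R_NormedModule R_NormedModule.
Definition V4 := prod_NormedModule R_AbsRing V2 V2.

Lemma continuous_pair {T U W : UniformSpace} (f : T -> U) (g : T -> W) x :
  continuous f x -> continuous g x -> continuous (fun t => (f t, g t)) x.
Proof.
intros Hf Hg; apply (continuous_comp_2 f g (fun u w => (u, w))); try assumption.
apply (continuous_ext (fun z => z)); [now intros [u w] | apply continuous_id].
Qed.

Lemma continuous_pair4 {T : UniformSpace} (c1 c2 c3 c4 : T -> R) x :
  continuous c1 x -> continuous c2 x -> continuous c3 x -> continuous c4 x ->
  continuous (fun t => ((c1 t, c2 t), (c3 t, c4 t)) : V4) x.
Proof.
intros H1 H2 H3 H4.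
exact (continuous_pair _ _ x (continuous_pair c1 c2 x H1 H2) (continuous_pair c3 c4 x H3 H4)).
Qed.

Lemma continuous_pair3 {T : UniformSpace} (c1 c2 c3 : T -> R) x :
  continuous c1 x -> continuous c2 x -> continuous c3 x ->
  continuous (fun t => (c1 t, (c2 t, c3 t)) : V3) x.
Proof.
intros H1 H2 H3.
exact (continuous_pair _ _ x H1 (continuous_pair c2 c3 x H2 H3)).
Qed.

Lemma line4 (a b c d a' b' c' d' s : R) :
  plus (((a, b), (c, d)) : V4) (scal s (((a', b'), (c', d')) : V4)) =
  ((a + s * a', b + s * b'), (c + s * c', d + s * d')).
Proof. reflexivity. Qed.

Lemma line3 (a b c a' b' c' s : R) :
  plus ((a, (b, c)) : V3) (scal s ((a', (b', c')) : V3)) =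
  (a + s * a', (b + s * b', c + s * c')).
Proof. reflexivity. Qed.

(** The four coordinates are set in motion one after the other, each time by [is_derive_increment],
    starting from the constant curve. *)
Lemma is_derive_curve4 (U : R4 -> Prop) (f : R4 -> R) (c1 c2 c3 c4 : R -> R)
    (s w1 w2 w3 w4 : R) :
  open (U : V4 -> Prop) -> Ck 1 (U : V4 -> Prop) f -> U ((c1 s, c2 s), (c3 s, c4 s)) ->
  is_derive c1 s w1 -> is_derive c2 s w2 -> is_derive c3 s w3 -> is_derive c4 s w4 ->
  is_derive (fun x => f ((c1 x, c2 x), (c3 x, c4 x))) s
    (w1 * dirD (f : V4 -> R) ((c1 s, c2 s), (c3 s, c4 s)) ((1, 0), (0, 0))
     + w2 * dirD (f : V4 -> R) ((c1 s, c2 s), (c3 s, c4 s)) ((0, 1), (0, 0))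
     + w3 * dirD (f : V4 -> R) ((c1 s, c2 s), (c3 s, c4 s)) ((0, 0), (1, 0))
     + w4 * dirD (f : V4 -> R) ((c1 s, c2 s), (c3 s, c4 s)) ((0, 0), (0, 1))).
Proof.
intros HU Hf Hs H1 H2 H3 H4.
assert (Hc : forall (c : R -> R) (w : R), is_derive c s w -> continuous c s).
{ intros c w H; apply (ex_derive_continuous c); now exists w. }
pose proof (Hc _ _ H1) as Hc1; pose proof (Hc _ _ H2) as Hc2; pose proof (Hc _ _ H3) as Hc3.
assert (Hi : forall (c : R -> R) (w : R), is_derive c s w -> is_derive (fun x => c x - c s) s w).
{ intros c w H; replace w with (w - 0) by ring.
  apply (is_derive_minus c (fun _ => c s)); [exact H | exact (is_derive_const (V := R_NormedModule) (c s) s)]. }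
set (p := ((c1 s, c2 s), (c3 s, c4 s))) in *.
pose (q1 := fun x => (((c1 x, c2 s), (c3 s, c4 s)) : V4)).
pose (q2 := fun x => (((c1 x, c2 x), (c3 s, c4 s)) : V4)).
pose (q3 := fun x => (((c1 x, c2 x), (c3 x, c4 s)) : V4)).
assert (C1 : continuous q1 s) by (apply continuous_pair4; auto; apply continuous_const).
assert (C2 : continuous q2 s) by (apply continuous_pair4; auto; apply continuous_const).
assert (C3 : continuous q3 s) by (apply continuous_pair4; auto; apply continuous_const).
assert (K1 : is_derive (fun x => f (q1 x)) s (w1 * dirD (f : V4 -> R) p ((1, 0), (0, 0)))).
{ pose proof (is_derive_increment (V := V4) U f (fun _ => p) ((1, 0), (0, 0))
    (fun x => c1 x - c1 s) s 0 w1 HU Hf Hs (continuous_const _ _) (Rminus_diag_eq _ _ eq_refl)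
    (Hi c1 w1 H1) (is_derive_const (V := R_NormedModule) _ _)) as K.
  rewrite Rplus_0_l in K; revert K; apply is_derive_ext; intros x; f_equal.
  unfold q1, p; rewrite line4.
  repeat apply f_equal2; simpl; ring. }
assert (K2 : is_derive (fun x => f (q2 x)) s (w1 * dirD (f : V4 -> R) p ((1, 0), (0, 0))
  + w2 * dirD (f : V4 -> R) p ((0, 1), (0, 0)))).
{ pose proof (is_derive_increment (V := V4) U f q1 ((0, 1), (0, 0))
    (fun x => c2 x - c2 s) s _ w2 HU Hf Hs
    C1 (Rminus_diag_eq _ _ eq_refl) (Hi c2 w2 H2) K1) as K.
    revert K; apply is_derive_ext; intros x; f_equal.
  unfold q1, q2, p; rewrite line4.
  repeat apply f_equal2; simpl; ring. }
assert (K3 : is_derive (fun x => f (q3 x)) s (w1 * dirD (f : V4 -> R) p ((1, 0), (0, 0))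
  + w2 * dirD (f : V4 -> R) p ((0, 1), (0, 0)) + w3 * dirD (f : V4 -> R) p ((0, 0), (1, 0)))).
{ pose proof (is_derive_increment (V := V4) U f q2 ((0, 0), (1, 0))
    (fun x => c3 x - c3 s) s _ w3 HU Hf Hs
    C2 (Rminus_diag_eq _ _ eq_refl) (Hi c3 w3 H3) K2) as K.
    revert K; apply is_derive_ext; intros x; f_equal.
  unfold q2, q3, p; rewrite line4.
  repeat apply f_equal2; simpl; ring. }
pose proof (is_derive_increment (V := V4) U f q3 ((0, 0), (0, 1))
  (fun x => c4 x - c4 s) s _ w4 HU Hf Hs
    C3 (Rminus_diag_eq _ _ eq_refl) (Hi c4 w4 H4) K3) as K.
revert K; apply is_derive_ext; intros x; f_equal.
unfold q3, p; rewrite line4.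
repeat apply f_equal2; simpl; ring.
Qed.

Lemma is_derive_const_R (c x : R) : is_derive (fun _ : R => c) x 0.
Proof. exact (is_derive_const (V := R_NormedModule) c x). Qed.

(** A straight line is a curve whose coordinate velocities are the components of v, so linearity of
    the directional derivative in v is an instance of the chain rule. *)
Lemma dirD_basis4 (U : V4 -> Prop) (f : V4 -> R) (p v : V4) :
  open U -> Ck 1 U f -> U p ->
  dirD f p v =
    fst (fst v) * dirD f p ((1, 0), (0, 0)) + snd (fst v) * dirD f p ((0, 1), (0, 0))
    + fst (snd v) * dirD f p ((0, 0), (1, 0)) + snd (snd v) * dirD f p ((0, 0), (0, 1)).
Proof.
intros HU Hf Hp; destruct p as [[p1 p2] [p3 p4]], v as [[v1 v2] [v3 v4]].
assert (Hl : forall a b : R, is_derive (fun s : R => a + s * b) 0 b).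
{ intros a b; auto_derive; [easy | ring]. }
pose proof (is_derive_curve4 U f (fun s => p1 + s * v1) (fun s => p2 + s * v2)
  (fun s => p3 + s * v3) (fun s => p4 + s * v4) 0 v1 v2 v3 v4 HU Hf) as K.
cbv beta in K; rewrite !Rmult_0_l, !Rplus_0_r in K.
apply is_derive_unique, K; auto.
Qed.

Lemma is_derive_comp4 {V : NormedModule R_AbsRing} (W : V -> Prop) (U : V4 -> Prop)
    (f : V4 -> R) (g1 g2 g3 g4 : V -> R) (p v : V) :
  open U -> Ck 1 U f ->
  Ck 1 W g1 -> Ck 1 W g2 -> Ck 1 W g3 -> Ck 1 W g4 ->
  W p -> U ((g1 p, g2 p), (g3 p, g4 p)) ->
  is_derive (fun s : R => f ((g1 (plus p (scal s v)), g2 (plus p (scal s v))),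
                             (g3 (plus p (scal s v)), g4 (plus p (scal s v))))) 0
    (dirD g1 p v * dirD f ((g1 p, g2 p), (g3 p, g4 p)) ((1, 0), (0, 0))
     + dirD g2 p v * dirD f ((g1 p, g2 p), (g3 p, g4 p)) ((0, 1), (0, 0))
     + dirD g3 p v * dirD f ((g1 p, g2 p), (g3 p, g4 p)) ((0, 0), (1, 0))
     + dirD g4 p v * dirD f ((g1 p, g2 p), (g3 p, g4 p)) ((0, 0), (0, 1))).
Proof.
intros HU Hf H1 H2 H3 H4 Wp Up.
pose proof (is_derive_curve4 U f (fun s : R => g1 (plus p (scal s v)))
  (fun s : R => g2 (plus p (scal s v))) (fun s : R => g3 (plus p (scal s v)))
  (fun s : R => g4 (plus p (scal s v))) 0 (dirD g1 p v) (dirD g2 p v)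
  (dirD g3 p v) (dirD g4 p v) HU Hf) as K.
cbv beta in K; rewrite !line_0 in K; apply K; [exact Up | | | |];
  now apply (is_derive_dirD 0 W).
Qed.

(** By the chain rule the derivative is a sum of products whose factors are derivatives of the g's
    and partial derivatives of f along the same map; the induction hypothesis applies to the
    latter. *)
Lemma Ck_comp4 {V : NormedModule R_AbsRing} k (W : V -> Prop) (U : V4 -> Prop)
    (f : V4 -> R) (g1 g2 g3 g4 : V -> R) :
  open U -> open W -> (forall p, W p -> U ((g1 p, g2 p), (g3 p, g4 p))) ->
  Ck k U f -> Ck k W g1 -> Ck k W g2 -> Ck k W g3 -> Ck k W g4 ->
  Ck k W (fun p => f ((g1 p, g2 p), (g3 p, g4 p))).
Proof.
intros HU HW HWU; revert f; induction k as [|k IH]; intros f Hf H1 H2 H3 H4.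
- split; [| exact I]; intros p Hp.
  apply (continuous_comp (fun p => ((g1 p, g2 p), (g3 p, g4 p)) : V4) f);
    [| now apply (proj1 Hf), HWU].
  apply continuous_pair4; [now apply (proj1 H1) | now apply (proj1 H2)
    | now apply (proj1 H3) | now apply (proj1 H4)].
- assert (Hle : forall (V' : NormedModule R_AbsRing) (U' : V' -> Prop) h,
    Ck (S k) U' h -> Ck 1 U' h).
  { clear; induction k as [|k IH]; [auto |]; intros V' U' h H; apply IH, Ck_pred, H. }
  split; [| intros v; split].
  + intros p Hp.
    apply (continuous_comp (fun p => ((g1 p, g2 p), (g3 p, g4 p)) : V4) f);
      [| now apply (proj1 Hf), HWU].
    apply continuous_pair4; [now apply (proj1 H1) | now apply (proj1 H2)
      | now apply (proj1 H3) | now apply (proj1 H4)].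
  + intros p Hp; eexists; apply (is_derive_comp4 W U); auto.
  + apply (Ck_ext k W (fun p =>
      dirD g1 p v * dirD f ((g1 p, g2 p), (g3 p, g4 p)) ((1, 0), (0, 0))
      + dirD g2 p v * dirD f ((g1 p, g2 p), (g3 p, g4 p)) ((0, 1), (0, 0))
      + dirD g3 p v * dirD f ((g1 p, g2 p), (g3 p, g4 p)) ((0, 0), (1, 0))
      + dirD g4 p v * dirD f ((g1 p, g2 p), (g3 p, g4 p)) ((0, 0), (0, 1))));
      [exact HW | |].
    * intros p Hp; symmetry; apply is_derive_unique, (is_derive_comp4 W U); auto.
    * assert (HD : forall e g, Ck (S k) W g ->
        Ck k W (fun p => dirD g p v * dirD f ((g1 p, g2 p), (g3 p, g4 p)) e)).
      { intros e g Hg; apply Ck_mult; [exact HW | now apply Ck_dirD |].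
        apply (IH (fun q => dirD f q e)); [now apply Ck_dirD | | | |];
          now apply Ck_pred. }
      repeat apply Ck_plus; auto.
Qed.

(** Used to read the chain rule on [V3] off the one on [V4], with a constant fourth component. *)
Definition drop4 (p : V4) : V3 := (fst (fst p), (snd (fst p), fst (snd p))).

Lemma continuous_drop4 p : continuous drop4 p.
Proof.
destruct p as [[a b] [c d]]; apply continuous_pair3.
- apply (continuous_comp (fst : V4 -> V2) fst); apply continuous_fst.
- apply (continuous_comp (fst : V4 -> V2) snd); [apply continuous_fst | apply continuous_snd].
- apply (continuous_comp (snd : V4 -> V2) fst); [apply continuous_snd | apply continuous_fst].
Qed.

Lemma drop4_line (p v : V4) (s : R) :
  drop4 (plus p (scal s v)) = plus (drop4 p) (scal s (drop4 v)).
Proof. reflexivity. Qed.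

Lemma open_all {T : UniformSpace} : open (fun _ : T => True).
Proof. exact open_true. Qed.

Lemma Ck_drop4 k (f : V3 -> R) :
  Ck k (fun _ => True) f -> Ck k (fun _ => True) (fun p => f (drop4 p)).
Proof.
intros Hf; apply (Ck_comp_linear k (fun _ => True) drop4); auto using open_all.
- intros p; apply continuous_drop4.
Qed.

Lemma Ck_comp3 {V : NormedModule R_AbsRing} k (W : V -> Prop)
    (f : V3 -> R) (g1 g2 g3 : V -> R) :
  open W -> Ck k (fun _ => True) f -> Ck k W g1 -> Ck k W g2 -> Ck k W g3 ->
  Ck k W (fun p => f (g1 p, (g2 p, g3 p))).
Proof.
intros HW Hf H1 H2 H3.
apply (Ck_comp4 k W (fun _ => True) (fun p => f (drop4 p)) g1 g2 g3 (fun _ => 0));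
  auto using open_all, Ck_drop4, Ck_const.
Qed.

Lemma is_derive_comp3 {V : NormedModule R_AbsRing} (W : V -> Prop)
    (f : V3 -> R) (g1 g2 g3 : V -> R) (p v : V) :
  open W -> Ck 1 (fun _ => True) f -> Ck 1 W g1 -> Ck 1 W g2 -> Ck 1 W g3 -> W p ->
  is_derive (fun s : R => f (g1 (plus p (scal s v)),
                            (g2 (plus p (scal s v)), g3 (plus p (scal s v))))) 0
    (dirD g1 p v * dirD f (g1 p, (g2 p, g3 p)) (1, (0, 0))
     + dirD g2 p v * dirD f (g1 p, (g2 p, g3 p)) (0, (1, 0))
     + dirD g3 p v * dirD f (g1 p, (g2 p, g3 p)) (0, (0, 1))).
Proof.
intros HW Hf H1 H2 H3 Wp.
pose proof (is_derive_comp4 W (fun _ => True) (fun p => f (drop4 p)) g1 g2 g3 (fun _ => 0)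
  p v open_all (Ck_drop4 1 f Hf) H1 H2 H3 (Ck_const 1 W 0 HW) Wp I) as K.
rewrite !(dirD_comp_linear drop4 f _ _ drop4_line) in K.
unfold drop4 in K; cbn [fst snd] in K.
assert (Hz : dirD (fun _ : V => 0) p v = 0) by exact (Derive_const 0 0).
now rewrite Hz, Rmult_0_l, Rplus_0_r in K.
Qed.

Lemma continuous_line2 {V : NormedModule R_AbsRing} (p u v : V) z :
  continuous (fun z : R * R => plus (plus p (scal (fst z) u)) (scal (snd z) v)) z.
Proof.
apply (continuous_plus (fun z : R * R => plus p (scal (fst z) u))
  (fun z : R * R => scal (snd z) v)).
- apply (continuous_plus (fun z : R * R => p) (fun z : R * R => scal (fst z) u));
    [apply continuous_const |].
  apply (continuous_scal_l (fun z : R * R => fst z) u); destruct z; apply continuous_fst.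
- apply (continuous_scal_l (fun z : R * R => snd z) v); destruct z; apply continuous_snd.
Qed.

(** The function is restricted to the plane through p spanned by u and v, where [Schwarz] applies to
    two real variables; the rest translates partial derivatives at (a, b) into directional
    derivatives at the moved point. *)
Lemma dirD_comm {V : NormedModule R_AbsRing} (U : V -> Prop) (f : V -> R) (p u v : V) :
  open U -> Ck 2 U f -> U p ->
  dirD (fun q => dirD f q u) p v = dirD (fun q => dirD f q v) p u.
Proof.
intros HU Hf Hp.
assert (Hf1 : Ck 1 U f) by now apply Ck_pred.
set (P := fun a b : R => plus (plus p (scal a u)) (scal b v)).
assert (P0 : P 0 0 = p) by (unfold P; now rewrite !line_0).
assert (Hsw : forall a b : R, P a b = plus (plus p (scal b v)) (scal a u)).
{ intros a b; unfold P; rewrite <- !plus_assoc; f_equal; apply plus_comm. }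
assert (HO : forall a b, U (P a b) -> locally (a, b) (fun z => U (P (fst z) (snd z)))).
{ intros a b Hab; apply (continuous_line2 p u v (a, b)), HU, Hab. }
assert (HOa : forall a b, U (P a b) -> locally a (fun z => U (P z b))).
{ intros a b Hab; destruct (HO a b Hab) as [d Hd]; exists d; intros z Hz.
  apply (Hd (z, b)); split; [exact Hz | apply ball_center]. }
assert (HOb : forall a b, U (P a b) -> locally b (fun z => U (P a z))).
{ intros a b Hab; destruct (HO a b Hab) as [d Hd]; exists d; intros z Hz.
  apply (Hd (a, z)); split; [apply ball_center | exact Hz]. }
assert (HO2 : locally_2d (fun a b => U (P a b)) 0 0).
{ apply locally_2d_locally; apply HO; now rewrite P0. }
set (g := fun a b : R => f (P a b)).
assert (Dv : forall a b, U (P a b) -> is_derive (fun z => g a z) b (dirD f (P a b) v)).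
{ intros a b Hab; apply is_derive_line; eexists; now apply (is_derive_dirD 0 U). }
assert (Du : forall a b, U (P a b) -> is_derive (fun z => g z b) a (dirD f (P a b) u)).
{ intros a b Hab; apply (is_derive_ext (fun z : R => f (plus (plus p (scal b v)) (scal z u)))).
  - intros z; unfold g; now rewrite Hsw.
  - rewrite Hsw; apply is_derive_line; eexists; apply (is_derive_dirD 0 U); [exact Hf1 |].
    fold (P a b); now rewrite <- Hsw. }
assert (Dvu : forall a b, U (P a b) -> is_derive (fun z => Derive (fun t => g z t) b) a
  (dirD (fun q => dirD f q v) (P a b) u)).
{ intros a b Hab.
  apply (is_derive_ext_loc (fun z : R => dirD f (plus (plus p (scal b v)) (scal z u)) v)).
  - generalize (HOa a b Hab); apply filter_imp; intros z Hz.
    rewrite <- Hsw; symmetry; apply is_derive_unique, Dv, Hz.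
  - rewrite Hsw; apply (is_derive_line (fun q => dirD f q v)).
    eexists; apply (is_derive_dirD 0 U (fun q => dirD f q v)); [now apply Ck_dirD |].
    now rewrite <- Hsw. }
assert (Duv : forall a b, U (P a b) -> is_derive (fun z => Derive (fun t => g t z) a) b
  (dirD (fun q => dirD f q u) (P a b) v)).
{ intros a b Hab; apply (is_derive_ext_loc (fun z : R => dirD f (P a z) u)).
  - generalize (HOb a b Hab); apply filter_imp; intros z Hz.
    symmetry; apply is_derive_unique, Du, Hz.
  - apply (is_derive_line (fun q => dirD f q u)).
    eexists; apply (is_derive_dirD 0 U (fun q => dirD f q u)); [now apply Ck_dirD | exact Hab]. }
assert (Cc : forall w w', continuity_2d_pt (fun a b =>
  dirD (fun q => dirD f q w) (P a b) w') 0 0).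
{ intros w w'; refine (proj2 (continuity_2d_pt_filterlim _ 0 0) _).
  set (F := fun q => dirD (fun q => dirD f q w) q w').
  assert (HF : forall q, U q -> continuous F q).
  { intros q Hq; refine (Ck_continuous 0 U F q _ Hq).
    exact (Ck_dirD 0 _ _ w' (Ck_dirD 1 _ f w Hf)). }
  refine (continuous_comp _ F (0, 0) (continuous_line2 p u v (0, 0)) (HF _ _)).
  change (U (P 0 0)); now rewrite P0. }
assert (Up0 : U (P 0 0)) by now rewrite P0.
pose proof (Schwarz g 0 0) as K.
assert (Euv : Derive (fun z : R => Derive (fun t : R => g t z) 0) 0 =
  dirD (fun q => dirD f q u) p v).
{ rewrite <- P0 at 1; exact (is_derive_unique _ _ _ (Duv 0 0 Up0)). }
assert (Evu : Derive (fun z : R => Derive (fun t : R => g z t) 0) 0 =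
  dirD (fun q => dirD f q v) p u).
{ rewrite <- P0 at 1; exact (is_derive_unique _ _ _ (Dvu 0 0 Up0)). }
rewrite <- Euv, <- Evu; symmetry; apply K.
- apply (locally_2d_impl (fun a b => U (P a b))); [| exact HO2].
  apply locally_2d_forall; intros a b Hab.
  split; [exists (dirD f (P a b) u); exact (Du a b Hab) |].
  split; [exists (dirD f (P a b) v); exact (Dv a b Hab) |].
  split; eexists; [exact (Dvu a b Hab) | exact (Duv a b Hab)].
- apply (continuity_2d_pt_ext_loc (fun a b => dirD (fun q => dirD f q v) (P a b) u));
    [| apply Cc].
  apply (locally_2d_impl (fun a b => U (P a b))); [| exact HO2].
  apply locally_2d_forall; intros a b Hab; symmetry; apply is_derive_unique, Dvu, Hab.
- apply (continuity_2d_pt_ext_loc (fun a b => dirD (fun q => dirD f q u) (P a b) v));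
    [| apply Cc].
  apply (locally_2d_impl (fun a b => U (P a b))); [| exact HO2].
  apply locally_2d_forall; intros a b Hab; symmetry; apply is_derive_unique, Duv, Hab.
Qed.

(** * Multiple integrals *)

Lemma ex_RInt_cont (h : R -> R) (a b : R) : (forall x, continuous h x) -> ex_RInt h a b.
Proof. intros Hh; apply (ex_RInt_continuous (V := R_CompleteNormedModule)); auto. Qed.

(** Compactness of [a, b] turns continuity at each (p, s) into one neighbourhood of p on which f q
    is uniformly close to f p. *)
Lemma continuous_RInt_param_le {T : UniformSpace} (f : T -> R -> R) (a b : R) (p : T) :
  a <= b ->
  (forall q s, continuous (fun z : T * R => f (fst z) (snd z)) (q, s)) ->
  continuous (fun q => RInt (f q) a b) p.
Proof.
intros Hab Hf.
assert (Hf1 : forall q s, continuous (f q) s).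
{ intros q s; apply (continuous_comp (fun s => (q, s)) (fun z : T * R => f (fst z) (snd z)));
    [| apply Hf].
  apply continuous_pair; [apply continuous_const | apply continuous_id]. }
assert (Hex : forall q, ex_RInt (f q) a b).
{ intros q; now apply ex_RInt_cont. }
apply (proj2 (filterlim_locally (fun q => RInt (f q) a b) (RInt (f p) a b))).
intros eps.
assert (Hba : 0 < b - a + 1) by lra.
(* Halved because f q s' and f p s' are both compared with f p s; the added 1 keeps the denominator
   positive when a = b. *)
pose (eps' := mkposreal (eps / (b - a + 1) / 2)
  (Rlt_mult_inv_pos _ _ (Rdiv_lt_0_compat _ _ (cond_pos eps) Hba) Rlt_0_2)).
assert (HN : forall s, exists d : posreal, forall q s', ball p d q -> ball s d s' ->
  Rabs (f q s' - f p s') < eps / (b - a + 1)).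
{ intros s.
  pose proof (proj1 (filterlim_locally _ _) (Hf p s) eps') as [d Hd].
  exists d; intros q s' Hq Hs'.
  pose proof (Hd (q, s') (conj Hq Hs')) as K1.
  pose proof (Hd (p, s') (conj (ball_center p d) Hs')) as K2.
  unfold ball in K1, K2; simpl in K1, K2.
  unfold AbsRing_ball, abs, minus, plus, opp in K1, K2; simpl in K1, K2.
  set (e := eps / (b - a + 1)) in *.
  replace (f q s' - f p s') with ((f q s' + - f p s) - (f p s' + - f p s)) by ring.
  eapply Rle_lt_trans; [apply Rabs_triang | rewrite Rabs_Ropp; lra]. }
pose (delta := fun s => proj1_sig (constructive_indefinite_description _ (HN s))).
assert (Hdelta : forall s q s', ball p (delta s) q -> ball s (delta s) s' ->
  Rabs (f q s' - f p s') < eps / (b - a + 1)).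
{ intros s; exact (proj2_sig (constructive_indefinite_description _ (HN s))). }
destruct (compactness_value_1d a b delta) as [d Hd].
exists d; intros q Hq.
assert (HI : forall s, a <= s <= b -> Rabs (f q s - f p s) <= eps / (b - a + 1)).
(* [compactness_value_1d] yields the centre of a covering interval only under a double negation,
   hence the argument by contradiction. *)
{ intros s Hs; apply Rnot_lt_le; intros Hn; apply (Hd s Hs).
  intros [t [Ht [Hst Hdt]]].
  assert (K : Rabs (f q s - f p s) < eps / (b - a + 1)).
  { apply (Hdelta t); [now apply (ball_le p d) | exact Hst]. }
  lra. }
change (Rabs (RInt (f q) a b - RInt (f p) a b) < eps).
assert (E : RInt (f q) a b - RInt (f p) a b = RInt (fun s => f q s - f p s) a b).
{ symmetry; apply (RInt_minus (V := R_CompleteNormedModule) (f q) (f p)); apply Hex. }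
rewrite E.
apply Rle_lt_trans with ((b - a) * (eps / (b - a + 1))).
- apply abs_RInt_le_const; [exact Hab | | exact HI].
  apply (ex_RInt_minus (V := R_NormedModule)); apply Hex.
- pose proof (cond_pos eps) as He.
  apply Rmult_lt_reg_r with (b - a + 1); [exact Hba |].
  replace ((b - a) * (eps / (b - a + 1)) * (b - a + 1)) with ((b - a) * eps) by (field; lra).
  nra.
Qed.

Lemma continuous_RInt_param {T : UniformSpace} (f : T -> R -> R) (a b : R) (p : T) :
  (forall q s, continuous (fun z : T * R => f (fst z) (snd z)) (q, s)) ->
  continuous (fun q => RInt (f q) a b) p.
Proof.
intros Hf; destruct (Rle_dec a b) as [Hab | Hab];
  [now apply continuous_RInt_param_le |].
apply (continuous_ext (fun q => opp (RInt (f q) b a))).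
- intros q; apply (opp_RInt_swap (V := R_CompleteNormedModule)).
  apply ex_RInt_cont; intros s.
  apply (continuous_comp (fun s => (q, s)) (fun z : T * R => f (fst z) (snd z)));
    [| apply Hf].
  apply continuous_pair; [apply continuous_const | apply continuous_id].
- apply (continuous_opp (V := R_NormedModule)), continuous_RInt_param_le; [lra | exact Hf].
Qed.

Lemma continuous_slice2 (f : R -> R -> R) :
  (forall x y, continuous (fun z : R * R => f (fst z) (snd z)) (x, y)) ->
  forall x y, continuous (f x) y /\ continuous (fun x => f x y) x.
Proof.
intros Hf x y; split.
- apply (continuous_comp (fun s => (x, s)) (fun z : R * R => f (fst z) (snd z)));
    [| apply Hf].
  apply continuous_pair; [apply continuous_const | apply continuous_id].
- apply (continuous_comp (fun s => (s, y)) (fun z : R * R => f (fst z) (snd z)));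
    [| apply Hf].
  apply continuous_pair; [apply continuous_id | apply continuous_const].
Qed.

Lemma continuous_swap2 (f : R -> R -> R) :
  (forall x y, continuous (fun z : R * R => f (fst z) (snd z)) (x, y)) ->
  forall x y, continuous (fun z : R * R => f (snd z) (fst z)) (x, y).
Proof.
intros Hf x y.
apply (continuous_comp (fun z : R * R => (snd z, fst z))
  (fun z : R * R => f (fst z) (snd z))); [| apply Hf].
apply continuous_pair; [apply continuous_snd | apply continuous_fst].
Qed.

(* Both sides are primitives, in the upper bound [b], of the inner integral. *)
Lemma RInt_fubini (f : R -> R -> R) (a b c d : R) :
  (forall x y, continuous (fun z : R * R => f (fst z) (snd z)) (x, y)) ->
  RInt (fun x => RInt (f x) c d) a b = RInt (fun y => RInt (fun x => f x y) a b) c d.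
Proof.
intros Hf.
assert (Hf1 : forall x y, continuous (f x) y) by (intros x y; exact (proj1 (continuous_slice2 f Hf x y))).
assert (Hf2 : forall y x, continuous (fun x => f x y) x)
  by (intros y x; exact (proj2 (continuous_slice2 f Hf x y))).
assert (Hex : forall y u v, ex_RInt (fun x => f x y) u v).
{ intros y u v; now apply ex_RInt_cont. }
assert (HG : forall x y, continuous (fun y => RInt (fun u => f u y) a x) y).
{ intros x y; apply (continuous_RInt_param (fun y u => f u y)).
  now apply continuous_swap2. }
assert (HD : forall x y, is_derive (fun z => RInt (fun u => f u y) a z) x (f x y)).
{ intros x y; apply (is_derive_RInt (fun u => f u y) (fun z => RInt (fun u => f u y) a z) a x);
    [| apply Hf2].
  exists (mkposreal 1 Rlt_0_1); intros z _; apply (RInt_correct (V := R_CompleteNormedModule)), Hex. }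
assert (Hder : forall x, is_derive (fun x => RInt (fun y => RInt (fun u => f u y) a x) c d) x
  (RInt (f x) c d)).
{ intros x.
  replace (RInt (f x) c d) with
    (RInt (fun y => Derive (fun z => RInt (fun u => f u y) a z) x) c d).
  2: { apply RInt_ext; intros y _; apply is_derive_unique, HD. }
  apply (is_derive_RInt_param (fun x y => RInt (fun u => f u y) a x) c d x).
  - exists (mkposreal 1 Rlt_0_1); intros z _ y _; eexists; apply HD.
  - intros y _; apply (continuity_2d_pt_ext f).
    + intros u v; symmetry; apply is_derive_unique, HD.
    + exact (proj2 (continuity_2d_pt_filterlim f x y) (Hf x y)).
  - exists (mkposreal 1 Rlt_0_1); intros z _.
    now apply ex_RInt_cont. }
assert (H0 : RInt (fun y => RInt (fun x => f x y) a a) c d = 0).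
{ transitivity (RInt (fun _ => 0) c d).
  - apply RInt_ext; intros y _; exact (RInt_point a (fun x => f x y)).
  - rewrite RInt_const; unfold scal; simpl; unfold mult; simpl; ring. }
apply is_RInt_unique.
replace (RInt (fun y => RInt (fun x => f x y) a b) c d) with
  (minus (RInt (fun y => RInt (fun x => f x y) a b) c d)
         (RInt (fun y => RInt (fun x => f x y) a a) c d)).
2: { rewrite H0; unfold minus, plus, opp; simpl; ring. }
apply (is_RInt_derive (V := R_CompleteNormedModule)
  (fun x => RInt (fun y => RInt (fun u => f u y) a x) c d)); intros x _.
- apply Hder.
- apply continuous_RInt_param, Hf.
Qed.

Definition RInt3 (G : V3 -> R) (a b c d e f : R) : R :=
  RInt (fun x => RInt (fun y => RInt (fun z => G (x, (y, z))) e f) c d) a b.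

Lemma continuous_triple (G : V3 -> R) (T : UniformSpace) (g1 g2 g3 : T -> R) p :
  (forall p, continuous G p) ->
  continuous g1 p -> continuous g2 p -> continuous g3 p ->
  continuous (fun t => G (g1 t, (g2 t, g3 t))) p.
Proof.
intros HG H1 H2 H3.
exact (continuous_comp _ G p (continuous_pair3 g1 g2 g3 p H1 H2 H3) (HG _)).
Qed.

Lemma continuous_fst_fst {T U W : UniformSpace} (z : (T * U) * W) :
  continuous (fun z => fst (fst z)) z.
Proof.
apply (continuous_comp (fst : (T * U) * W -> T * U) fst); destruct z as [[? ?] ?];
  apply continuous_fst.
Qed.

Lemma continuous_snd_fst {T U W : UniformSpace} (z : (T * U) * W) :
  continuous (fun z => snd (fst z)) z.
Proof.
apply (continuous_comp (fst : (T * U) * W -> T * U) snd); destruct z as [[? ?] ?];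
  [apply continuous_fst | apply continuous_snd].
Qed.

Lemma continuous_RInt_inner (G : V3 -> R) (e f x y : R) :
  (forall p, continuous G p) ->
  continuous (fun z : R * R => RInt (fun s => G (fst z, (snd z, s))) e f) (x, y).
Proof.
intros HG; apply (continuous_RInt_param (fun (z : R * R) s => G (fst z, (snd z, s)))).
intros [q1 q2] s; apply continuous_triple; [exact HG | | |].
- apply continuous_fst_fst.
- apply continuous_snd_fst.
- apply continuous_snd.
Qed.

Lemma continuous_slice_pair (G : V3 -> R) (x y z : R) :
  (forall p, continuous G p) ->
  continuous (fun w : R * R => G (x, (fst w, snd w))) (y, z).
Proof.
intros HG; apply continuous_triple;
  [exact HG | apply continuous_const | apply continuous_fst | apply continuous_snd].
Qed.

Lemma RInt3_swap12 (G : V3 -> R) (a b c d e f : R) :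
  (forall p, continuous G p) ->
  RInt3 G a b c d e f =
  RInt (fun y => RInt (fun x => RInt (fun z => G (x, (y, z))) e f) a b) c d.
Proof.
intros HG; apply (RInt_fubini (fun x y => RInt (fun z => G (x, (y, z))) e f)).
intros x y; now apply continuous_RInt_inner.
Qed.

Lemma RInt3_swap23 (G : V3 -> R) (a b c d e f : R) :
  (forall p, continuous G p) ->
  RInt3 G a b c d e f =
  RInt (fun x => RInt (fun z => RInt (fun y => G (x, (y, z))) c d) e f) a b.
Proof.
intros HG; apply RInt_ext; intros x _.
apply (RInt_fubini (fun y z => G (x, (y, z)))).
intros y z; now apply continuous_slice_pair.
Qed.

Lemma ex_RInt_slices (G : V3 -> R) (a b c d e f : R) :
  (forall p, continuous G p) ->
  ex_RInt (fun x => RInt (fun y => RInt (fun z => G (x, (y, z))) e f) c d) a b /\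
  (forall x, ex_RInt (fun y => RInt (fun z => G (x, (y, z))) e f) c d) /\
  (forall x y, ex_RInt (fun z => G (x, (y, z))) e f).
Proof.
intros HG.
assert (HI : forall x y,
  continuous (fun z : R * R => RInt (fun s => G (fst z, (snd z, s))) e f) (x, y)).
{ intros x y; now apply continuous_RInt_inner. }
split; [| split].
- apply ex_RInt_cont; intros x.
  apply (continuous_RInt_param (fun x y => RInt (fun z => G (x, (y, z))) e f)), HI.
- intros x; apply ex_RInt_cont; intros y.
  exact (proj1 (continuous_slice2 (fun x y => RInt (fun z => G (x, (y, z))) e f) HI x y)).
- intros x y; apply ex_RInt_cont; intros z.
  apply (continuous_triple G _ (fun _ => x) (fun _ => y) (fun z => z)); auto;
    solve [apply continuous_const | apply continuous_id].
Qed.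

Lemma continuous_scal_R {T : UniformSpace} (f : T -> R) (l : R) :
  (forall q, continuous f q) -> forall q, continuous (fun q => l * f q) q.
Proof.
intros Hf q; apply (continuous_mult (fun _ => l) f); [apply continuous_const | apply Hf].
Qed.

Lemma continuous_plus_R {T : UniformSpace} (f g : T -> R) :
  (forall q, continuous f q) -> (forall q, continuous g q) ->
  forall q, continuous (fun q => f q + g q) q.
Proof. intros Hf Hg q; apply (continuous_plus f g); auto. Qed.

Lemma RInt3_ext (G H : V3 -> R) (a b c d e f : R) :
  (forall x y z, Rmin a b < x < Rmax a b -> Rmin c d < y < Rmax c d ->
     Rmin e f < z < Rmax e f -> G (x, (y, z)) = H (x, (y, z))) ->
  RInt3 G a b c d e f = RInt3 H a b c d e f.
Proof.
intros E; apply RInt_ext; intros x Hx; apply RInt_ext; intros y Hy;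
  apply RInt_ext; intros z Hz; auto.
Qed.

Lemma RInt3_plus (G H : V3 -> R) (a b c d e f : R) :
  (forall p, continuous G p) -> (forall p, continuous H p) ->
  RInt3 (fun p => G p + H p) a b c d e f = RInt3 G a b c d e f + RInt3 H a b c d e f.
Proof.
intros HG HH.
destruct (ex_RInt_slices G a b c d e f HG) as [G1 [G2 G3]].
destruct (ex_RInt_slices H a b c d e f HH) as [H1 [H2 H3]].
unfold RInt3.
etransitivity; [| exact (RInt_plus _ _ a b G1 H1)].
apply RInt_ext; intros x _.
etransitivity;
  [| exact (RInt_plus _ _ c d (G2 x) (H2 x))].
apply RInt_ext; intros y _.
exact (RInt_plus _ _ e f (G3 x y) (H3 x y)).
Qed.

Lemma RInt3_scal (G : V3 -> R) (l a b c d e f : R) :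
  (forall p, continuous G p) ->
  RInt3 (fun p => l * G p) a b c d e f = l * RInt3 G a b c d e f.
Proof.
intros HG.
destruct (ex_RInt_slices G a b c d e f HG) as [G1 [G2 G3]].
unfold RInt3.
etransitivity;
  [| exact (RInt_scal _ a b l G1)].
apply RInt_ext; intros x _.
etransitivity;
  [| exact (RInt_scal _ c d l (G2 x))].
apply RInt_ext; intros y _.
exact (RInt_scal _ e f l (G3 x y)).
Qed.

Lemma RInt_FTC (h : R -> R) (h' : R -> R) (a b : R) :
  (forall x, is_derive h x (h' x)) -> (forall x, continuous h' x) ->
  RInt h' a b = h b - h a.
Proof.
intros Hd Hc; apply is_RInt_unique.
apply (is_RInt_derive (V := R_CompleteNormedModule) h h'); auto.
Qed.

Lemma RInt_mult_r (h : R -> R) (l a b : R) : (forall x, continuous h x) ->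
  RInt (fun x => h x * l) a b = RInt h a b * l.
Proof.
intros Hh; rewrite (Rmult_comm _ l).
refine (eq_trans _ (RInt_scal (V := R_CompleteNormedModule) h a b l (ex_RInt_cont h a b Hh))).
apply RInt_ext; intros x _; apply Rmult_comm.
Qed.

Lemma RInt_zero (a b : R) : RInt (fun _ => 0) a b = 0.
Proof. rewrite RInt_const; unfold scal; simpl; unfold mult; simpl; ring. Qed.

Lemma is_derive_slices (S : V3 -> R) (x y z : R) :
  Ck 1 (fun _ => True) S ->
  is_derive (fun s => S (s, (y, z))) x (dirD S (x, (y, z)) (1, (0, 0))) /\
  is_derive (fun s => S (x, (s, z))) y (dirD S (x, (y, z)) (0, (1, 0))) /\
  is_derive (fun s => S (x, (y, s))) z (dirD S (x, (y, z)) (0, (0, 1))).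
Proof.
intros HS.
assert (K : forall p v s, is_derive (fun x : R => S (plus p (scal x v))) s
  (dirD S (plus p (scal s v)) v)).
{ intros p v s; apply is_derive_line.
  eexists; exact (is_derive_dirD 0 (fun _ => True) S _ v HS I). }
split; [pose proof (K (0, (y, z)) (1, (0, 0)) x) as L
  | split; [pose proof (K (x, (0, z)) (0, (1, 0)) y) as L
  | pose proof (K (x, (y, 0)) (0, (0, 1)) z) as L]];
  rewrite line3, Rplus_0_l, Rmult_1_r, !Rmult_0_r, !Rplus_0_r in L;
  refine (is_derive_ext _ _ _ _ _ L); intros s; rewrite line3;
  now rewrite Rplus_0_l, Rmult_1_r, !Rmult_0_r, !Rplus_0_r.
Qed.

Lemma RInt3_rotate (G : V3 -> R) (a b c d e f : R) : (forall q, continuous G q) ->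
  RInt3 G a b c d e f =
  RInt (fun y => RInt (fun z => RInt (fun x => G (x, (y, z))) a b) e f) c d.
Proof.
intros HG; rewrite RInt3_swap12 by exact HG; apply RInt_ext; intros y _.
apply (RInt_fubini (fun x z => G (x, (y, z)))); intros x z.
apply (continuous_triple G _ (fun w : R * R => fst w) (fun _ => y) (fun w => snd w)); auto;
  [apply continuous_fst | apply continuous_const | apply continuous_snd].
Qed.

Lemma RInt_dirD (S : V3 -> R) (a b x y z : R) : Ck 1 (fun _ => True) S ->
  RInt (fun s => dirD S (s, (y, z)) (1, (0, 0))) a b = S (b, (y, z)) - S (a, (y, z)) /\
  RInt (fun s => dirD S (x, (s, z)) (0, (1, 0))) a b = S (x, (b, z)) - S (x, (a, z)) /\
  RInt (fun s => dirD S (x, (y, s)) (0, (0, 1))) a b = S (x, (y, b)) - S (x, (y, a)).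
Proof.
intros HS.
assert (Hc : forall v p, continuous (fun p => dirD S p v) p).
{ intros v p; exact (Ck_continuous 0 (fun _ => True) _ p (Ck_dirD 0 _ S v HS) I). }
split; [| split].
- apply (RInt_FTC (fun s => S (s, (y, z)))); intros s;
    [exact (proj1 (is_derive_slices S s y z HS)) |].
  apply (continuous_triple _ _ (fun s => s) (fun _ => y) (fun _ => z) s (Hc (1, (0, 0))));
    solve [apply continuous_id | apply continuous_const].
- apply (RInt_FTC (fun s => S (x, (s, z)))); intros s;
    [exact (proj1 (proj2 (is_derive_slices S x s z HS))) |].
  apply (continuous_triple _ _ (fun _ => x) (fun s => s) (fun _ => z) s (Hc (0, (1, 0))));
    solve [apply continuous_id | apply continuous_const].
- apply (RInt_FTC (fun s => S (x, (y, s)))); intros s;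
    [exact (proj2 (proj2 (is_derive_slices S x y s HS))) |].
  apply (continuous_triple _ _ (fun _ => x) (fun _ => y) (fun s => s) s (Hc (0, (0, 1))));
    solve [apply continuous_id | apply continuous_const].
Qed.

Lemma RInt2_zero (h : R -> R -> R) (a b c d : R) :
  (forall x y, h x y = 0) -> RInt (fun x => RInt (h x) c d) a b = 0.
Proof.
intros Hh; transitivity (RInt (fun _ => 0) a b); [| apply RInt_zero].
apply RInt_ext; intros x _; transitivity (RInt (fun _ => 0) c d); [| apply RInt_zero].
now apply RInt_ext.
Qed.

(** Fubini makes the differentiated variable innermost, where the integral is a difference of
    boundary values. With its analogues in y and z this is the form in which Stokes' theorem is
    used, both on the sphere and on the disk. *)
Lemma RInt3_partial_x (S : V3 -> R) (a b c d e f : R) :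
  Ck 1 (fun _ => True) S -> (forall y z : R, S (b, (y, z)) = S (a, (y, z))) ->
  RInt3 (fun p => dirD S p (1, (0, 0))) a b c d e f = 0.
Proof.
intros HS Hper; rewrite RInt3_rotate.
- apply (RInt2_zero (fun y z => RInt (fun x => dirD S (x, (y, z)) (1, (0, 0))) a b)); intros y z.
  exact (eq_trans (proj1 (RInt_dirD S a b 0 y z HS)) (Rminus_diag_eq _ _ (Hper y z))).
- intros p; exact (Ck_continuous 0 (fun _ => True) _ p (Ck_dirD 0 _ S _ HS) I).
Qed.

Lemma RInt3_partial_y (S : V3 -> R) (a b c d e f : R) :
  Ck 1 (fun _ => True) S -> (forall x z : R, S (x, (d, z)) = S (x, (c, z))) ->
  RInt3 (fun p => dirD S p (0, (1, 0))) a b c d e f = 0.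
Proof.
intros HS Hper; rewrite RInt3_swap23.
- apply (RInt2_zero (fun x z => RInt (fun y => dirD S (x, (y, z)) (0, (1, 0))) c d)); intros x z.
  exact (eq_trans (proj1 (proj2 (RInt_dirD S c d x 0 z HS))) (Rminus_diag_eq _ _ (Hper x z))).
- intros p; exact (Ck_continuous 0 (fun _ => True) _ p (Ck_dirD 0 _ S _ HS) I).
Qed.

Lemma RInt3_partial_z (S : V3 -> R) (a b c d e f : R) :
  Ck 1 (fun _ => True) S -> (forall x y : R, S (x, (y, f)) = S (x, (y, e))) ->
  RInt3 (fun p => dirD S p (0, (0, 1))) a b c d e f = 0.
Proof.
intros HS Hper.
apply (RInt2_zero (fun x y => RInt (fun z => dirD S (x, (y, z)) (0, (0, 1))) e f)); intros x y.
exact (eq_trans (proj2 (proj2 (RInt_dirD S e f x y 0 HS))) (Rminus_diag_eq _ _ (Hper x y))).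
Qed.

(** * One-forms, pullback and Stokes' theorem on the sphere *)

Definition co1 (p : V4) : R := fst (fst p).
Definition co2 (p : V4) : R := snd (fst p).
Definition co3 (p : V4) : R := fst (snd p).
Definition co4 (p : V4) : R := snd (snd p).
Definition b1 : V4 := ((1, 0), (0, 0)).
Definition b2 : V4 := ((0, 1), (0, 0)).
Definition b3 : V4 := ((0, 0), (1, 0)).
Definition b4 : V4 := ((0, 0), (0, 1)).
Definition nonzero4 (p : V4) : Prop := p <> zero.

Lemma Ck_coordinates4 k (U : V4 -> Prop) : open U ->
  Ck k U co1 /\ Ck k U co2 /\ Ck k U co3 /\ Ck k U co4.
Proof.
intros HU; split; [| split; [| split]]; apply Ck_linear; try exact HU;
  try (intros p v s; reflexivity); intros p.
- exact (@continuous_fst_fst R_UniformSpace R_UniformSpace V2 p).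
- exact (@continuous_snd_fst R_UniformSpace R_UniformSpace V2 p).
- apply (continuous_comp (snd : V4 -> V2) fst); destruct p as [? [? ?]];
    [apply continuous_snd | apply continuous_fst].
- apply (continuous_comp (snd : V4 -> V2) snd); destruct p as [? [? ?]];
    apply continuous_snd.
Qed.

Lemma Ck_coordinates3 k :
  Ck k (fun _ : V3 => True) (fun q => fst q) /\
  Ck k (fun _ : V3 => True) (fun q => fst (snd q)) /\
  Ck k (fun _ : V3 => True) (fun q => snd (snd q)).
Proof.
split; [| split]; apply Ck_linear; try exact open_all;
  try (intros p v s; reflexivity); intros p.
- destruct p; apply continuous_fst.
- apply (continuous_comp (snd : V3 -> V2) fst); destruct p as [? [? ?]];
    [apply continuous_snd | apply continuous_fst].
- apply (continuous_comp (snd : V3 -> V2) snd); destruct p as [? [? ?]];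
    apply continuous_snd.
Qed.

Lemma nonzero_iff (p : V4) : nonzero4 p <-> 0 < dot4 p p.
Proof.
destruct p as [[a b] [c d]]; unfold dot4; simpl; split.
- intros H; apply Rnot_le_lt; intros Hl; apply H.
  pose proof (Rle_0_sqr a); pose proof (Rle_0_sqr b); pose proof (Rle_0_sqr c);
    pose proof (Rle_0_sqr d).
  assert (a = 0 /\ b = 0 /\ c = 0 /\ d = 0) as [-> [-> [-> ->]]].
  { repeat split; apply Rsqr_0_uniq; unfold Rsqr in *; lra. }
  reflexivity.
- intros H E; change (((a, b), (c, d)) = ((0, 0), (0, 0))) in E.
  injection E as -> -> -> ->; lra.
Qed.

Lemma Ck_dot4 k (U : V4 -> Prop) : open U -> Ck k U (fun p => dot4 p p).
Proof.
intros HU; destruct (Ck_coordinates4 k U HU) as [H1 [H2 [H3 H4]]].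
unfold dot4; repeat apply Ck_plus; try exact HU; now apply Ck_mult.
Qed.

Lemma open_superlevel {V : NormedModule R_AbsRing} (f : V -> R) (c : R) :
  (forall p, continuous f p) -> open (fun p => c < f p).
Proof.
intros Hf p Hp; apply (Hf p (fun y => c < y)), (open_gt c), Hp.
Qed.

Lemma open_ext_iff {T : UniformSpace} (U W : T -> Prop) :
  (forall p, U p <-> W p) -> open U -> open W.
Proof.
intros E HU p Hp; generalize (HU p (proj2 (E p) Hp)); apply filter_imp; intros q; apply E.
Qed.

Lemma open_nonzero : open nonzero4.
Proof.
apply (open_ext_iff (fun p => 0 < dot4 p p)); [intros p; now rewrite nonzero_iff |].
apply (open_superlevel (V := V4) (fun p => dot4 p p)); intros p.
exact (Ck_continuous 0 (fun _ => True) _ p (Ck_dot4 0 _ open_all) I).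
Qed.

Lemma one_form_basis (beta : R4 -> R4 -> R) (p v : V4) :
  one_form beta -> nonzero4 p ->
  beta p v = co1 v * beta p b1 + co2 v * beta p b2 + co3 v * beta p b3 + co4 v * beta p b4.
Proof.
intros [Hl _] Hp.
(* Linearity is given as one identity for a u + v; taking u = v = 0 and a = 1 shows that the form
   vanishes on the zero vector. *)
assert (Z : beta p (zero : V4) = 0).
{ assert (E : beta p (plus (scal 1 (zero : V4)) (zero : V4)) =
    1 * beta p (zero : V4) + beta p (zero : V4)) by exact (Hl p zero zero 1 Hp).
  assert (E' : plus (scal 1 (zero : V4)) (zero : V4) = zero).
  { exact (eq_trans (plus_zero_r (scal 1 (zero : V4))) (scal_zero_r (V := V4) 1)). }
  rewrite E' in E; set (w := beta p (zero : V4)) in *.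
  change (w = 1 * w + w) in E; lra. }
destruct v as [[v1 v2] [v3 v4]]; unfold co1, co2, co3, co4; simpl.
transitivity (beta p (plus (scal v1 b1) (plus (scal v2 b2)
  (plus (scal v3 b3) (plus (scal v4 b4) (zero : V4)))))).
- f_equal.
  change (((v1, v2), (v3, v4)) = (
    (v1 * 1 + (v2 * 0 + (v3 * 0 + (v4 * 0 + 0))), v1 * 0 + (v2 * 1 + (v3 * 0 + (v4 * 0 + 0)))),
    (v1 * 0 + (v2 * 0 + (v3 * 1 + (v4 * 0 + 0))), v1 * 0 + (v2 * 0 + (v3 * 0 + (v4 * 1 + 0)))))).
  repeat apply f_equal2; symmetry; match goal with |- ?x = ?y => change (@eq R x y) end; ring.
- rewrite !Hl by exact Hp; rewrite Z; ring.
Qed.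

Lemma one_form_Ck k (beta : R4 -> R4 -> R) (v : V4) :
  one_form beta -> Ck k nonzero4 (fun p => beta p v).
Proof. intros [_ Hs]; exact (Hs v k). Qed.

Lemma is_derive_sum4 (f1 f2 f3 f4 g1 g2 g3 g4 : R -> R) (s k1 k2 k3 k4 l1 l2 l3 l4 : R) :
  is_derive f1 s k1 -> is_derive f2 s k2 -> is_derive f3 s k3 -> is_derive f4 s k4 ->
  is_derive g1 s l1 -> is_derive g2 s l2 -> is_derive g3 s l3 -> is_derive g4 s l4 ->
  is_derive (fun x => f1 x * g1 x + f2 x * g2 x + f3 x * g3 x + f4 x * g4 x) s
    ((k1 * g1 s + f1 s * l1) + (k2 * g2 s + f2 s * l2) + (k3 * g3 s + f3 s * l3)
     + (k4 * g4 s + f4 s * l4)).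
Proof.
intros F1 F2 F3 F4 G1 G2 G3 G4.
assert (M : forall (f g : R -> R) (k l : R), is_derive f s k -> is_derive g s l ->
  is_derive (fun x => f x * g x) s (k * g s + f s * l)).
{ intros f g k l Hf Hg; exact (is_derive_mult f g s k l Hf Hg Rmult_comm). }
assert (P : forall (f g : R -> R) (k l : R), is_derive f s k -> is_derive g s l ->
  is_derive (fun x => f x + g x) s (k + l)).
{ intros f g k l Hf Hg; exact (is_derive_plus f g s k l Hf Hg). }
apply (P (fun x => f1 x * g1 x + f2 x * g2 x + f3 x * g3 x) (fun x => f4 x * g4 x));
  [| now apply M].
apply (P (fun x => f1 x * g1 x + f2 x * g2 x) (fun x => f3 x * g3 x)); [| now apply M].
now apply (P (fun x => f1 x * g1 x) (fun x => f2 x * g2 x)); apply M.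
Qed.

Lemma dirD_one_form (beta : R4 -> R4 -> R) (p u v : V4) :
  one_form beta -> nonzero4 p ->
  dirD (fun q => beta q v) p u =
    co1 v * dirD (fun q => beta q b1) p u + co2 v * dirD (fun q => beta q b2) p u
    + co3 v * dirD (fun q => beta q b3) p u + co4 v * dirD (fun q => beta q b4) p u.
Proof.
intros Hb Hp.
rewrite (dirD_ext_open nonzero4 _ (fun q => co1 v * beta q b1 + co2 v * beta q b2
  + co3 v * beta q b3 + co4 v * beta q b4) p u open_nonzero Hp).
2: { intros q Hq; now apply one_form_basis. }
assert (D : forall e, is_derive (fun s : R => beta (plus p (scal s u)) e) 0
  (dirD (fun q => beta q e) p u)).
{ intros e; exact (is_derive_dirD 0 nonzero4 (fun q => beta q e) p u
    (one_form_Ck 1 beta e Hb) Hp). }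
apply is_derive_unique.
pose proof (is_derive_sum4 _ _ _ _ _ _ _ _ 0 _ _ _ _ _ _ _ _
  (is_derive_const_R (co1 v) 0) (is_derive_const_R (co2 v) 0)
  (is_derive_const_R (co3 v) 0) (is_derive_const_R (co4 v) 0)
  (D b1) (D b2) (D b3) (D b4)) as K.
cbv beta in K.
rewrite !Rmult_0_l, !Rplus_0_l in K; exact K.
Qed.

(** The differential of [h] at [q] on the vector [a]; it plays for maps the role of [D4] for
    curves. *)
Definition d4 {V : NormedModule R_AbsRing} (h : V -> V4) (q a : V) : V4 :=
  ((dirD (fun q => co1 (h q)) q a, dirD (fun q => co2 (h q)) q a),
   (dirD (fun q => co3 (h q)) q a, dirD (fun q => co4 (h q)) q a)).

Definition Ck4 {V : NormedModule R_AbsRing} k (W : V -> Prop) (h : V -> V4) : Prop :=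
  Ck k W (fun q => co1 (h q)) /\ Ck k W (fun q => co2 (h q)) /\
  Ck k W (fun q => co3 (h q)) /\ Ck k W (fun q => co4 (h q)).

Lemma pair4_eta (p : V4) : ((co1 p, co2 p), (co3 p, co4 p)) = p.
Proof. now destruct p as [[? ?] [? ?]]. Qed.

Lemma is_derive_along {V : NormedModule R_AbsRing} (W : V -> Prop) (U : V4 -> Prop)
    (h : V -> V4) (f : V4 -> R) (q a : V) :
  open U -> Ck4 1 W h -> W q -> U (h q) -> Ck 1 U f ->
  is_derive (fun s : R => f (h (plus q (scal s a)))) 0 (dirD f (h q) (d4 h q a)).
Proof.
intros HU [H1 [H2 [H3 H4]]] Wq Uq Hf.
apply (is_derive_ext (fun s : R =>
  f ((co1 (h (plus q (scal s a))), co2 (h (plus q (scal s a)))),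
     (co3 (h (plus q (scal s a))), co4 (h (plus q (scal s a))))))).
{ intros s; now rewrite pair4_eta. }
rewrite (dirD_basis4 U f (h q) (d4 h q a) HU Hf Uq).
pose proof (is_derive_comp4 W U f _ _ _ _ q a HU Hf H1 H2 H3 H4 Wq) as K.
cbv beta in K; rewrite pair4_eta in K; exact (K Uq).
Qed.

(* The second derivatives of [h] cancel by symmetry. *)
Lemma ext_d_pullback {V : NormedModule R_AbsRing} (W : V -> Prop) (h : V -> V4)
    (beta : R4 -> R4 -> R) (q a b : V) :
  open W -> Ck4 2 W h -> (forall q, W q -> nonzero4 (h q)) -> one_form beta -> W q ->
  ext_d beta (h q) (d4 h q a) (d4 h q b) =
    dirD (fun q => beta (h q) (d4 h q b)) q a - dirD (fun q => beta (h q) (d4 h q a)) q b.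
Proof.
intros HW Hh Hn Hb Wq.
assert (Hh1 : Ck4 1 W h).
{ destruct Hh as [H1 [H2 [H3 H4]]]; split; [| split; [| split]]; now apply Ck_pred. }
(* Product rule: one term comes from the motion of the base point, the other from the variation of
   the frame vector, and only the latter contains second derivatives of [h]. *)
assert (K : forall a b, dirD (fun q => beta (h q) (d4 h q b)) q a =
  dirD (fun p => beta p (d4 h q b)) (h q) (d4 h q a)
  + (dirD (fun q => dirD (fun q => co1 (h q)) q b) q a * beta (h q) b1
     + dirD (fun q => dirD (fun q => co2 (h q)) q b) q a * beta (h q) b2
     + dirD (fun q => dirD (fun q => co3 (h q)) q b) q a * beta (h q) b3
     + dirD (fun q => dirD (fun q => co4 (h q)) q b) q a * beta (h q) b4)).
{ clear a b; intros a b.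
  rewrite (dirD_ext_open W _ (fun q =>
    dirD (fun q => co1 (h q)) q b * beta (h q) b1
    + dirD (fun q => co2 (h q)) q b * beta (h q) b2
    + dirD (fun q => co3 (h q)) q b * beta (h q) b3
    + dirD (fun q => co4 (h q)) q b * beta (h q) b4) q a HW Wq).
  2: { intros q' Wq'; now rewrite one_form_basis by auto. }
  assert (DB : forall e, is_derive (fun s : R => beta (h (plus q (scal s a))) e) 0
    (dirD (fun p => beta p e) (h q) (d4 h q a))).
  { intros e; apply (is_derive_along W nonzero4 h (fun p => beta p e)); auto using open_nonzero.
    now apply one_form_Ck. }
  assert (DH : forall f, Ck 2 W f -> is_derive (fun s : R => dirD f (plus q (scal s a)) b) 0
    (dirD (fun q => dirD f q b) q a)).
  { intros f Hf; exact (is_derive_dirD 0 W (fun q => dirD f q b) q a (Ck_dirD 1 W f b Hf) Wq). }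
  destruct Hh as [H1 [H2 [H3 H4]]].
  rewrite (dirD_one_form beta (h q) (d4 h q a) (d4 h q b)) by auto.
  apply is_derive_unique.
  pose proof (is_derive_sum4 _ _ _ _ _ _ _ _ 0 _ _ _ _ _ _ _ _
    (DH _ H1) (DH _ H2) (DH _ H3) (DH _ H4) (DB b1) (DB b2) (DB b3) (DB b4)) as K.
  cbv beta in K; rewrite !line_0 in K.
  match goal with |- is_derive _ _ ?y => match type of K with is_derive _ _ ?x =>
    replace y with x; [exact K |] end end.
  set (w := d4 h q b).
  change (dirD (fun q => co1 (h q)) q b) with (co1 w).
  change (dirD (fun q => co2 (h q)) q b) with (co2 w).
  change (dirD (fun q => co3 (h q)) q b) with (co3 w).
  change (dirD (fun q => co4 (h q)) q b) with (co4 w).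
  ring. }
rewrite !K; destruct Hh as [H1 [H2 [H3 H4]]].
rewrite (dirD_comm W (fun q => co1 (h q)) q b a) by assumption.
rewrite (dirD_comm W (fun q => co2 (h q)) q b a) by assumption.
rewrite (dirD_comm W (fun q => co3 (h q)) q b a) by assumption.
rewrite (dirD_comm W (fun q => co4 (h q)) q b a) by assumption.
unfold ext_d; ring.
Qed.

(** One order is lost, since the coefficients of the pullback contain the first derivatives of
    [h]. *)
Lemma Ck_pullback {V : NormedModule R_AbsRing} k (W : V -> Prop) (h : V -> V4)
    (beta : R4 -> R4 -> R) (b : V) :
  open W -> Ck4 (S k) W h -> (forall q, W q -> nonzero4 (h q)) -> one_form beta ->
  Ck k W (fun q => beta (h q) (d4 h q b)).
Proof.
intros HW [H1 [H2 [H3 H4]]] Hn Hb.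
apply (Ck_ext k W (fun q =>
    dirD (fun q => co1 (h q)) q b * beta (h q) b1
    + dirD (fun q => co2 (h q)) q b * beta (h q) b2
    + dirD (fun q => co3 (h q)) q b * beta (h q) b3
    + dirD (fun q => co4 (h q)) q b * beta (h q) b4)); [exact HW | |].
{ intros q Wq; symmetry; now rewrite one_form_basis by auto. }
assert (HB : forall e, Ck k W (fun q => beta (h q) e)).
{ intros e.
  apply (Ck_ext k W (fun q =>
    (fun p => beta p e) ((co1 (h q), co2 (h q)), (co3 (h q), co4 (h q))))); [exact HW | |].
  - intros q _; now rewrite pair4_eta.
  - apply (Ck_comp4 k W nonzero4 (fun p => beta p e)); auto using open_nonzero;
      try now apply Ck_pred.
    + intros q Wq; rewrite pair4_eta; auto.
    + now apply one_form_Ck. }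
repeat apply Ck_plus; try exact HW; apply Ck_mult; auto; now apply Ck_dirD.
Qed.

(** * Forms on the sphere in Hopf coordinates *)

Lemma sin_cos_sqr (x : R) : sin x * sin x + cos x * cos x = 1.
Proof. exact (sin2_cos2 x). Qed.

(** These are the directions eta, xi1, xi2 when [V3] carries Hopf coordinates, and t, x, y when it
    carries space-time points. *)
Definition e0 : V3 := (1, (0, 0)).
Definition e1 : V3 := (0, (1, 0)).
Definition e2 : V3 := (0, (0, 1)).
Definition all3 (_ : V3) : Prop := True.

Definition hopf3 (q : V3) : V4 := hopf (fst q) (fst (snd q)) (snd (snd q)).

Lemma Ck_hopf3 k : Ck4 k all3 hopf3.
Proof.
destruct (Ck_coordinates3 k) as [H0 [H1 H2]].
destruct (Ck_sin_cos k _ _ open_all H0) as [S0 C0].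
destruct (Ck_sin_cos k _ _ open_all H1) as [S1 C1].
destruct (Ck_sin_cos k _ _ open_all H2) as [S2 C2].
split; [| split; [| split]]; unfold co1, co2, co3, co4, hopf3, hopf; simpl;
  apply Ck_mult; auto using open_all.
Qed.

Lemma hopf_unit (a b c : R) : dot4 (hopf a b c) (hopf a b c) = 1.
Proof.
unfold dot4, hopf; simpl.
pose proof (sin_cos_sqr a) as A; pose proof (sin_cos_sqr b) as B; pose proof (sin_cos_sqr c) as C.
transitivity (sin a * sin a * (sin b * sin b + cos b * cos b)
  + cos a * cos a * (sin c * sin c + cos c * cos c)); [ring |].
rewrite B, C; lra.
Qed.

Lemma hopf3_nonzero q : nonzero4 (hopf3 q).
Proof. apply nonzero_iff; unfold hopf3; rewrite hopf_unit; lra. Qed.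

Lemma hopf_frame (a b c : R) :
  d4 hopf3 (a, (b, c)) e0 = ((cos a * cos b, cos a * sin b), (- sin a * cos c, - sin a * sin c)) /\
  d4 hopf3 (a, (b, c)) e1 = ((- sin a * sin b, sin a * cos b), (0, 0)) /\
  d4 hopf3 (a, (b, c)) e2 = ((0, 0), (- cos a * sin c, cos a * cos c)).
Proof.
destruct (Ck_hopf3 1) as [H1 [H2 [H3 H4]]].
destruct (is_derive_slices _ a b c H1) as [K1 [L1 M1]].
destruct (is_derive_slices _ a b c H2) as [K2 [L2 M2]].
destruct (is_derive_slices _ a b c H3) as [K3 [L3 M3]].
destruct (is_derive_slices _ a b c H4) as [K4 [L4 M4]].
unfold d4; apply is_derive_unique in K1, K2, K3, K4, L1, L2, L3, L4, M1, M2, M3, M4.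
split; [| split]; repeat apply f_equal2;
  [refine (eq_trans (eq_sym K1) _) | refine (eq_trans (eq_sym K2) _)
  | refine (eq_trans (eq_sym K3) _) | refine (eq_trans (eq_sym K4) _)
  | refine (eq_trans (eq_sym L1) _) | refine (eq_trans (eq_sym L2) _)
  | refine (eq_trans (eq_sym L3) _) | refine (eq_trans (eq_sym L4) _)
  | refine (eq_trans (eq_sym M1) _) | refine (eq_trans (eq_sym M2) _)
  | refine (eq_trans (eq_sym M3) _) | refine (eq_trans (eq_sym M4) _)]; clear;
  unfold co1, co2, co3, co4, hopf3, hopf; simpl;
  apply is_derive_unique; auto_derive; auto; ring.
Qed.

(** Identifies the frame in the definition of [S3_integral] with differentials of [hopf3], to which
    [ext_d_pullback] applies. *)
Lemma hopf_frame_D4 (a b c : R) :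
  hopf_eta a b c = d4 hopf3 (a, (b, c)) e0 /\
  hopf_xi1 a b c = d4 hopf3 (a, (b, c)) e1 /\
  hopf_xi2 a b c = d4 hopf3 (a, (b, c)) e2.
Proof.
destruct (hopf_frame a b c) as [-> [-> ->]].
unfold hopf_eta, hopf_xi1, hopf_xi2, D4, hopf; simpl.
split; [| split]; repeat apply f_equal2; apply is_derive_unique; auto_derive; auto; ring.
Qed.

(** Coefficient of the pullback of [beta] to Hopf coordinates. For a one-form it is smooth on all of
    [V3], including the values of eta where [hopf3] is not an immersion. *)
Definition coef (beta : R4 -> R4 -> R) (e q : V3) : R := beta (hopf3 q) (d4 hopf3 q e).

Lemma Ck_coef k beta e : one_form beta -> Ck k all3 (coef beta e).
Proof.
intros Hb; apply (Ck_pullback k all3 hopf3 beta e);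
  [exact open_all | apply Ck_hopf3 | intros q' _; apply hopf3_nonzero | exact Hb].
Qed.

(** The coefficient of beta /\ d beta' on d eta /\ d xi1 /\ d xi2. *)
Definition wedge_coef (beta beta' : R4 -> R4 -> R) (q : V3) : R :=
  coef beta e0 q * (dirD (coef beta' e2) q e1 - dirD (coef beta' e1) q e2)
  - coef beta e1 q * (dirD (coef beta' e2) q e0 - dirD (coef beta' e0) q e2)
  + coef beta e2 q * (dirD (coef beta' e1) q e0 - dirD (coef beta' e0) q e1).

Lemma S3_integral_frame (mu : R4 -> R4 -> R4 -> R4 -> R) :
  S3_integral mu = RInt3 (fun q => mu (hopf3 q) (d4 hopf3 q e0) (d4 hopf3 q e1) (d4 hopf3 q e2))
    0 (PI / 2) 0 (2 * PI) 0 (2 * PI).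
Proof.
apply RInt_ext; intros a _; apply RInt_ext; intros b _; apply RInt_ext; intros c _.
destruct (hopf_frame_D4 a b c) as [-> [-> ->]]; reflexivity.
Qed.

Lemma ext_d_coef beta q a b : one_form beta ->
  ext_d beta (hopf3 q) (d4 hopf3 q a) (d4 hopf3 q b) =
    dirD (coef beta b) q a - dirD (coef beta a) q b.
Proof.
intros Hb; apply (ext_d_pullback all3 hopf3 beta q a b);
  [exact open_all | apply Ck_hopf3 | intros q' _; apply hopf3_nonzero | exact Hb | exact I].
Qed.

Lemma S3_integral_coef beta beta' : one_form beta -> one_form beta' ->
  S3_integral (wedge12 beta (ext_d beta')) =
    RInt3 (wedge_coef beta beta') 0 (PI / 2) 0 (2 * PI) 0 (2 * PI).
Proof.
intros Hb Hb'; rewrite S3_integral_frame; apply RInt3_ext; intros a b c _ _ _.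
unfold wedge12; rewrite !ext_d_coef by assumption; reflexivity.
Qed.

Lemma Ck_wedge_coef k beta beta' : one_form beta -> one_form beta' ->
  Ck k all3 (wedge_coef beta beta').
Proof.
intros Hb Hb'.
assert (HD : forall e e', Ck k all3 (fun q => dirD (coef beta' e) q e'))
  by (intros; now apply Ck_dirD, Ck_coef).
apply Ck_plus; [exact open_all | apply Ck_minus; [exact open_all | |] |];
  (apply Ck_mult; [exact open_all | now apply Ck_coef | now apply Ck_minus; [exact open_all | |]]).
Qed.

Lemma dirD_minor (f g f' g' : V3 -> R) q v :
  Ck 1 all3 f -> Ck 1 all3 g -> Ck 1 all3 f' -> Ck 1 all3 g' ->
  dirD (fun q => f q * g' q - g q * f' q) q v =
    dirD f q v * g' q + f q * dirD g' q v - (dirD g q v * f' q + g q * dirD f' q v).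
Proof.
intros Hf Hg Hf' Hg'; apply is_derive_unique.
apply (is_derive_minus (fun s : R => f (plus q (scal s v)) * g' (plus q (scal s v)))
  (fun s : R => g (plus q (scal s v)) * f' (plus q (scal s v))));
  now apply (is_derive_line_mult 0 all3).
Qed.

Lemma dirD_periodic {V : NormedModule R_AbsRing} (f : V -> R) (c p v : V) :
  (forall q, f (plus q c) = f q) -> dirD f (plus p c) v = dirD f p v.
Proof.
intros Hf; apply Derive_ext; intros s.
rewrite <- (Hf (plus p (scal s v))); f_equal.
rewrite <- !plus_assoc; f_equal; apply plus_comm.
Qed.

Lemma hopf3_periodic q :
  hopf3 (plus q (0, (2 * PI, 0))) = hopf3 q /\ hopf3 (plus q (0, (0, 2 * PI))) = hopf3 q.
Proof.
destruct q as [a [b c]].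
change (hopf (a + 0) (b + 2 * PI) (c + 0) = hopf a b c /\
  hopf (a + 0) (b + 0) (c + 2 * PI) = hopf a b c).
unfold hopf; rewrite !Rplus_0_r.
now rewrite !cos_plus, !sin_plus, cos_2PI, sin_2PI, !Rmult_1_r, !Rmult_0_r, !Rplus_0_r, !Rminus_0_r.
Qed.

Lemma coef_periodic beta e (a b c : R) :
  coef beta e (a, (2 * PI, c)) = coef beta e (a, (0, c)) /\
  coef beta e (a, (b, 2 * PI)) = coef beta e (a, (b, 0)).
Proof.
assert (K : forall x : V3, (forall q, hopf3 (plus q x) = hopf3 q) ->
  forall q, coef beta e (plus q x) = coef beta e q).
{ intros x Hx q; unfold coef; rewrite Hx; f_equal; unfold d4.
  apply f_equal2; apply f_equal2;
    match goal with |- dirD ?f _ _ = _ => apply (dirD_periodic f x) end;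
    intros q'; now rewrite Hx. }
split.
- rewrite <- (K (0, (2 * PI, 0)) (fun q => proj1 (hopf3_periodic q)) (a, (0, c))).
  f_equal; change ((a, (2 * PI, c)) = (a + 0, (0 + 2 * PI, c + 0))).
  now rewrite !Rplus_0_r, Rplus_0_l.
- rewrite <- (K (0, (0, 2 * PI)) (fun q => proj2 (hopf3_periodic q)) (a, (b, 0))).
  f_equal; change ((a, (b, 2 * PI)) = (a + 0, (b + 0, 0 + 2 * PI))).
  now rewrite !Rplus_0_r, Rplus_0_l.
Qed.

(** At eta = 0 the circle of angle xi1 is collapsed, so its tangent vector is zero; at eta = PI / 2
    the same happens to xi2. *)
Lemma coef_degenerate beta (b c : R) : one_form beta ->
  coef beta e1 (0, (b, c)) = 0 /\ coef beta e2 (PI / 2, (b, c)) = 0.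
Proof.
intros Hb; unfold coef.
rewrite (one_form_basis beta (hopf3 (0, (b, c)))) by auto using hopf3_nonzero.
rewrite (one_form_basis beta (hopf3 (PI / 2, (b, c)))) by auto using hopf3_nonzero.
destruct (hopf_frame 0 b c) as [_ [-> _]]; destruct (hopf_frame (PI / 2) b c) as [_ [_ ->]].
unfold co1, co2, co3, co4; simpl; rewrite sin_0, cos_PI2; split; ring.
Qed.

(* Stokes for [beta /\ beta'], which has no boundary term on the sphere. *)
Lemma S3_integral_wedge_sym beta beta' : one_form beta -> one_form beta' ->
  S3_integral (wedge12 beta (ext_d beta')) = S3_integral (wedge12 beta' (ext_d beta)).
Proof.
intros Hb Hb'; rewrite !S3_integral_coef by assumption.
assert (C : forall e, Ck 1 all3 (coef beta e)) by (intros; now apply Ck_coef).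
assert (C' : forall e, Ck 1 all3 (coef beta' e)) by (intros; now apply Ck_coef).
pose (minor := fun e e' (q : V3) =>
  coef beta e q * coef beta' e' q - coef beta e' q * coef beta' e q).
assert (CS : forall e e', Ck 1 all3 (minor e e')).
{ intros e e'; apply Ck_minus; [exact open_all | |]; now apply Ck_mult; [exact open_all | |]. }
assert (CD : forall e e' v q, continuous (fun q => dirD (minor e e') q v) q).
{ intros e e' v q; exact (Ck_continuous 0 all3 _ q (Ck_dirD 0 all3 _ v (CS e e')) I). }
assert (CW : forall q, continuous (wedge_coef beta' beta) q).
{ intros q; exact (Ck_continuous 0 all3 _ q (Ck_wedge_coef 0 _ _ Hb' Hb) I). }
(* The minors are the coefficients of beta /\ beta'. Since d (beta /\ beta') = d beta /\ beta' -
   beta /\ d beta', the two integrands differ by a sum of partial derivatives. *)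
transitivity (RInt3 (fun q => wedge_coef beta' beta q +
  (-1 * dirD (minor e1 e2) q e0 + (dirD (minor e0 e2) q e1 + -1 * dirD (minor e0 e1) q e2)))
  0 (PI / 2) 0 (2 * PI) 0 (2 * PI)).
{ apply RInt3_ext; intros x y z _ _ _; unfold minor.
  rewrite !dirD_minor by auto; unfold wedge_coef; ring. }
pose proof (@continuous_scal_R V3) as CM; pose proof (@continuous_plus_R V3) as CP.
rewrite (RInt3_plus (wedge_coef beta' beta)) by auto 10.
rewrite (RInt3_plus (fun q => -1 * dirD (minor e1 e2) q e0)) by auto 10.
rewrite (RInt3_plus (fun q => dirD (minor e0 e2) q e1)) by auto 10.
rewrite !RInt3_scal by auto.
(* At eta = 0 both e1-coefficients vanish, at eta = PI / 2 both e2-coefficients do. In the two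
   angular directions the boundary values cancel by periodicity. *)
assert (X0 : RInt3 (fun q => dirD (minor e1 e2) q e0) 0 (PI / 2) 0 (2 * PI) 0 (2 * PI) = 0).
{ apply (RInt3_partial_x (minor e1 e2)); [apply CS |]; intros y z; unfold minor.
  destruct (coef_degenerate beta y z Hb) as [-> ->].
  destruct (coef_degenerate beta' y z Hb') as [-> ->]; ring. }
assert (X1 : RInt3 (fun q => dirD (minor e0 e2) q e1) 0 (PI / 2) 0 (2 * PI) 0 (2 * PI) = 0).
{ apply (RInt3_partial_y (minor e0 e2)); [apply CS |]; intros x z; unfold minor.
  now rewrite !(proj1 (coef_periodic beta _ x 0 z)), !(proj1 (coef_periodic beta' _ x 0 z)). }
assert (X2 : RInt3 (fun q => dirD (minor e0 e1) q e2) 0 (PI / 2) 0 (2 * PI) 0 (2 * PI) = 0).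
{ apply (RInt3_partial_z (minor e0 e1)); [apply CS |]; intros x y; unfold minor.
  now rewrite !(proj2 (coef_periodic beta _ x y 0)), !(proj2 (coef_periodic beta' _ x y 0)). }
rewrite X0, X1, X2; ring.
Qed.

Lemma frame_tangent (a b c : R) :
  let p := hopf3 (a, (b, c)) in
  S3 p /\ forall e, e = e0 \/ e = e1 \/ e = e2 -> tangentS3 p (d4 hopf3 (a, (b, c)) e).
Proof.
split; [apply hopf_unit |].
destruct (hopf_frame a b c) as [E0 [E1 E2]].
intros e [-> | [-> | ->]]; [rewrite E0 | rewrite E1 | rewrite E2];
  unfold tangentS3, dot4, hopf3, hopf; simpl; [| ring | ring].
pose proof (sin_cos_sqr b) as B; pose proof (sin_cos_sqr c) as C.
transitivity (sin a * cos a * (sin b * sin b + cos b * cos b)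
  - sin a * cos a * (sin c * sin c + cos c * cos c)); [ring |].
rewrite B, C; ring.
Qed.

(** A primitive has its exterior derivative prescribed on tangent vectors only, and the Hopf frame
    consists of such vectors. *)
Lemma S3_integral_primitive_ext Y beta beta' alpha : Defs.primitive Y beta -> Defs.primitive Y beta' ->
  S3_integral (wedge12 alpha (ext_d beta)) = S3_integral (wedge12 alpha (ext_d beta')).
Proof.
intros Hb Hb'; rewrite !S3_integral_frame; apply RInt3_ext; intros a b c _ _ _.
destruct (frame_tangent a b c) as [Hp Ht].
unfold wedge12.
rewrite (Hb _ (d4 hopf3 (a, (b, c)) e1) (d4 hopf3 (a, (b, c)) e2)) by auto.
rewrite (Hb _ (d4 hopf3 (a, (b, c)) e0) (d4 hopf3 (a, (b, c)) e2)) by auto.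
rewrite (Hb _ (d4 hopf3 (a, (b, c)) e0) (d4 hopf3 (a, (b, c)) e1)) by auto.
rewrite (Hb' _ (d4 hopf3 (a, (b, c)) e1) (d4 hopf3 (a, (b, c)) e2)) by auto.
rewrite (Hb' _ (d4 hopf3 (a, (b, c)) e0) (d4 hopf3 (a, (b, c)) e2)) by auto.
now rewrite (Hb' _ (d4 hopf3 (a, (b, c)) e0) (d4 hopf3 (a, (b, c)) e1)) by auto.
Qed.

(** With d beta = d beta' on the sphere: int beta' /\ d beta' = int beta' /\ d beta = int beta /\ d
    beta' = int beta /\ d beta, the middle equality being the symmetry of the pairing. *)
Lemma helicity_well_defined Y beta h : one_form beta -> Defs.primitive Y beta ->
  S3_integral (wedge12 beta (ext_d beta)) = h -> is_helicity Y h.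
Proof.
intros Hb Pb Hh; split; [now exists beta |].
intros beta' Hb' Pb'.
rewrite (S3_integral_primitive_ext Y beta' beta beta' Pb' Pb).
rewrite S3_integral_wedge_sym by assumption.
now rewrite (S3_integral_primitive_ext Y beta' beta beta Pb' Pb).
Qed.

(** * A primitive of the double suspension *)

Lemma polar_exists (a b : R) :
  exists th, a = sqrt (a * a + b * b) * cos th /\ b = sqrt (a * a + b * b) * sin th.
Proof.
set (n := sqrt (a * a + b * b)).
assert (Hs : 0 <= a * a + b * b) by nra.
assert (Hn2 : n * n = a * a + b * b) by (apply sqrt_sqrt; lra).
destruct (Req_dec n 0) as [Hn | Hn].
{ exists 0; rewrite Hn in *; split; nra. }
assert (Hp : 0 < n) by (pose proof (sqrt_pos (a * a + b * b)); fold n in H; lra).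
assert (Ha : -1 <= a / n <= 1).
{ assert (E : a / n * n = a) by (field; lra).
  assert (Hb2 : 0 <= b * b) by nra.
  assert (Hl : - n <= a <= n) by (split; nra).
  split; apply Rmult_le_reg_r with n; lra. }
assert (Ec : cos (acos (a / n)) = a / n) by now apply cos_acos.
assert (Es : sin (acos (a / n)) = Rabs b / n).
{ rewrite sin_acos by exact Ha.
  replace (1 - (a / n)²) with ((Rabs b / n)²).
  - apply sqrt_Rsqr; apply Rdiv_le_0_compat; [apply Rabs_pos | exact Hp].
  - unfold Rdiv; rewrite !Rsqr_mult, <- Rsqr_abs.
    assert (H1 : (/ n)² * (n * n) = 1) by (unfold Rsqr; field; lra).
    rewrite <- H1, Hn2; unfold Rsqr; ring. }
destruct (Rle_dec 0 b) as [Hb | Hb].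
- exists (acos (a / n)); rewrite Ec, Es, Rabs_pos_eq by exact Hb; split; field; lra.
- exists (- acos (a / n)); rewrite cos_neg, sin_neg, Ec, Es, Rabs_left by lra; split; field; lra.
Qed.

Lemma polar_unique (n th th' : R) : 0 < n ->
  n * cos th = n * cos th' -> n * sin th = n * sin th' ->
  exists k : Z, th' = th + 2 * PI * IZR k.
Proof.
intros Hn Hc Hs.
apply Rmult_eq_reg_l in Hc; [| lra]; apply Rmult_eq_reg_l in Hs; [| lra].
assert (E : cos (th' - th) = 1).
{ rewrite cos_minus, Hc, Hs; pose proof (sin_cos_sqr th') as P; lra. }
(* cos d = 1 - 2 sin^2 (d / 2) turns the equation into a zero of the sine, whose zeros are the
   integer multiples of PI. *)
assert (Z : sin ((th' - th) / 2) = 0).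
{ replace (th' - th) with (2 * ((th' - th) / 2)) in E by field.
  rewrite cos_2a_sin in E; nra. }
apply sin_eq_0_0 in Z; destruct Z as [k Hk]; exists k.
replace th' with (th + 2 * ((th' - th) / 2)) by field; rewrite Hk; ring.
Qed.

Lemma periodic_IZR (g : R -> R) : (forall t, g (t + 1) = g t) ->
  forall (k : Z) t, g (t + IZR k) = g t.
Proof.
intros Hg.
assert (Hn : forall (n : nat) t, g (t + INR n) = g t).
{ induction n as [|n IH]; intros t; [now rewrite Rplus_0_r |].
  rewrite S_INR, <- Rplus_assoc, Hg; apply IH. }
intros k t; destruct (Z.le_gt_cases 0 k) as [Hk | Hk].
- rewrite <- (Z2Nat.id k Hk), <- INR_IZR_INZ; apply Hn.
- rewrite <- (Hn (Z.to_nat (- k)) (t + IZR k)), INR_IZR_INZ, Z2Nat.id by lia.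
  rewrite opp_IZR; f_equal; ring.
Qed.

(** An argument of a + i b chosen with no continuity whatsoever; it is only fed to functions for
    which a change by 2 PI is invisible. *)
Definition angle (a b : R) : R := epsilon (inhabits 0) (fun th =>
  a = sqrt (a * a + b * b) * cos th /\ b = sqrt (a * a + b * b) * sin th).

Lemma angle_spec a b :
  a = sqrt (a * a + b * b) * cos (angle a b) /\ b = sqrt (a * a + b * b) * sin (angle a b).
Proof. exact (epsilon_spec (inhabits 0) _ (polar_exists a b)). Qed.

Lemma angle_polar (n th : R) : 0 < n ->
  exists k : Z, angle (n * cos th) (n * sin th) = th + 2 * PI * IZR k.
Proof.
intros Hn; apply (polar_unique n); [exact Hn | |].
all: assert (E : sqrt (n * cos th * (n * cos th) + n * sin th * (n * sin th)) = n).
1, 3: replace (n * cos th * (n * cos th) + n * sin th * (n * sin th)) with (n * n)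
  by (pose proof (sin_cos_sqr th) as P;
      transitivity (n * n * (sin th * sin th + cos th * cos th)); [rewrite P |]; ring);
  apply sqrt_square; lra.
all: destruct (angle_spec (n * cos th) (n * sin th)) as [H1 H2]; rewrite E in H1, H2; assumption.
Qed.

(* [F] read in the frame rotating with the Hopf flow. *)
Definition corot (F : R -> plane -> R) (q : V3) : R :=
  F (fst q) (rot (- (2 * PI * fst q)) (snd q)).

Definition ham3 (F : R -> plane -> R) (q : V3) : R := F (fst q) (snd q).

Lemma Ck_ham3 k F : hamiltonian F -> Ck k all3 (ham3 F).
Proof. intros [H _ _]; exact (H k). Qed.

Lemma Ck_corot k F : hamiltonian F -> Ck k all3 (corot F).
Proof.
intros HF; destruct (Ck_coordinates3 k) as [H0 [H1 H2]].
assert (HT : Ck k all3 (fun q : V3 => - (2 * PI * fst q))).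
{ apply Ck_opp; [exact open_all |]; apply Ck_mult; [exact open_all | | exact H0].
  apply Ck_const, open_all. }
destruct (Ck_sin_cos k _ _ open_all HT) as [HS HC].
apply (Ck_comp3 k all3 (ham3 F) (fun q => fst q)
  (fun q => fst (snd q) * cos (- (2 * PI * fst q)) - snd (snd q) * sin (- (2 * PI * fst q)))
  (fun q => fst (snd q) * sin (- (2 * PI * fst q)) + snd (snd q) * cos (- (2 * PI * fst q))));
  [exact open_all | now apply Ck_ham3 | exact H0 | |].
- apply Ck_minus; [exact open_all | |]; now apply Ck_mult; [exact open_all | |].
- apply Ck_plus; [exact open_all | |]; now apply Ck_mult; [exact open_all | |].
Qed.

Lemma corot_periodic F (k : Z) t x : hamiltonian F ->
  corot F (t + IZR k, x) = corot F (t, x).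
Proof.
intros [_ HF _]; revert t; apply (periodic_IZR (fun t => corot F (t, x))).
intros t; unfold corot; cbn [fst snd]; rewrite HF; f_equal; unfold rot.
replace (- (2 * PI * (t + 1))) with (- (2 * PI * t + 2 * PI)) by ring.
now rewrite !cos_neg, !sin_neg, cos_plus, sin_plus, cos_2PI, sin_2PI,
  !Rmult_1_r, !Rmult_0_r, Rplus_0_r, Rminus_0_r.
Qed.

Lemma normsq2_rot (s : R) (x : plane) : normsq2 (rot s x) = normsq2 x.
Proof.
unfold normsq2, rot; simpl; pose proof (sin_cos_sqr s) as P.
transitivity ((fst x * fst x + snd x * snd x) * (sin s * sin s + cos s * cos s)); [ring |].
rewrite P; ring.
Qed.

(** [F] carried to the sphere by [tau1]: t is the angle of z2 over 2 PI, and x is sqrt 2 times z1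
    rotated back by that angle. Dividing by the norm extends it to nonzero vectors as a function
    constant on rays; beyond the torus |x| > 1 and the value is 0. *)
Definition hamf (F : R -> plane -> R) (p : V4) : R :=
  corot F (angle (co3 p) (co4 p) / (2 * PI),
    (sqrt 2 * co1 p / sqrt (dot4 p p), sqrt 2 * co2 p / sqrt (dot4 p p))).

(** Frees [hamf] from the choice made in [angle]: by periodicity any argument of z2 gives the same
    value. *)
Lemma hamf_polar F (p : V4) (n th : R) : hamiltonian F -> 0 < n ->
  co3 p = n * cos th -> co4 p = n * sin th ->
  hamf F p = corot F (th / (2 * PI),
    (sqrt 2 * co1 p / sqrt (dot4 p p), sqrt 2 * co2 p / sqrt (dot4 p p))).
Proof.
intros HF Hn H3 H4; unfold hamf; rewrite H3, H4.
destruct (angle_polar n th Hn) as [k ->].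
replace ((th + 2 * PI * IZR k) / (2 * PI)) with (th / (2 * PI) + IZR k)
  by (field; apply PI_neq0).
now apply corot_periodic.
Qed.

Definition off_axis (p : V4) : Prop := 0 < co3 p * co3 p + co4 p * co4 p.

Lemma Ck_normsq34 k U : open U -> Ck k U (fun p => co3 p * co3 p + co4 p * co4 p).
Proof.
intros HU; destruct (Ck_coordinates4 k U HU) as [_ [_ [H3 H4]]].
now apply Ck_plus; [| apply Ck_mult | apply Ck_mult].
Qed.

Lemma open_off_axis : open off_axis.
Proof.
apply (open_superlevel (V := V4)); intros p.
exact (Ck_continuous 0 (fun _ => True) _ p (Ck_normsq34 0 _ open_all) I).
Qed.

Lemma off_axis_nonzero p : off_axis p -> nonzero4 p.
Proof.
intros H; apply nonzero_iff; destruct p as [[a b] [c d]].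
unfold off_axis, co3, co4 in H; unfold dot4; simpl in *; nra.
Qed.

Lemma sqrt_one_plus_sqr (c s : R) : 0 < c ->
  sqrt (c * c + s * s) * cos (atan (s / c)) = c /\
  sqrt (c * c + s * s) * sin (atan (s / c)) = s.
Proof.
intros Hc.
assert (E : sqrt (c * c + s * s) = c * sqrt (1 + (s / c)²)).
{ replace (c * c + s * s) with ((c * c) * (1 + (s / c)²)) by (unfold Rsqr; field; lra).
  rewrite sqrt_mult, sqrt_square; try lra; [nra |]; pose proof (Rle_0_sqr (s / c)); lra. }
assert (Hp : 0 < sqrt (1 + (s / c)²)).
{ apply sqrt_lt_R0; pose proof (Rle_0_sqr (s / c)); lra. }
rewrite E, cos_atan, sin_atan; split; field; lra.
Qed.

(* Near a point of angle [th0], the angle is [th0 + atan (s / c)] up to a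
   multiple of [2 PI], where [c + i s] is [z2] rotated by [- th0]. *)
Lemma Ck_hamf k F : hamiltonian F -> Ck k off_axis (hamf F).
Proof.
intros HF; apply Ck_local; intros p0 Hp0.
set (th0 := angle (co3 p0) (co4 p0)).
pose (c := fun p : V4 => co3 p * cos th0 + co4 p * sin th0).
pose (s := fun p : V4 => co4 p * cos th0 - co3 p * sin th0).
assert (Hcs : forall U : V4 -> Prop, open U -> Ck k U c /\ Ck k U s).
{ intros U HU; destruct (Ck_coordinates4 k U HU) as [_ [_ [H3 H4]]].
  split; [apply Ck_plus | apply Ck_minus]; try exact HU; apply Ck_mult; auto using Ck_const. }
assert (Hsum : forall p, c p * c p + s p * s p = co3 p * co3 p + co4 p * co4 p).
{ intros p; unfold c, s; pose proof (sin_cos_sqr th0) as P.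
  transitivity ((co3 p * co3 p + co4 p * co4 p) * (sin th0 * sin th0 + cos th0 * cos th0));
    [ring | rewrite P; ring]. }
pose (W := fun p : V4 => 0 < c p).
assert (OW : open W).
{ apply (open_superlevel (V := V4)); intros p.
  exact (Ck_continuous k (fun _ => True) _ p (proj1 (Hcs _ open_all)) I). }
(* At p0 itself the rotation by - th0 makes z2 real, so c p0 is its modulus. *)
assert (W0 : W p0).
{ unfold W, c.
  destruct (angle_spec (co3 p0) (co4 p0)) as [H3 H4]; fold th0 in H3, H4.
  assert (Hn : 0 < sqrt (co3 p0 * co3 p0 + co4 p0 * co4 p0)) by now apply sqrt_lt_R0.
  set (n := sqrt (co3 p0 * co3 p0 + co4 p0 * co4 p0)) in *.
  rewrite H3, H4; pose proof (sin_cos_sqr th0) as P.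
  replace (n * cos th0 * cos th0 + n * sin th0 * sin th0) with n; [exact Hn |].
  transitivity (n * (sin th0 * sin th0 + cos th0 * cos th0)); [rewrite P |]; ring. }
exists W; split; [exact W0 |].
assert (WN : forall p, W p -> 0 < dot4 p p).
{ intros p Hp; apply nonzero_iff, off_axis_nonzero.
  unfold off_axis; rewrite <- Hsum; unfold W in Hp; nra. }
destruct (Hcs W OW) as [Hc Hs].
destruct (Ck_coordinates4 k W OW) as [H1 [H2 _]].
assert (Hr : Ck k W (fun p => / sqrt (dot4 p p))).
{ apply Ck_inv; [exact OW | |].
  - intros p Hp; apply Rgt_not_eq, sqrt_lt_R0, WN, Hp.
  - apply Ck_sqrt; [exact OW | exact WN | apply Ck_dot4, OW]. }
apply (Ck_ext k W (fun p => corot F ((th0 + atan (s p * / c p)) * / (2 * PI),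
  (sqrt 2 * co1 p * / sqrt (dot4 p p), sqrt 2 * co2 p * / sqrt (dot4 p p))))); [exact OW | |].
- intros p Hp; symmetry.
  destruct (sqrt_one_plus_sqr (c p) (s p) Hp) as [EC ES].
  assert (Hn : 0 < sqrt (c p * c p + s p * s p)).
  { apply sqrt_lt_R0; unfold W in Hp; nra. }
  apply (hamf_polar F p (sqrt (c p * c p + s p * s p))); [exact HF | exact Hn | |];
    change (s p * / c p) with (s p / c p); pose proof (sin_cos_sqr th0) as P;
    set (n := sqrt (c p * c p + s p * s p)) in *; set (d := atan (s p / c p)) in *.
  + transitivity (cos th0 * (n * cos d) - sin th0 * (n * sin d)); [| rewrite cos_plus; ring].
    rewrite EC, ES; unfold c, s.
    transitivity (co3 p * (sin th0 * sin th0 + cos th0 * cos th0)); [rewrite P |]; ring.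
  + transitivity (sin th0 * (n * cos d) + cos th0 * (n * sin d)); [| rewrite sin_plus; ring].
    rewrite EC, ES; unfold c, s.
    transitivity (co4 p * (sin th0 * sin th0 + cos th0 * cos th0)); [rewrite P |]; ring.
- apply (Ck_comp3 k W (corot F)); [exact OW | now apply Ck_corot | | |].
  + apply Ck_mult; [exact OW | | apply Ck_const, OW].
    apply Ck_plus; [exact OW | apply Ck_const, OW |].
    apply Ck_atan; [exact OW |]; apply Ck_mult; [exact OW | exact Hs |].
    apply Ck_inv; [exact OW | | exact Hc].
    intros p Hp; unfold W in Hp; lra.
  + apply Ck_mult; [exact OW | | exact Hr]; apply Ck_mult; auto using Ck_const.
  + apply Ck_mult; [exact OW | | exact Hr]; apply Ck_mult; auto using Ck_const.
Qed.

(** The condition |x|^2 > rho^2 with |x|^2 = 2 |z1|^2 / |p|^2, cleared of its denominator. It holds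
    around every nonzero point of the axis z2 = 0 when rho < 1. *)
Definition far (rho : R) (p : V4) : Prop :=
  0 < 2 * (co1 p * co1 p + co2 p * co2 p) - rho * rho * dot4 p p.

Lemma open_far rho : open (far rho).
Proof.
apply (open_superlevel (V := V4)); intros p.
destruct (Ck_coordinates4 0 _ (@open_all V4)) as [H1 [H2 _]].
refine (Ck_continuous 0 (fun _ => True) _ p _ I).
apply Ck_minus; [exact open_all | |].
- apply Ck_mult; [exact open_all | apply Ck_const, open_all |].
  apply Ck_plus; [exact open_all | |]; now apply Ck_mult; [exact open_all | |].
- apply Ck_mult; [exact open_all | apply Ck_const, open_all | apply Ck_dot4, open_all].
Qed.

Lemma hamf_support F : hamiltonian F -> exists rho, 0 < rho < 1 /\
  (forall p, far rho p -> hamf F p = 0) /\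
  (forall t x, rho ^ 2 < normsq2 x -> F t x = 0).
Proof.
intros [_ _ [rho [Hrho HF]]]; exists rho; split; [exact Hrho | split; [| exact HF]].
intros p Hp; unfold far in Hp; apply HF; rewrite normsq2_rot; unfold normsq2; simpl.
assert (Hd : 0 < dot4 p p).
{ apply nonzero_iff; intros E.
  assert (K : dot4 p p = 0 /\ co1 p = 0 /\ co2 p = 0)
    by (rewrite E; split; [change (0 * 0 + 0 * 0 + 0 * 0 + 0 * 0 = 0); ring | now split]).
  destruct K as [K1 [K2 K3]]; rewrite K1, K2, K3 in Hp; lra. }
assert (Hr : 0 < sqrt (dot4 p p)) by now apply sqrt_lt_R0.
assert (H2 : sqrt 2 * sqrt 2 = 2) by (apply sqrt_sqrt; lra).
set (r := sqrt (dot4 p p)) in *.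
assert (Hrr : r * r = dot4 p p) by (apply sqrt_sqrt; lra).
replace (sqrt 2 * co1 p / r * (sqrt 2 * co1 p / r * 1)
  + sqrt 2 * co2 p / r * (sqrt 2 * co2 p / r * 1))
  with (sqrt 2 * sqrt 2 * (co1 p * co1 p + co2 p * co2 p) / (r * r)) by (field; lra).
rewrite H2, Hrr; apply Rmult_lt_reg_r with (dot4 p p); [exact Hd |].
unfold Rdiv; rewrite (Rmult_assoc _ (/ dot4 p p)), Rinv_l by lra; lra.
Qed.

(** The one-form d (arg z2). Its period is 2 PI, so PI dt is half of it, whence the division by 2 in
    [ham_form]. *)
Definition dangle (p v : V4) : R :=
  (co3 p * co4 v - co4 p * co3 v) / (co3 p * co3 p + co4 p * co4 p).

(* [PI F dt] on the first solid torus, where [t] is the angle of [z2] divided by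
   [2 PI]. On the axis [z2 = 0] the quotient in [dangle] is [0 / 0], but [hamf F]
   vanishes near it. *)
Definition ham_form (F : R -> plane -> R) (p v : R4) : R := hamf F p * dangle p v / 2.

(** Exchanges z1 and z2. It carries [tau1] to [tau2] and preserves orientation, so statements on the
    second torus follow from those on the first. *)
Definition swap4 (p : V4) : V4 := (snd p, fst p).

Definition contact (p v : R4) : R :=
  co1 p * co2 v - co2 p * co1 v + co3 p * co4 v - co4 p * co3 v.

Lemma one_form_contact : one_form contact.
Proof.
split.
- intros [[p1 p2] [p3 p4]] [[u1 u2] [u3 u4]] [[v1 v2] [v3 v4]] a _.
  unfold contact, co1, co2, co3, co4; simpl; unfold plus, scal, mult; simpl.
  unfold mult; simpl; ring.
- intros v k; destruct (Ck_coordinates4 k _ open_nonzero) as [H1 [H2 [H3 H4]]].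
  pose proof open_nonzero as O.
  exact (Ck_minus k nonzero4 _ _ O (Ck_plus k nonzero4 _ _ O (Ck_minus k nonzero4 _ _ O
    (Ck_mult k nonzero4 _ _ O H1 (Ck_const k nonzero4 (co2 v) O))
    (Ck_mult k nonzero4 _ _ O H2 (Ck_const k nonzero4 (co1 v) O)))
    (Ck_mult k nonzero4 _ _ O H3 (Ck_const k nonzero4 (co4 v) O)))
    (Ck_mult k nonzero4 _ _ O H4 (Ck_const k nonzero4 (co3 v) O))).
Qed.

(** Two kinds of neighbourhood cover the nonzero vectors: off the axis z2 = 0 every factor is
    smooth, and around a point of the axis [far rho] holds, where the form is zero. *)
Lemma one_form_ham_form F : hamiltonian F -> one_form (ham_form F).
Proof.
intros HF; split.
- intros p u v a _; unfold ham_form, dangle, Rdiv.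
  destruct u as [[u1 u2] [u3 u4]], v as [[v1 v2] [v3 v4]].
  unfold co3, co4; simpl; unfold plus, scal, mult; simpl; unfold mult; simpl; ring.
- intros v k.
  destruct (hamf_support F HF) as [rho [Hrho [Hsupp _]]].
  change (Ck k nonzero4 (fun p => ham_form F p v)).
  apply Ck_local; intros p Hp.
  destruct (Rlt_dec 0 (co3 p * co3 p + co4 p * co4 p)) as [Hax | Hax].
  + exists off_axis; split; [exact Hax |].
    pose proof open_off_axis as O.
    destruct (Ck_coordinates4 k _ O) as [_ [_ [H3 H4]]].
    apply Ck_mult; [exact O | | apply Ck_const, O].
    apply Ck_mult; [exact O | now apply Ck_hamf |].
    apply Ck_mult; [exact O | |].
    * apply Ck_minus; [exact O | |]; apply Ck_mult; auto using Ck_const.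
    * apply Ck_inv; [exact O | | now apply Ck_normsq34].
      intros q Hq; unfold off_axis in Hq; lra.
  + pose proof (open_far rho) as Ofar; exists (far rho); split.
    * apply nonzero_iff in Hp; unfold far; destruct p as [[a b] [c d]].
      unfold dot4, co1, co2, co3, co4 in *; simpl in *.
      assert (c * c + d * d = 0) by (pose proof (Rle_0_sqr c); pose proof (Rle_0_sqr d);
        unfold Rsqr in *; lra).
      assert (Hr2 : 0 < 1 - rho * rho) by nra.
      assert (HS : 0 < a * a + b * b) by lra.
      pose proof (Rmult_lt_0_compat _ _ Hr2 HS) as HM.
      replace (a * a + b * b + c * c + d * d) with (a * a + b * b) by lra.
      lra.
    * apply (Ck_ext k (far rho) (fun _ => 0)); [exact Ofar | | apply Ck_const, Ofar].
      intros q Hq; unfold ham_form; rewrite Hsupp by exact Hq; unfold Rdiv; ring.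
Qed.

Lemma swap4_line (p v : V4) (s : R) :
  swap4 (plus p (scal s v)) = plus (swap4 p) (scal s (swap4 v)).
Proof. reflexivity. Qed.

Lemma one_form_swap beta : one_form beta ->
  one_form (fun p v => beta (swap4 p) (swap4 v)).
Proof.
assert (Hz : forall p : V4, nonzero4 (swap4 p) <-> nonzero4 p).
{ intros p; rewrite !nonzero_iff; destruct p as [[? ?] [? ?]]; unfold dot4; simpl.
  split; intros H; lra. }
intros [Hl Hs]; split.
- intros p u v a Hp.
  exact (Hl (swap4 p) (swap4 u) (swap4 v) a (proj2 (Hz p) Hp)).
- intros v k; change (Ck k nonzero4 (fun p => beta (swap4 p) (swap4 v))).
  apply (Ck_subset k (fun p => nonzero4 (swap4 p))); [intros p; apply Hz |].
  apply (Ck_comp_linear k nonzero4 swap4 (fun p => beta p (swap4 v))).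
  + intros [p1 p2]; apply continuous_pair; [apply continuous_snd | apply continuous_fst].
  + exact swap4_line.
  + exact open_nonzero.
  + exact (Hs (swap4 v) k).
Qed.

Lemma ext_d_swap beta p u v :
  ext_d (fun p v => beta (swap4 p) (swap4 v)) p u v =
  ext_d beta (swap4 p) (swap4 u) (swap4 v).
Proof. reflexivity. Qed.

Lemma one_form_plus beta beta' : one_form beta -> one_form beta' ->
  one_form (fun p v => beta p v + beta' p v).
Proof.
intros [Hl Hs] [Hl' Hs']; split.
- intros p u v a Hp; rewrite Hl, Hl' by exact Hp; ring.
- intros v k; exact (Ck_plus k nonzero4 _ _ open_nonzero (Hs v k) (Hs' v k)).
Qed.

Lemma one_form_scal beta (c : R) : one_form beta -> one_form (fun p v => c * beta p v).
Proof.
intros [Hl Hs]; split.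
- intros p u v a Hp; rewrite Hl by exact Hp; ring.
- intros v k; apply (Ck_mult k nonzero4); [exact open_nonzero | | exact (Hs v k)].
  apply (Ck_const k nonzero4), open_nonzero.
Qed.

(** * The chart of the solid torus *)

Lemma inv_sqrt2_sqr : / sqrt 2 * / sqrt 2 = / 2.
Proof. rewrite <- Rinv_mult, sqrt_sqrt by lra; reflexivity. Qed.

(** Space before time, as in the domain of [tau1]; in [V3] the order is the opposite. *)
Definition VT := prod_NormedModule R_AbsRing V2 R_NormedModule.

(** The open set |x|^2 < 2, on which the square root in [tau1] is smooth. It contains the closed
    torus, so boundary points are interior to the chart. *)
Definition torus_chart (q : VT) : Prop := 0 < 1 - normsq2 (fst q) / 2.

(** The modulus of z2 at the point [tau1 q]. *)
Definition depth (q : VT) : R := sqrt (1 - normsq2 (fst q) / 2).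

Lemma Ck_coordinatesT k :
  Ck k (fun _ : VT => True) (fun q => fst (fst q)) /\
  Ck k (fun _ : VT => True) (fun q => snd (fst q)) /\
  Ck k (fun _ : VT => True) (fun q => snd q).
Proof.
split; [| split]; apply Ck_linear; try exact open_all;
  try (intros p v s; reflexivity); intros p.
- exact (@continuous_fst_fst R_UniformSpace R_UniformSpace R_UniformSpace p).
- exact (@continuous_snd_fst R_UniformSpace R_UniformSpace R_UniformSpace p).
- destruct p; apply continuous_snd.
Qed.

Lemma Ck_normsq2 k :
  Ck k (fun _ : VT => True) (fun q => 1 - normsq2 (fst q) * / 2).
Proof.
destruct (Ck_coordinatesT k) as [H1 [H2 _]].
apply Ck_minus; [exact open_all | apply Ck_const, open_all |].
apply Ck_mult; [exact open_all | | apply Ck_const, open_all].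
apply (Ck_ext k _ (fun q : VT => fst (fst q) * fst (fst q) + snd (fst q) * snd (fst q)));
  [exact open_all | intros [[x y] t] _; unfold normsq2; simpl; ring |].
apply Ck_plus; [exact open_all | |]; now apply Ck_mult; [exact open_all | |].
Qed.

Lemma open_torus_chart : open torus_chart.
Proof.
apply (open_superlevel (V := VT) (fun q => 1 - normsq2 (fst q) * / 2)); intros q.
exact (Ck_continuous 0 _ _ q (Ck_normsq2 0) I).
Qed.

Lemma Ck_tau1 k : Ck4 k torus_chart (tau1 : VT -> V4).
Proof.
assert (HW : forall f : VT -> R, Ck k (fun _ => True) f -> Ck k torus_chart f).
{ intros f; now apply Ck_subset. }
destruct (Ck_coordinatesT k) as [H1 [H2 H3]].
pose proof open_torus_chart as O.
assert (HT : Ck k torus_chart (fun q : VT => 2 * PI * snd q)).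
{ apply Ck_mult; [exact O | apply Ck_const, O | now apply HW]. }
destruct (Ck_sin_cos k _ _ O HT) as [HS HC].
assert (Hd : Ck k torus_chart depth).
{ apply Ck_sqrt; [exact O | now intros q Hq | apply HW, Ck_normsq2]. }
assert (Hx : Ck k torus_chart (fun q : VT => fst (fst q) / sqrt 2)).
{ apply Ck_mult; [exact O | now apply HW | apply Ck_const, O]. }
assert (Hy : Ck k torus_chart (fun q : VT => snd (fst q) / sqrt 2)).
{ apply Ck_mult; [exact O | now apply HW | apply Ck_const, O]. }
split; [| split; [| split]].
- apply (Ck_ext k _ (fun q : VT => fst (fst q) / sqrt 2 * cos (2 * PI * snd q)
    - snd (fst q) / sqrt 2 * sin (2 * PI * snd q))); [exact O | now intros [x t] _ |].
  apply Ck_minus; [exact O | |]; now apply Ck_mult; [exact O | |].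
- apply (Ck_ext k _ (fun q : VT => fst (fst q) / sqrt 2 * sin (2 * PI * snd q)
    + snd (fst q) / sqrt 2 * cos (2 * PI * snd q))); [exact O | now intros [x t] _ |].
  apply Ck_plus; [exact O | |]; now apply Ck_mult; [exact O | |].
- apply (Ck_ext k _ (fun q : VT => depth q * cos (2 * PI * snd q)
    - 0 * sin (2 * PI * snd q))); [exact O | now intros [x t] _ |].
  apply Ck_minus; [exact O | |]; apply Ck_mult; auto; apply Ck_const, O.
- apply (Ck_ext k _ (fun q : VT => depth q * sin (2 * PI * snd q)
    + 0 * cos (2 * PI * snd q))); [exact O | now intros [x t] _ |].
  apply Ck_plus; [exact O | |]; apply Ck_mult; auto; apply Ck_const, O.
Qed.

Definition rot4 (s : R) (p : R4) : R4 := (rot s (fst p), rot s (snd p)).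

(** The diagonal rotation by 2 PI t is factored out, and the terms in 2 PI c are its infinitesimal
    action. Volume and inner product are invariant under it, which simplifies the computations that
    follow. *)
Lemma tau1_frame (x y t a b c : R) :
  torus_chart ((x, y), t) ->
  d4 (tau1 : VT -> V4) ((x, y), t) ((a, b), c) =
  rot4 (2 * PI * t)
    ((a / sqrt 2 - 2 * PI * c * (y / sqrt 2), b / sqrt 2 + 2 * PI * c * (x / sqrt 2)),
     (- (x * a + y * b) / (2 * depth ((x, y), t)), 2 * PI * c * depth ((x, y), t))).
Proof.
intros HW; unfold torus_chart, depth, normsq2 in *; cbn [fst snd] in *.
assert (H2 : sqrt 2 <> 0) by (apply Rgt_not_eq, sqrt_lt_R0; lra).
assert (Hs : 0 < sqrt (1 - (x ^ 2 + y ^ 2) / 2)) by now apply sqrt_lt_R0.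
assert (E : forall s : R, plus (((x, y), t) : VT) (scal s (((a, b), c) : VT)) =
  ((x + s * a, y + s * b), t + s * c)) by reflexivity.
unfold d4, rot4, rot; cbn [fst snd].
apply f_equal2; apply f_equal2; unfold dirD;
  erewrite Derive_ext by (intros s; rewrite E; unfold tau1, rot, co1, co2, co3, co4, normsq2;
    cbn [fst snd]; reflexivity);
  apply is_derive_unique; auto_derive;
  rewrite ?Rmult_0_l, ?Rplus_0_r; auto;
  try (field; auto).
all: match goal with |- context [sqrt (1 + ?e)] =>
  replace (1 + e) with (1 - (x ^ 2 + y ^ 2) / 2) by field end; field; lra.
Qed.

Lemma det4_rot4 (s : R) (p u v w : R4) :
  det4 (rot4 s p) (rot4 s u) (rot4 s v) (rot4 s w) = det4 p u v w.
Proof.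
assert (K : forall x y, det2 (rot s x) (rot s y) = det2 x y).
{ intros x y; unfold det2, rot; cbn [fst snd].
  pose proof (sin_cos_sqr s) as P.
  transitivity ((fst x * snd y - fst y * snd x) * (sin s * sin s + cos s * cos s));
    [ring | rewrite P; ring]. }
unfold det4, rot4; cbn [fst snd]; now rewrite !K.
Qed.

Lemma tau1_rot4 x y t :
  tau1 ((x, y), t) = rot4 (2 * PI * t) ((x / sqrt 2, y / sqrt 2), (depth ((x, y), t), 0)).
Proof. reflexivity. Qed.

(** This is tau1^* dV = PI omega /\ dt; the factor PI is (1 / sqrt 2)^2 times 2 PI. *)
Lemma tau1_volume (x y t a b c a' b' c' a'' b'' c'' : R) :
  torus_chart ((x, y), t) ->
  dV (tau1 ((x, y), t)) (d4 (tau1 : VT -> V4) ((x, y), t) ((a, b), c))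
    (d4 (tau1 : VT -> V4) ((x, y), t) ((a', b'), c'))
    (d4 (tau1 : VT -> V4) ((x, y), t) ((a'', b''), c'')) =
  PI * (a * (b' * c'' - b'' * c') - b * (a' * c'' - a'' * c') + c * (a' * b'' - a'' * b')).
Proof.
intros HW; rewrite !tau1_frame, tau1_rot4 by exact HW; unfold dV; rewrite det4_rot4.
assert (Hs : 0 < depth ((x, y), t)) by now apply sqrt_lt_R0.
assert (Hs2 : depth ((x, y), t) * depth ((x, y), t) = 1 - (x * x + y * y) / 2).
{ unfold depth; rewrite sqrt_sqrt by (apply Rlt_le, HW); unfold normsq2; simpl; field. }
pose proof inv_sqrt2_sqr as H2.
(* Square roots and inverses become letters subject to polynomial relations, modulo which [ring]
   closes the goal. *)
set (s := depth ((x, y), t)) in *; set (k := / sqrt 2) in *.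
unfold det4, det2; cbn [fst snd]; unfold Rdiv; fold k.
replace (/ (2 * s)) with (/ 2 * / s) by (field; lra).
assert (Hi : s * / s = 1) by (field; lra).
set (i := / s) in *.
set (h := / 2) in *; assert (Hh : h * 2 = 1) by (unfold h; field).
assert (Hs3 : s * s = 1 - (x * x + y * y) * h) by (rewrite Hs2; unfold h; field).
clear Hs2; ring [H2 Hi Hs3 Hh].
Qed.

Lemma dot4_rot4 (s : R) (p u : R4) : dot4 (rot4 s p) (rot4 s u) = dot4 p u.
Proof.
unfold dot4, rot4, rot; cbn [fst snd].
pose proof (sin_cos_sqr s) as P.
transitivity ((fst (fst p) * fst (fst u) + snd (fst p) * snd (fst u)
  + fst (snd p) * fst (snd u) + snd (snd p) * snd (snd u)) * (sin s * sin s + cos s * cos s));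
  [ring | rewrite P; ring].
Qed.

Lemma rot_opp (s : R) (x : plane) : rot s (rot (- s) x) = x /\ rot (- s) (rot s x) = x.
Proof.
pose proof (sin_cos_sqr s) as P.
destruct x as [a b]; unfold rot; cbn [fst snd]; rewrite cos_neg, sin_neg.
split; apply f_equal2.
- transitivity (a * (sin s * sin s + cos s * cos s)); [ring | rewrite P; ring].
- transitivity (b * (sin s * sin s + cos s * cos s)); [ring | rewrite P; ring].
- transitivity (a * (sin s * sin s + cos s * cos s)); [ring | rewrite P; ring].
- transitivity (b * (sin s * sin s + cos s * cos s)); [ring | rewrite P; ring].
Qed.

Lemma depth_sqr (x y t : R) : torus_chart ((x, y), t) ->
  0 < depth ((x, y), t) /\ depth ((x, y), t) * depth ((x, y), t) = 1 - (x * x + y * y) / 2.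
Proof.
intros HW; split; [now apply sqrt_lt_R0 |].
unfold depth; rewrite sqrt_sqrt by (apply Rlt_le, HW); unfold normsq2; simpl; field.
Qed.

Lemma tau1_unit (x y t : R) : torus_chart ((x, y), t) ->
  dot4 (tau1 ((x, y), t)) (tau1 ((x, y), t)) = 1.
Proof.
intros HW; rewrite tau1_rot4, dot4_rot4; unfold dot4; cbn [fst snd].
destruct (depth_sqr x y t HW) as [_ Hs].
pose proof inv_sqrt2_sqr as H2.
rewrite Hs; unfold Rdiv; ring [H2].
Qed.

Lemma tangent_chart (x y t : R) (u : R4) : torus_chart ((x, y), t) ->
  tangentS3 (tau1 ((x, y), t)) u ->
  exists a b c : R, u = d4 (tau1 : VT -> V4) ((x, y), t) ((a, b), c).
Proof.
intros HW Hu; destruct (depth_sqr x y t HW) as [Hs _].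
assert (H2 : 0 < sqrt 2) by (apply sqrt_lt_R0; lra).
assert (H22 : sqrt 2 * sqrt 2 = 2) by (apply sqrt_sqrt; lra).
set (T := 2 * PI * t).
assert (Hu' : u = rot4 T (rot4 (- T) u)).
{ destruct u as [u1 u2]; unfold rot4; cbn [fst snd].
  now rewrite !(fun x => proj1 (rot_opp T x)). }
destruct (rot4 (- T) u) as [[u1 u2] [u3 u4]]; subst u.
unfold tangentS3 in Hu; rewrite tau1_rot4 in Hu; fold T in Hu; rewrite dot4_rot4 in Hu.
unfold dot4 in Hu; cbn [fst snd] in Hu; set (s := depth ((x, y), t)) in *.
(* After rotating back, the last component of [tau1_frame] determines c and the first two then
   determine a and b. The remaining component is forced by tangency. *)
exists (sqrt 2 * u1 + y * (u4 / s)), (sqrt 2 * u2 - x * (u4 / s)), (u4 / (2 * PI * s)).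
rewrite tau1_frame by exact HW; fold T s; f_equal.
pose proof PI_RGT_0 as HPI.
apply f_equal2; apply f_equal2.
- field; lra.
- field; lra.
- assert (K : x * u1 + y * u2 = - (sqrt 2 * s * u3)).
  { replace (x * u1 + y * u2) with (sqrt 2 * (x / sqrt 2 * u1 + y / sqrt 2 * u2))
      by (field; lra).
    replace (x / sqrt 2 * u1 + y / sqrt 2 * u2) with (- (s * u3)) by lra; ring. }
  replace (x * (sqrt 2 * u1 + y * (u4 / s)) + y * (sqrt 2 * u2 - x * (u4 / s)))
    with (sqrt 2 * (x * u1 + y * u2)) by (field; lra).
  rewrite K; replace (- (sqrt 2 * - (sqrt 2 * s * u3))) with (sqrt 2 * sqrt 2 * s * u3) by ring.
  rewrite H22; field; lra.
- field; lra.
Qed.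

Lemma tau1_onto (p : R4) : S3 p -> normsq2 (fst p) <= 1 / 2 ->
  exists q, disk (fst q) /\ tau1 q = p.
Proof.
intros Hp Hle; destruct p as [[p1 p2] [p3 p4]].
unfold S3, dot4, normsq2 in *; cbn [fst snd] in *.
destruct (polar_exists p3 p4) as [T [H3 H4]].
set (n := sqrt (p3 * p3 + p4 * p4)) in *.
pose proof PI_RGT_0 as HPI.
assert (H2 : 0 < sqrt 2) by (apply sqrt_lt_R0; lra).
assert (H22 : sqrt 2 * sqrt 2 = 2) by (apply sqrt_sqrt; lra).
(* Inversion of [tau1]: the angle T of z2 gives the time, and z1 is rotated back by T and rescaled,
   so that |x|^2 = 2 |z1|^2 <= 1. *)
exists ((sqrt 2 * fst (rot (- T) (p1, p2)), sqrt 2 * snd (rot (- T) (p1, p2))), T / (2 * PI)).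
pose proof (normsq2_rot (- T) (p1, p2)) as HN; unfold normsq2 in HN; cbn [fst snd] in HN.
assert (HR : rot T (fst (rot (- T) (p1, p2)), snd (rot (- T) (p1, p2))) = (p1, p2)).
{ rewrite <- surjective_pairing; apply rot_opp. }
set (r1 := fst (rot (- T) (p1, p2))) in *; set (r2 := snd (rot (- T) (p1, p2))) in *.
assert (HD : (sqrt 2 * r1) ^ 2 + (sqrt 2 * r2) ^ 2 = 2 * (p1 ^ 2 + p2 ^ 2)).
{ transitivity (sqrt 2 * sqrt 2 * (r1 ^ 2 + r2 ^ 2)); [ring | now rewrite H22, HN]. }
split.
- unfold disk, normsq2; cbn [fst snd]; rewrite HD; lra.
- unfold tau1, normsq2; cbn [fst snd]; rewrite HD.
  replace (2 * PI * (T / (2 * PI))) with T by (field; lra).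
  replace (sqrt 2 * r1 / sqrt 2) with r1 by (field; lra).
  replace (sqrt 2 * r2 / sqrt 2) with r2 by (field; lra).
  rewrite HR; f_equal.
  replace (1 - 2 * (p1 ^ 2 + p2 ^ 2) / 2) with (p3 * p3 + p4 * p4)
    by (replace (p3 * p3 + p4 * p4) with (1 - (p1 * p1 + p2 * p2)) by lra; field).
  fold n; unfold rot; cbn [fst snd].
  transitivity ((n * cos T, n * sin T)); [apply f_equal2; ring | now rewrite <- H3, <- H4].
Qed.

Definition hamT (F : R -> plane -> R) (q : VT) : R := F (snd q) (fst q).

Lemma hamf_tau1 F (x y t : R) : hamiltonian F -> torus_chart ((x, y), t) ->
  hamf F (tau1 ((x, y), t)) = F t (x, y).
Proof.
intros HF HW; destruct (depth_sqr x y t HW) as [Hs _].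
pose proof PI_RGT_0 as HPI.
assert (H2 : 0 < sqrt 2) by (apply sqrt_lt_R0; lra).
rewrite (hamf_polar F _ (depth ((x, y), t)) (2 * PI * t) HF Hs).
2: { unfold tau1, rot, co3; cbn [fst snd]; unfold depth; cbn [fst]; ring. }
2: { unfold tau1, rot, co4; cbn [fst snd]; unfold depth; cbn [fst]; ring. }
rewrite tau1_unit, sqrt_1 by exact HW.
replace (2 * PI * t / (2 * PI)) with t by (field; lra).
unfold corot; cbn [fst snd]; f_equal.
etransitivity; [| apply (proj2 (rot_opp (2 * PI * t) (x, y)))]; f_equal.
unfold tau1, rot, co1, co2; cbn [fst snd]; apply f_equal2; field; lra.
Qed.

Lemma pullback_ham_form F (x y t a b c : R) : hamiltonian F -> torus_chart ((x, y), t) ->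
  ham_form F (tau1 ((x, y), t)) (d4 (tau1 : VT -> V4) ((x, y), t) ((a, b), c)) =
  PI * (F t (x, y) * c).
Proof.
intros HF HW; unfold ham_form; rewrite hamf_tau1 by assumption.
replace (dangle (tau1 ((x, y), t)) (d4 (tau1 : VT -> V4) ((x, y), t) ((a, b), c)))
  with (2 * PI * c); [field |].
destruct (depth_sqr x y t HW) as [Hs _].
rewrite tau1_frame, tau1_rot4 by exact HW; set (s := depth ((x, y), t)) in *.
unfold dangle, co3, co4, rot4, rot; cbn [fst snd].
pose proof (sin_cos_sqr (2 * PI * t)) as P.
set (S := sin (2 * PI * t)) in *; set (C := cos (2 * PI * t)) in *.
set (d := - (x * a + y * b) / (2 * s)).
replace ((s * C - 0 * S) * (s * C - 0 * S) + (s * S + 0 * C) * (s * S + 0 * C))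
  with (s * s * (S * S + C * C)) by ring.
replace ((s * C - 0 * S) * (d * S + 2 * PI * c * s * C) -
  (s * S + 0 * C) * (d * C - 2 * PI * c * s * S))
  with (2 * PI * c * (s * s) * (S * S + C * C)) by ring.
rewrite P; field; lra.
Qed.

Lemma pullback_contact (x y t a b c : R) : torus_chart ((x, y), t) ->
  contact (tau1 ((x, y), t)) (d4 (tau1 : VT -> V4) ((x, y), t) ((a, b), c)) =
  (x * b - y * a) / 2 + 2 * PI * c.
Proof.
intros HW; destruct (depth_sqr x y t HW) as [Hs Hs2].
rewrite tau1_frame, tau1_rot4 by exact HW; set (s := depth ((x, y), t)) in *.
unfold contact, co1, co2, co3, co4, rot4, rot; cbn [fst snd].
pose proof (sin_cos_sqr (2 * PI * t)) as P.
pose proof inv_sqrt2_sqr as H2.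
set (S := sin (2 * PI * t)) in *; set (C := cos (2 * PI * t)) in *.
set (d := - (x * a + y * b) / (2 * s)).
unfold Rdiv; set (k := / sqrt 2) in *.
transitivity ((k * k * (x * b - y * a) + 2 * PI * c * (k * k * (x * x + y * y) + s * s))
  * (S * S + C * C)); [ring |].
rewrite P, H2, Hs2; field.
Qed.

Lemma is_derive_hamT F (q v : VT) : hamiltonian F ->
  is_derive (fun s : R => hamT F (plus q (scal s v))) 0
    (fst (fst v) * dirD (F (snd q) : V2 -> R) (fst q) (1, 0)
     + snd (fst v) * dirD (F (snd q) : V2 -> R) (fst q) (0, 1)
     + snd v * dirD (ham3 F) (snd q, fst q) (1, (0, 0))).
Proof.
intros HF; destruct (Ck_coordinatesT 1) as [H1 [H2 H3]].
destruct q as [[x y] t], v as [[a b] c]; cbn [fst snd].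
pose proof (is_derive_comp3 (fun _ : VT => True) (ham3 F) (fun q => snd q)
  (fun q => fst (fst q)) (fun q => snd (fst q)) ((x, y), t) ((a, b), c) open_all
  (Ck_ham3 1 F HF) H3 H1 H2 I) as K.
cbn [fst snd] in K.
assert (L : forall (l : VT -> R), (forall p v (s : R), l (plus p (scal s v)) = l p + s * l v) ->
  forall p v, dirD l p v = l v).
{ intros l Hl p v; apply is_derive_unique.
  apply (is_derive_ext (fun s => l p + s * l v)); [intros s; now rewrite Hl |].
  auto_derive; [easy | ring]. }
rewrite (L (fun q => snd q)), (L (fun q => fst (fst q))), (L (fun q => snd (fst q))) in K
  by reflexivity; cbn [fst snd] in K.
assert (E1 : dirD (ham3 F) (t, (x, y)) (0, (1, 0)) = dirD (F t : V2 -> R) (x, y) (1, 0)).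
{ apply Derive_ext; intros s; unfold ham3.
  change (F (t + s * 0) (x + s * 1, y + s * 0) = F t (x + s * 1, y + s * 0)).
  now rewrite Rmult_0_r, Rplus_0_r. }
assert (E2 : dirD (ham3 F) (t, (x, y)) (0, (0, 1)) = dirD (F t : V2 -> R) (x, y) (0, 1)).
{ apply Derive_ext; intros s; unfold ham3.
  change (F (t + s * 0) (x + s * 0, y + s * 1) = F t (x + s * 0, y + s * 1)).
  now rewrite Rmult_0_r, Rplus_0_r. }
refine (eq_ind _ (fun l : R => is_derive _ 0 l) K _ _).
change (c * dirD (ham3 F) (t, (x, y)) (1, (0, 0)) + a * dirD (ham3 F) (t, (x, y)) (0, (1, 0))
  + b * dirD (ham3 F) (t, (x, y)) (0, (0, 1)) =
  a * dirD (F t : V2 -> R) (x, y) (1, 0) + b * dirD (F t : V2 -> R) (x, y) (0, 1)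
  + c * dirD (ham3 F) (t, (x, y)) (1, (0, 0))).
rewrite E1, E2; ring.
Qed.

(* [tau1^* beta = PI (F dt + (x dy - y dx) / 2 + 2 PI dt)]. *)
Lemma pullback_coefficient F (a : VT) (q : VT) : hamiltonian F -> torus_chart q ->
  PI * contact (tau1 q) (d4 (tau1 : VT -> V4) q a)
    + ham_form F (tau1 q) (d4 (tau1 : VT -> V4) q a) =
  PI * (hamT F q * snd a + (fst (fst q) * snd (fst a) - snd (fst q) * fst (fst a)) / 2
    + 2 * PI * snd a).
Proof.
destruct q as [[x y] t], a as [[a b] c]; intros HF HW.
rewrite pullback_contact, pullback_ham_form by assumption.
change (PI * ((x * b - y * a) / 2 + 2 * PI * c) + PI * (F t (x, y) * c)
  = PI * (F t (x, y) * c + (x * b - y * a) / 2 + 2 * PI * c)); ring.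
Qed.

Lemma dirD_pullback_coefficient F (a b : VT) (q : VT) : hamiltonian F ->
  dirD (fun q => PI * (hamT F q * snd a
    + (fst (fst q) * snd (fst a) - snd (fst q) * fst (fst a)) / 2 + 2 * PI * snd a)) q b =
  PI * ((fst (fst b) * dirD (F (snd q) : V2 -> R) (fst q) (1, 0)
     + snd (fst b) * dirD (F (snd q) : V2 -> R) (fst q) (0, 1)
     + snd b * dirD (ham3 F) (snd q, fst q) (1, (0, 0))) * snd a
    + (fst (fst b) * snd (fst a) - snd (fst b) * fst (fst a)) / 2).
Proof.
intros HF; pose proof (is_derive_hamT F q b HF) as K.
match type of K with is_derive _ _ ?k => set (dH := k) in * end.
apply is_derive_unique; set (h := fun s : R => hamT F (plus q (scal s b))) in *.
destruct q as [[x y] t], a as [[a1 a2] a3], b as [[b1 b2] b3].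
change (is_derive (fun s : R => PI * (h s * a3
  + ((x + s * b1) * a2 - (y + s * b2) * a1) / 2 + 2 * PI * a3)) 0
  (PI * (dH * a3 + (b1 * a2 - b2 * a1) / 2))).
auto_derive; [now exists dH |].
replace (Derive (fun x : R => h x) 0) with dH by (symmetry; now apply is_derive_unique).
field.
Qed.

(** The global primitive as seen from one torus, where the term of the other Hamiltonian is
    absent. *)
Definition model_form (F : R -> plane -> R) (p v : R4) : R := PI * contact p v + ham_form F p v.

Lemma one_form_model F : hamiltonian F -> one_form (model_form F).
Proof.
intros HF; apply one_form_plus; [apply one_form_scal, one_form_contact |].
now apply one_form_ham_form.
Qed.

Lemma disk_torus_chart q : disk (fst q) -> torus_chart q.
Proof.
destruct q as [x t]; change (normsq2 x <= 1 -> 0 < 1 - normsq2 x / 2); lra.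
Qed.

(** Both sides are compared in the chart, the left one by naturality of d and the right one by
    [tau1_volume]. The time derivatives of F cancel by antisymmetry. *)
Lemma model_form_primitive F (q : VT) (u v : R4) : hamiltonian F -> disk (fst q) ->
  tangentS3 (tau1 q) u -> tangentS3 (tau1 q) v ->
  ext_d (model_form F) (tau1 q) u v =
  dV (tau1 q) (d4 (tau1 : VT -> V4) q (suspension F q)) u v.
Proof.
intros HF Hq Hu Hv; apply disk_torus_chart in Hq.
destruct q as [[x y] t].
destruct (tangent_chart x y t u Hq Hu) as [a [b [c ->]]].
destruct (tangent_chart x y t v Hq Hv) as [a' [b' [c' ->]]].
rewrite (ext_d_pullback torus_chart (tau1 : VT -> V4) (model_form F)).
- rewrite (dirD_ext_open torus_chart _ (fun q => PI * (hamT F q * c'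
    + (fst (fst q) * b' - snd (fst q) * a') / 2 + 2 * PI * c')) _ _ open_torus_chart Hq)
    by (intros q' Hq'; exact (pullback_coefficient F ((a', b'), c') q' HF Hq')).
  rewrite (dirD_ext_open torus_chart
    (fun q => model_form F (tau1 q) (d4 (tau1 : VT -> V4) q ((a, b), c)))
    (fun q => PI * (hamT F q * c
    + (fst (fst q) * b - snd (fst q) * a) / 2 + 2 * PI * c)) _ _ open_torus_chart Hq)
    by (intros q' Hq'; exact (pullback_coefficient F ((a, b), c) q' HF Hq')).
  rewrite (dirD_pullback_coefficient F ((a', b'), c') ((a, b), c)) by exact HF.
  rewrite (dirD_pullback_coefficient F ((a, b), c) ((a', b'), c')) by exact HF.
  unfold suspension, ham_vf; cbn [fst snd]; rewrite tau1_volume by exact Hq.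
  pose (Fx := dirD (F t : V2 -> R) (x, y) (1, 0)).
  pose (Fy := dirD (F t : V2 -> R) (x, y) (0, 1)).
  pose (Ft := dirD (ham3 F) (t, (x, y)) (1, (0, 0))).
  change (PI * ((a * Fx + b * Fy + c * Ft) * c' + (a * b' - b * a') / 2)
    - PI * ((a' * Fx + b' * Fy + c' * Ft) * c + (a' * b - b' * a) / 2)
    = PI * (Fy * (b * c' - b' * c) - - Fx * (a * c' - a' * c) + 1 * (a * b' - a' * b))).
  field.
- exact open_torus_chart.
- apply Ck_tau1.
- intros [[x' y'] t'] Hq'; apply nonzero_iff; rewrite tau1_unit by exact Hq'; lra.
- now apply one_form_model.
- exact Hq.
Qed.

(** * The global primitive *)

Definition ham_form' (F : R -> plane -> R) (p v : R4) : R := ham_form F (swap4 p) (swap4 v).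

Definition helicity_form (F1 F2 : R -> plane -> R) (p v : R4) : R :=
  PI * contact p v + (ham_form F1 p v + ham_form' F2 p v).

Lemma one_form_helicity F1 F2 : hamiltonian F1 -> hamiltonian F2 ->
  one_form (helicity_form F1 F2).
Proof.
intros H1 H2; apply one_form_plus; [apply one_form_scal, one_form_contact |].
apply one_form_plus; [now apply one_form_ham_form |].
now apply one_form_swap, one_form_ham_form.
Qed.

Lemma ext_d_ext_open (U : V4 -> Prop) (beta beta' : R4 -> R4 -> R) p u v :
  open U -> U p -> (forall q w, U q -> beta q w = beta' q w) ->
  ext_d beta p u v = ext_d beta' p u v.
Proof.
intros HU Hp E; unfold ext_d.
apply (f_equal2 Rminus).
- exact (dirD_ext_open (V := V4) U _ _ p u HU Hp (fun q Hq => E q v Hq)).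
- exact (dirD_ext_open (V := V4) U _ _ p v HU Hp (fun q Hq => E q u Hq)).
Qed.

Lemma open_far_swap rho : open (fun p => far rho (swap4 p)).
Proof.
intros p Hp.
assert (C : continuous swap4 p).
{ destruct p as [p1 p2].
  exact (continuous_pair (snd : V4 -> V2) (fst : V4 -> V2) (p1, p2)
    (continuous_snd _ _) (continuous_fst _ _)). }
exact (C (far rho) (open_far rho (swap4 p) Hp)).
Qed.

(** On |z1|^2 >= 1 / 2 the inequality rho < 1 leaves a margin, so even at the common boundary of the
    two tori the Hamiltonian term of the first vanishes in a whole neighbourhood. *)
Lemma far_sphere rho p : 0 < rho < 1 -> S3 p ->
  1 / 2 <= normsq2 (fst p) -> far rho p.
Proof.
intros Hr; destruct p as [[a b] [c d]]; unfold far, S3, dot4, normsq2, co1, co2; simpl.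
intros -> H; nra.
Qed.

(** Exposes the preimage behind the [epsilon] choice. As [model_form_primitive] holds at every
    preimage in the closed torus, whichever one was chosen will do. *)
Lemma pushforward_spec (tau : (R * R) * R -> R4) V p :
  (exists q, disk (fst q) /\ tau q = p) ->
  exists q, disk (fst q) /\ tau q = p /\
    pushforward tau V p = D4 (fun s => tau (plus q (scal s (V q)))) 0.
Proof.
intros [q [Hq Ep]]; unfold pushforward.
apply (epsilon_spec (inhabits p) (fun w : R4 => exists q, disk (fst q) /\ tau q = p /\
  w = D4 (fun s => tau (plus q (scal s (V q)))) 0)).
now exists (D4 (fun s => tau (plus q (scal s (V q)))) 0), q.
Qed.

(** Near each point of a closed half of the sphere the Hamiltonian form of the other half vanishes,
    so the global form coincides there with [model_form] or with its image under the exchange of z1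
    and z2, and so do the exterior derivatives. *)
Lemma helicity_form_primitive F1 F2 : hamiltonian F1 -> hamiltonian F2 ->
  Defs.primitive (double_suspension F1 F2) (helicity_form F1 F2).
Proof.
intros H1 H2 p u v Hp Hu Hv; unfold double_suspension.
destruct (hamf_support F1 H1) as [r1 [Hr1 [Z1 _]]].
destruct (hamf_support F2 H2) as [r2 [Hr2 [Z2 _]]].
destruct (Rle_dec (normsq2 (fst p)) (1 / 2)) as [Hle | Hgt].
- destruct (pushforward_spec tau1 (suspension F1) p (tau1_onto p Hp Hle)) as [q [Hq [Eq ->]]].
  subst p.
  change (D4 (fun s => tau1 (plus q (scal s (suspension F1 q)))) 0)
    with (d4 (tau1 : VT -> V4) q (suspension F1 q)).
  rewrite <- (model_form_primitive F1 q u v H1 Hq Hu Hv).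
  apply (ext_d_ext_open (fun p => far r2 (swap4 p))); [apply open_far_swap | |].
  + apply far_sphere; [exact Hr2 | |]; destruct (tau1 q) as [[a b] [c d]];
      unfold S3, dot4, normsq2 in *; simpl in *; lra.
  + intros p w Hw; unfold helicity_form, model_form, ham_form', ham_form.
    rewrite (Z2 (swap4 p) Hw); unfold Rdiv; ring.
(* The second half is reduced to the first torus by exchanging z1 and z2. *)
- assert (Hp' : S3 (swap4 p)).
  { destruct p as [[a b] [c d]]; unfold S3, dot4 in *; simpl in *; lra. }
  assert (Hle : normsq2 (fst (swap4 p)) <= 1 / 2).
  { destruct p as [[a b] [c d]]; unfold S3, dot4, normsq2 in *; simpl in *; lra. }
  assert (Ho : exists q, disk (fst q) /\ tau2 q = p).
  { destruct (tau1_onto (swap4 p) Hp' Hle) as [q [Hq Eq]]; exists q; split; [exact Hq |].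
    transitivity (swap4 (swap4 p)); [rewrite <- Eq | now destruct p].
    now destruct q as [x t]. }
  destruct (pushforward_spec tau2 (suspension F2) p Ho) as [q [Hq [Eq ->]]].
  assert (Eq' : swap4 p = tau1 q) by (rewrite <- Eq; now destruct q as [x t]).
  change (D4 (fun s => tau2 (plus q (scal s (suspension F2 q)))) 0)
    with (swap4 (d4 (tau1 : VT -> V4) q (suspension F2 q))).
  transitivity (dV (swap4 p) (d4 (tau1 : VT -> V4) q (suspension F2 q)) (swap4 u) (swap4 v)).
  (* The exchange is an even permutation of the four real coordinates, so the determinant is
     unchanged. *)
  2: { generalize (d4 (tau1 : VT -> V4) q (suspension F2 q)); intros w.
       destruct p as [p1 p2], w as [w1 w2], u as [u1 u2], v as [v1 v2].
       unfold dV, det4, swap4; cbn [fst snd]; ring. }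
  rewrite Eq', <- model_form_primitive; [| exact H2 | exact Hq | |].
  + rewrite <- Eq', <- (ext_d_swap (model_form F2)).
    apply (ext_d_ext_open (far r1)); [apply open_far | apply far_sphere; [exact Hr1 | exact Hp | lra] |].
    intros p' w Hw; unfold helicity_form, model_form, ham_form', ham_form at 1.
    rewrite (Z1 p' Hw).
    destruct p' as [[? ?] [? ?]], w as [[? ?] [? ?]].
    unfold contact, co1, co2, co3, co4, swap4; cbn [fst snd]; field.
  + rewrite <- Eq'; destruct p as [[? ?] [? ?]], u as [[? ?] [? ?]].
    unfold tangentS3, dot4, swap4 in *; simpl in *; lra.
  + rewrite <- Eq'; destruct p as [[? ?] [? ?]], v as [[? ?] [? ?]].
    unfold tangentS3, dot4, swap4 in *; simpl in *; lra.
Qed.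

(** * Coefficients of the primitive and of its wedge products *)

Lemma coef_contact (a b c : R) :
  coef contact e0 (a, (b, c)) = 0 /\
  coef contact e1 (a, (b, c)) = sin a * sin a /\
  coef contact e2 (a, (b, c)) = cos a * cos a.
Proof.
destruct (hopf_frame a b c) as [E0 [E1 E2]]; unfold coef; rewrite E0, E1, E2.
unfold contact, hopf3, hopf, co1, co2, co3, co4; cbn [fst snd].
pose proof (sin_cos_sqr b) as B; pose proof (sin_cos_sqr c) as C.
split; [ring | split].
- transitivity (sin a * sin a * (sin b * sin b + cos b * cos b)); [ring | rewrite B; ring].
- transitivity (cos a * cos a * (sin c * sin c + cos c * cos c)); [ring | rewrite C; ring].
Qed.

Lemma dirD_coef_contact (a b c : R) :
  dirD (coef contact e2) (a, (b, c)) e1 = 0 /\ dirD (coef contact e1) (a, (b, c)) e2 = 0 /\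
  dirD (coef contact e2) (a, (b, c)) e0 = - (2 * sin a * cos a) /\
  dirD (coef contact e0) (a, (b, c)) e2 = 0 /\
  dirD (coef contact e1) (a, (b, c)) e0 = 2 * sin a * cos a /\
  dirD (coef contact e0) (a, (b, c)) e1 = 0.
Proof.
assert (K : forall e, Ck 1 all3 (coef contact e))
  by (intros e; exact (Ck_coef 1 contact e one_form_contact)).
destruct (is_derive_slices _ a b c (K e0)) as [_ [K01 K02]].
destruct (is_derive_slices _ a b c (K e1)) as [K10 [_ K12]].
destruct (is_derive_slices _ a b c (K e2)) as [K20 [K21 _]].
apply is_derive_unique in K01, K02, K10, K12, K20, K21.
split; [| split; [| split; [| split; [| split]]]].
- refine (eq_trans (eq_sym K21) _); apply is_derive_unique.
  apply (is_derive_ext (fun _ => cos a * cos a)); [| apply is_derive_const_R].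
  intros s; exact (eq_sym (proj2 (proj2 (coef_contact a s c)))).
- refine (eq_trans (eq_sym K12) _); apply is_derive_unique.
  apply (is_derive_ext (fun _ => sin a * sin a)); [| apply is_derive_const_R].
  intros s; exact (eq_sym (proj1 (proj2 (coef_contact a b s)))).
- refine (eq_trans (eq_sym K20) _); apply is_derive_unique.
  apply (is_derive_ext (fun a => cos a * cos a)); [intros s; exact (eq_sym (proj2 (proj2 (coef_contact s b c)))) |].
  auto_derive; [easy | ring].
- refine (eq_trans (eq_sym K02) _); apply is_derive_unique.
  apply (is_derive_ext (fun _ => 0)); [| apply is_derive_const_R].
  intros s; exact (eq_sym (proj1 (coef_contact a b s))).
- refine (eq_trans (eq_sym K10) _); apply is_derive_unique.
  apply (is_derive_ext (fun a => sin a * sin a)); [intros s; exact (eq_sym (proj1 (proj2 (coef_contact s b c)))) |].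
  auto_derive; [easy | ring].
- refine (eq_trans (eq_sym K01) _); apply is_derive_unique.
  apply (is_derive_ext (fun _ => 0)); [| apply is_derive_const_R].
  intros s; exact (eq_sym (proj1 (coef_contact a s c))).
Qed.

(** Among the Hopf directions only xi2 moves the angle of z2, the one differential that occurs in
    [ham_form]. *)
Lemma coef_ham_form F q : coef (ham_form F) e0 q = 0 /\ coef (ham_form F) e1 q = 0.
Proof.
destruct q as [a [b c]]; revert a b c; change (forall a b c : R,
  coef (ham_form F) e0 (a, (b, c)) = 0 /\ coef (ham_form F) e1 (a, (b, c)) = 0).
intros a b c; destruct (hopf_frame a b c) as [E0 [E1 _]].
unfold coef; rewrite E0, E1; unfold ham_form, dangle, hopf3, hopf, co3, co4; cbn [fst snd].
unfold Rdiv; split; ring.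
Qed.

Lemma coef_ham_form' F q : coef (ham_form' F) e0 q = 0 /\ coef (ham_form' F) e2 q = 0.
Proof.
destruct q as [a [b c]]; revert a b c; change (forall a b c : R,
  coef (ham_form' F) e0 (a, (b, c)) = 0 /\ coef (ham_form' F) e2 (a, (b, c)) = 0).
intros a b c; destruct (hopf_frame a b c) as [E0 [_ E2]].
unfold coef; rewrite E0, E2; unfold ham_form', ham_form, dangle, swap4, hopf3, hopf, co3, co4;
  cbn [fst snd].
unfold Rdiv; split; ring.
Qed.

Lemma coef_ham_form_value F (a b c : R) : cos a <> 0 ->
  coef (ham_form F) e2 (a, (b, c)) = hamf F (hopf a b c) / 2.
Proof.
intros Ha; destruct (hopf_frame a b c) as [_ [_ E2]].
unfold coef; rewrite E2; unfold ham_form.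
replace (dangle (hopf3 (a, (b, c))) ((0, 0), (- cos a * sin c, cos a * cos c))) with 1.
- unfold hopf3; cbn [fst snd]; field.
- unfold dangle, hopf3, hopf, co3, co4; cbn [fst snd].
  pose proof (sin_cos_sqr c) as C.
  replace (cos a * cos c * (cos a * cos c) - cos a * sin c * (- cos a * sin c))
    with (cos a * cos a * (sin c * sin c + cos c * cos c)) by ring.
  replace (cos a * cos c * (cos a * cos c) + cos a * sin c * (cos a * sin c))
    with (cos a * cos a * (sin c * sin c + cos c * cos c)) by ring.
  rewrite C; field; exact Ha.
Qed.

(** In Hopf coordinates the exchange of z1 and z2 is eta -> PI / 2 - eta together with the exchange
    of xi1 and xi2. *)
Lemma coef_ham_form'_value F (a b c : R) : sin a <> 0 ->
  coef (ham_form' F) e1 (a, (b, c)) = hamf F (hopf (PI / 2 - a) c b) / 2.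
Proof.
intros Ha; destruct (hopf_frame a b c) as [_ [E1 _]].
unfold coef; rewrite E1; unfold ham_form', ham_form.
assert (Es : swap4 (hopf3 (a, (b, c))) = hopf (PI / 2 - a) c b).
{ unfold hopf3, hopf, swap4; cbn [fst snd]; now rewrite sin_shift, cos_shift. }
rewrite Es.
replace (dangle (hopf (PI / 2 - a) c b) (swap4 ((- sin a * sin b, sin a * cos b), (0, 0)))) with 1;
  [field |].
unfold dangle, hopf, co3, co4, swap4; cbn [fst snd]; rewrite cos_shift.
pose proof (sin_cos_sqr b) as B.
replace (sin a * cos b * (sin a * cos b) - sin a * sin b * (- sin a * sin b))
  with (sin a * sin a * (sin b * sin b + cos b * cos b)) by ring.
replace (sin a * cos b * (sin a * cos b) + sin a * sin b * (sin a * sin b))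
  with (sin a * sin a * (sin b * sin b + cos b * cos b)) by ring.
rewrite B; field; exact Ha.
Qed.

Lemma dirD_zero {V : NormedModule R_AbsRing} (f : V -> R) (p v : V) :
  (forall q, f q = 0) -> dirD f p v = 0.
Proof.
intros Hf; unfold dirD; rewrite (Derive_ext _ (fun _ => 0)); [apply Derive_const |].
intros s; apply Hf.
Qed.

(** According to the side of |z1|^2 = 1 / 2 on which the point lies, one of the two forms vanishes
    on a neighbourhood, so its derivatives, which enter the wedge coefficients, vanish too. *)
Lemma disjoint_supports F1 F2 q : hamiltonian F1 -> hamiltonian F2 ->
  (coef (ham_form F1) e2 q = 0 /\ forall v, dirD (coef (ham_form F1) e2) q v = 0) \/
  (coef (ham_form' F2) e1 q = 0 /\ forall v, dirD (coef (ham_form' F2) e1) q v = 0).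
Proof.
intros H1 H2.
destruct (hamf_support F1 H1) as [r1 [Hr1 [Z1 _]]].
destruct (hamf_support F2 H2) as [r2 [Hr2 [Z2 _]]].
assert (Hcont : forall q, continuous hopf3 q).
{ intros q'; apply (continuous_ext (fun q => ((co1 (hopf3 q), co2 (hopf3 q)),
    (co3 (hopf3 q), co4 (hopf3 q))) : V4)); [intros x; apply pair4_eta |].
  destruct (Ck_hopf3 0) as [K1 [K2 [K3 K4]]].
  apply continuous_pair4; [exact (proj1 K1 q' I) | exact (proj1 K2 q' I)
    | exact (proj1 K3 q' I) | exact (proj1 K4 q' I)]. }
assert (HS : S3 (hopf3 q)) by apply hopf_unit.
destruct (Rle_dec (1 / 2) (normsq2 (fst (hopf3 q)))) as [Hle | Hgt]; [left | right].
- assert (Z : forall q, far r1 (hopf3 q) -> coef (ham_form F1) e2 q = 0).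
  { intros q' Hq'; unfold coef, ham_form; rewrite Z1 by exact Hq'; unfold Rdiv; ring. }
  assert (Hf : far r1 (hopf3 q)) by (now apply far_sphere).
  split; [now apply Z |]; intros v.
  rewrite (dirD_ext_open (fun q => far r1 (hopf3 q)) _ (fun _ => 0)); auto.
  + apply dirD_zero; reflexivity.
  + intros q' Hq'; exact (Hcont q' _ (open_far r1 _ Hq')).
- assert (Z : forall q, far r2 (swap4 (hopf3 q)) -> coef (ham_form' F2) e1 q = 0).
  { intros q' Hq'; unfold coef, ham_form', ham_form; rewrite Z2 by exact Hq'.
    unfold Rdiv; ring. }
  assert (Hf : far r2 (swap4 (hopf3 q))).
  { apply far_sphere; [exact Hr2 | |]; destruct (hopf3 q) as [[? ?] [? ?]];
      unfold S3, dot4, normsq2 in *; simpl in *; lra. }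
  split; [now apply Z |]; intros v.
  rewrite (dirD_ext_open (fun q => far r2 (swap4 (hopf3 q))) _ (fun _ => 0)); auto.
  + apply dirD_zero; reflexivity.
  + intros q' Hq'; exact (Hcont q' _ (open_far_swap r2 _ Hq')).
Qed.

(** Bilinear expansion from which the products of two Hamiltonian forms have dropped out: the self
    products because each form has a single nonzero coefficient, the mixed ones because the supports
    are disjoint. *)
Lemma wedge_coef_helicity F1 F2 (a b c : R) : hamiltonian F1 -> hamiltonian F2 ->
  wedge_coef (helicity_form F1 F2) (helicity_form F1 F2) (a, (b, c)) =
  PI * PI * wedge_coef contact contact (a, (b, c))
  + (PI * (wedge_coef contact (ham_form F1) (a, (b, c))
           + wedge_coef (ham_form F1) contact (a, (b, c)))
   + PI * (wedge_coef contact (ham_form' F2) (a, (b, c))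
           + wedge_coef (ham_form' F2) contact (a, (b, c)))).
Proof.
intros H1 H2; set (q := (a, (b, c)) : V3).
assert (O1 : one_form (ham_form F1)) by now apply one_form_ham_form.
assert (O2 : one_form (ham_form' F2)) by now apply one_form_swap, one_form_ham_form.
assert (D : forall e v, dirD (coef (helicity_form F1 F2) e) q v =
  PI * dirD (coef contact e) q v
  + (dirD (coef (ham_form F1) e) q v + dirD (coef (ham_form' F2) e) q v)).
{ intros e v; apply is_derive_unique.
  assert (K : forall beta, one_form beta ->
    is_derive (fun s : R => coef beta e (plus q (scal s v))) 0 (dirD (coef beta e) q v)).
  { intros beta Hb; exact (is_derive_dirD 0 all3 _ q v (Ck_coef 1 beta e Hb) I). }
  apply (is_derive_plus (fun s : R => PI * coef contact e (plus q (scal s v)))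
    (fun s : R => coef (ham_form F1) e (plus q (scal s v))
       + coef (ham_form' F2) e (plus q (scal s v)))).
  - apply (is_derive_scal (fun s : R => coef contact e (plus q (scal s v)))).
    apply K, one_form_contact.
  - apply (is_derive_plus (fun s : R => coef (ham_form F1) e (plus q (scal s v)))
      (fun s : R => coef (ham_form' F2) e (plus q (scal s v)))); now apply K. }
assert (N : forall e, coef (helicity_form F1 F2) e q =
  PI * coef contact e q + (coef (ham_form F1) e q + coef (ham_form' F2) e q)) by reflexivity.
assert (Z : forall v, dirD (coef (ham_form F1) e0) q v = 0 /\ dirD (coef (ham_form F1) e1) q v = 0 /\
  dirD (coef (ham_form' F2) e0) q v = 0 /\ dirD (coef (ham_form' F2) e2) q v = 0).
{ intros v; repeat split; apply dirD_zero; intros q';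
    [exact (proj1 (coef_ham_form F1 q')) | exact (proj2 (coef_ham_form F1 q'))
    | exact (proj1 (coef_ham_form' F2 q')) | exact (proj2 (coef_ham_form' F2 q'))]. }
destruct (coef_ham_form F1 q) as [Z0 Z1], (coef_ham_form' F2 q) as [Z2 Z3].
pose proof (disjoint_supports F1 F2 q H1 H2) as HS.
unfold wedge_coef.
set (h := coef (helicity_form F1 F2)) in *; set (k := coef contact) in *.
set (f1 := coef (ham_form F1)) in *; set (f2 := coef (ham_form' F2)) in *.
clearbody h k f1 f2 q.
rewrite !D, !N, Z0, Z1, Z2, Z3.
destruct (Z e0) as [_ [A1 [_ A2]]], (Z e1) as [A3 [_ [A4 A5]]], (Z e2) as [A6 [A7 [A8 _]]].
rewrite A1, A2, A3, A4, A5, A6, A7, A8.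
destruct HS as [[ZF DZ] | [ZF DZ]]; rewrite ZF, !DZ; ring.
Qed.

Lemma wedge_coef_contact (a b c : R) :
  wedge_coef contact contact (a, (b, c)) = 2 * sin a * cos a.
Proof.
unfold wedge_coef.
destruct (coef_contact a b c) as [-> [-> ->]].
destruct (dirD_coef_contact a b c) as [-> [-> [-> [-> [-> ->]]]]].
pose proof (sin_cos_sqr a) as A.
transitivity (2 * sin a * cos a * (sin a * sin a + cos a * cos a)); [ring | rewrite A; ring].
Qed.

Lemma wedge_coef_ham_form F (a b c : R) : cos a <> 0 ->
  wedge_coef (ham_form F) contact (a, (b, c)) = hamf F (hopf a b c) * (sin a * cos a).
Proof.
intros Ha; unfold wedge_coef.
destruct (coef_ham_form F (a, (b, c))) as [-> ->].
destruct (dirD_coef_contact a b c) as [-> [-> [-> [-> [-> ->]]]]].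
rewrite coef_ham_form_value by exact Ha; field.
Qed.

Lemma wedge_coef_ham_form' F (a b c : R) : sin a <> 0 ->
  wedge_coef (ham_form' F) contact (a, (b, c)) =
  hamf F (hopf (PI / 2 - a) c b) * (sin a * cos a).
Proof.
intros Ha; unfold wedge_coef.
destruct (coef_ham_form' F (a, (b, c))) as [-> ->].
destruct (dirD_coef_contact a b c) as [-> [-> [-> [-> [-> ->]]]]].
rewrite coef_ham_form'_value by exact Ha; field.
Qed.

(** * The helicity integral in Hopf coordinates *)

Lemma RInt_affine (h : R -> R) (u v a b : R) : (forall x, continuous h x) ->
  u * RInt (fun y => h (u * y + v)) a b = RInt h (u * a + v) (u * b + v).
Proof.
intros Hh.
rewrite <- (RInt_comp_lin (V := R_CompleteNormedModule) h u v a b) by now apply ex_RInt_cont.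
symmetry; apply (RInt_scal (V := R_CompleteNormedModule) (fun y => h (u * y + v)) a b u).
apply ex_RInt_cont; intros x.
apply (continuous_comp (fun y => u * y + v) h); [| apply Hh].
apply (ex_derive_continuous (fun y => u * y + v)); auto_derive; easy.
Qed.

(** Absorbs the shift by xi2 which the corotating frame leaves in the integral over xi1. *)
Lemma RInt_periodic_shift (h : R -> R) (T c : R) :
  (forall x, continuous h x) -> (forall x, h (x + T) = h x) ->
  RInt (fun x => h (x - c)) 0 T = RInt h 0 T.
Proof.
intros Hc Hp.
assert (Hex : forall a b, ex_RInt h a b) by (intros; now apply ex_RInt_cont).
assert (Ch : forall a b d, RInt h a b + RInt h b d = RInt h a d).
{ intros a b d; exact (RInt_Chasles (V := R_CompleteNormedModule) h a b d (Hex a b) (Hex b d)). }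
assert (E1 : RInt (fun x => h (x - c)) 0 T = RInt h (- c) (T - c)).
{ pose proof (RInt_affine h 1 (- c) 0 T Hc) as K.
  replace (1 * 0 + - c) with (- c) in K by ring.
  replace (1 * T + - c) with (T - c) in K by ring.
  rewrite <- K, Rmult_1_l; apply RInt_ext; intros x _; f_equal; ring. }
assert (E2 : RInt h T (T - c) = RInt h 0 (- c)).
{ pose proof (RInt_affine h 1 T 0 (- c) Hc) as K.
  replace (1 * 0 + T) with T in K by ring.
  replace (1 * - c + T) with (T - c) in K by ring.
  rewrite <- K, Rmult_1_l; apply RInt_ext; intros x _.
  rewrite <- (Hp x); f_equal; ring. }
pose proof (Ch (- c) 0 T); pose proof (Ch (- c) T (T - c)); pose proof (Ch 0 (- c) 0).
assert (Z : RInt h 0 0 = 0) by exact (RInt_point 0 h).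
lra.
Qed.

(** Contains the Jacobian r, so that its [RInt3] over time, radius and angle is a time integral of
    [disk_integral]. *)
Definition polar3 (f : V3 -> R) (p : V3) : R :=
  f (fst p, (fst (snd p) * cos (snd (snd p)), fst (snd p) * sin (snd (snd p)))) * fst (snd p).

Lemma Ck_polar3 k (f : V3 -> R) : Ck k all3 f -> Ck k all3 (polar3 f).
Proof.
intros Hf; destruct (Ck_coordinates3 k) as [H0 [H1 H2]].
destruct (Ck_sin_cos k _ _ open_all H2) as [HS HC].
apply Ck_mult; [exact open_all | | exact H1].
apply (Ck_comp3 k all3 f); [exact open_all | exact Hf | exact H0 | |];
  now apply Ck_mult; [exact open_all | |].
Qed.

Lemma Ck_all_continuous k (f : V3 -> R) : Ck k all3 f -> forall q, continuous f q.
Proof. intros Hf q; exact (Ck_continuous k all3 f q Hf I). Qed.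

Definition polar_fiber (F : R -> plane -> R) (t r : R) : R :=
  RInt (fun th => F t (r * cos th, r * sin th)) 0 (2 * PI).

Lemma continuous_ham_polar F (t r th : R) : hamiltonian F ->
  continuous (fun z : R * R => F t (fst z * cos (snd z), fst z * sin (snd z))) (r, th).
Proof.
intros HF; apply (continuous_triple (ham3 F) _ (fun _ => t)
  (fun z : R * R => fst z * cos (snd z)) (fun z : R * R => fst z * sin (snd z))).
- exact (Ck_all_continuous 0 _ (Ck_ham3 0 F HF)).
- apply continuous_const.
- apply (continuous_mult (fun z : R * R => fst z) (fun z : R * R => cos (snd z)));
    [apply continuous_fst | apply (continuous_comp (snd : R * R -> R) cos);
      [apply continuous_snd | apply continuous_cos]].
- apply (continuous_mult (fun z : R * R => fst z) (fun z : R * R => sin (snd z)));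
    [apply continuous_fst | apply (continuous_comp (snd : R * R -> R) sin);
      [apply continuous_snd | apply continuous_sin]].
Qed.

Lemma continuous_polar_fiber F (t r : R) : hamiltonian F -> continuous (polar_fiber F t) r.
Proof.
intros HF; apply (continuous_RInt_param (fun r th => F t (r * cos th, r * sin th))).
intros r' th; now apply continuous_ham_polar.
Qed.

Lemma disk_integral_fiber F (t : R) : hamiltonian F ->
  disk_integral (F t) = RInt (fun r => polar_fiber F t r * r) 0 1.
Proof.
intros HF; apply RInt_ext; intros r _.
apply (RInt_mult_r (fun th => F t (r * cos th, r * sin th))); intros th.
exact (proj1 (continuous_slice2 (fun r th => F t (r * cos th, r * sin th))
  (fun r th => continuous_ham_polar F t r th HF) r th)).
Qed.

Lemma polar_fiber_outside F (t r : R) : hamiltonian F -> 1 <= r -> polar_fiber F t r = 0.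
Proof.
intros HF Hr; destruct (hamf_support F HF) as [rho [Hrho [_ Z]]].
transitivity (RInt (fun _ => 0) 0 (2 * PI)); [| apply RInt_zero].
apply RInt_ext; intros th _; apply Z; rewrite normsq2_polar; nra.
Qed.

(** Substitution r = sqrt 2 sin a: r dr = 2 sin a cos a da, whence the factor 1 / 2. The range
    becomes [0, sqrt 2], and beyond r = 1 the Hamiltonian is zero. *)
Lemma hopf_radial_integral F (t : R) : hamiltonian F ->
  RInt (fun a => polar_fiber F t (sqrt 2 * sin a) * (sin a * cos a)) 0 (PI / 2) =
  disk_integral (F t) * / 2.
Proof.
intros HF; rewrite (disk_integral_fiber F t HF).
assert (H2 : 0 < sqrt 2) by (apply sqrt_lt_R0; lra).
assert (H22 : sqrt 2 * sqrt 2 = 2) by (apply sqrt_sqrt; lra).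
assert (Hc : forall r, continuous (fun r => polar_fiber F t r * r) r).
{ intros r; apply (continuous_mult (polar_fiber F t) (fun r => r));
    [now apply continuous_polar_fiber | apply continuous_id]. }
assert (K : RInt (fun a => scal (sqrt 2 * cos a)
    ((fun r => polar_fiber F t r * r) (sqrt 2 * sin a))) 0 (PI / 2) =
  RInt (fun r => polar_fiber F t r * r) (sqrt 2 * sin 0) (sqrt 2 * sin (PI / 2))).
{ apply (RInt_comp (V := R_CompleteNormedModule) (fun r => polar_fiber F t r * r)
    (fun a => sqrt 2 * sin a) (fun a => sqrt 2 * cos a)); [intros a _; apply Hc |].
  intros a _; split; [auto_derive; [easy | ring] |].
  apply (ex_derive_continuous (fun a => sqrt 2 * cos a)); auto_derive; easy. }
rewrite sin_0, sin_PI2, Rmult_0_r, Rmult_1_r in K.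
assert (Hm : RInt (fun r => polar_fiber F t r * r) 0 (sqrt 2) =
  RInt (fun r => polar_fiber F t r * r) 0 1).
{ rewrite <- (RInt_Chasles (V := R_CompleteNormedModule) (fun r => polar_fiber F t r * r) 0 1 (sqrt 2))
    by (now apply ex_RInt_cont).
  assert (Z : RInt (fun r => polar_fiber F t r * r) 1 (sqrt 2) = 0).
  { transitivity (RInt (fun _ => 0) 1 (sqrt 2)); [| apply RInt_zero].
    apply RInt_ext; intros r Hr; rewrite polar_fiber_outside; [apply Rmult_0_l | exact HF |].
    assert (1 <= sqrt 2) by nra.
    rewrite Rmin_left in Hr by lra; lra. }
  rewrite Z; apply Rplus_0_r. }
rewrite Hm in K; rewrite <- K.
refine (eq_trans _ (RInt_mult_r _ (/ 2) 0 (PI / 2) _)).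
- apply RInt_ext; intros a _.
  change (polar_fiber F t (sqrt 2 * sin a) * (sin a * cos a) =
    sqrt 2 * cos a * (polar_fiber F t (sqrt 2 * sin a) * (sqrt 2 * sin a)) * / 2).
  transitivity (/ 2 * (sqrt 2 * sqrt 2) * (polar_fiber F t (sqrt 2 * sin a) * (sin a * cos a)));
    [rewrite H22; field | ring].
- intros a; apply (continuous_mult (fun a => sqrt 2 * cos a)
    (fun a => (fun r => polar_fiber F t r * r) (sqrt 2 * sin a))).
  + apply (ex_derive_continuous (fun a => sqrt 2 * cos a)); auto_derive; easy.
  + apply (continuous_comp (fun a => sqrt 2 * sin a) (fun r => polar_fiber F t r * r));
      [| apply Hc].
    apply (ex_derive_continuous (fun a => sqrt 2 * sin a)); auto_derive; easy.
Qed.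

(** [hamf] along [hopf] in closed form. It is continuous also at eta = PI / 2, where the angle of z2
    is lost, as Fubini requires. *)
Definition hopf_ham (F : R -> plane -> R) (q : V3) : R :=
  ham3 F (snd (snd q) / (2 * PI),
    (sqrt 2 * sin (fst q) * cos (fst (snd q) - snd (snd q)),
     sqrt 2 * sin (fst q) * sin (fst (snd q) - snd (snd q)))).

Lemma continuous_hopf_ham F q : hamiltonian F ->
  continuous (fun q => hopf_ham F q * (sin (fst q) * cos (fst q))) q.
Proof.
intros HF; destruct (Ck_coordinates3 0) as [H0 [H1 H2]].
destruct (Ck_sin_cos 0 _ _ open_all H0) as [S0 C0].
destruct (Ck_sin_cos 0 _ _ open_all (Ck_minus 0 _ _ _ open_all H1 H2)) as [SD CD].
apply (Ck_all_continuous 0); apply Ck_mult; [exact open_all | |].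
2: { now apply Ck_mult; [exact open_all | |]. }
pose proof (Ck_const 0 all3 (sqrt 2) open_all) as HC2.
apply (Ck_comp3 0 all3 (ham3 F)); [exact open_all | now apply Ck_ham3 | | |].
- apply Ck_mult; [exact open_all | exact H2 | apply Ck_const, open_all].
- apply Ck_mult; [exact open_all | | exact CD]; now apply Ck_mult; [exact open_all | |].
- apply Ck_mult; [exact open_all | | exact SD]; now apply Ck_mult; [exact open_all | |].
Qed.

Lemma hamf_hopf F (a b c : R) : hamiltonian F -> 0 < cos a ->
  hamf F (hopf a b c) = hopf_ham F (a, (b, c)).
Proof.
intros HF Ha; rewrite (hamf_polar F (hopf a b c) (cos a) c HF Ha) by reflexivity.
rewrite hopf_unit, sqrt_1; unfold corot, hopf_ham, ham3, hopf, co1, co2, rot; cbn [fst snd].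
replace (- (2 * PI * (c / (2 * PI)))) with (- c) by (field; apply PI_neq0).
rewrite cos_neg, sin_neg, cos_minus, sin_minus.
do 2 f_equal; [field | field].
Qed.

Lemma continuous_disk_integral F (t : R) : hamiltonian F ->
  continuous (fun t => disk_integral (F t)) t.
Proof.
intros HF; pose proof (Ck_all_continuous 0 _ (Ck_polar3 0 _ (Ck_ham3 0 F HF))) as HG.
apply (continuous_RInt_param (fun t r =>
  RInt (fun th => polar3 (ham3 F) (t, (r, th))) 0 (2 * PI))).
intros t' r; now apply continuous_RInt_inner.
Qed.

(** The factor PI is 2 PI from t = xi2 / (2 PI) times 1 / 2 from the radial substitution. *)
Lemma hopf_ham_integral F : hamiltonian F ->
  RInt3 (fun q => hopf_ham F q * (sin (fst q) * cos (fst q))) 0 (PI / 2) 0 (2 * PI) 0 (2 * PI) =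
  PI * RInt (fun t => disk_integral (F t)) 0 1.
Proof.
intros HF; pose proof PI_RGT_0 as HPI.
set (G := fun q => hopf_ham F q * (sin (fst q) * cos (fst q))).
assert (HG : forall q, continuous G q) by (intros q; now apply continuous_hopf_ham).
set (G' := fun p : V3 => G (fst p, (snd (snd p), fst (snd p)))).
assert (HG' : forall q, continuous G' q).
{ intros q; destruct (Ck_coordinates3 0) as [H0 [H1 H2]].
  apply (continuous_triple G V3 (fun p => fst p) (fun p => snd (snd p)) (fun p => fst (snd p)) q HG);
    now apply (Ck_all_continuous 0). }
(* The order becomes xi2, eta, xi1: at a fixed time, eta and xi1 are then the radius and, up to a
   shift, the polar angle on the disk. *)
rewrite RInt3_swap23 by exact HG.
change (RInt3 G' 0 (PI / 2) 0 (2 * PI) 0 (2 * PI) = PI * RInt (fun t => disk_integral (F t)) 0 1).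
rewrite RInt3_swap12 by exact HG'.
transitivity (RInt (fun c => disk_integral (F (/ (2 * PI) * c + 0)) * / 2) 0 (2 * PI)).
- apply RInt_ext; intros c _.
  rewrite <- hopf_radial_integral by exact HF.
  apply RInt_ext; intros a _; unfold G', G; cbn [fst snd].
  set (w := sin a * cos a).
  transitivity (RInt (fun b => hopf_ham F (a, (b, c))) 0 (2 * PI) * w).
  + apply RInt_mult_r; intros b.
    apply (continuous_comp (fun b => b - c) (fun x => F (c / (2 * PI))
      (sqrt 2 * sin a * cos x, sqrt 2 * sin a * sin x))).
    * apply (ex_derive_continuous (fun b => b - c)); auto_derive; easy.
    * exact (proj1 (continuous_slice2 (fun r th => F (c / (2 * PI)) (r * cos th, r * sin th))
        (fun r th => continuous_ham_polar F _ r th HF) (sqrt 2 * sin a) (b - c))).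
  + f_equal; unfold polar_fiber.
    replace (/ (2 * PI) * c + 0) with (c / (2 * PI)) by (unfold Rdiv; ring).
    apply (RInt_periodic_shift (fun x => F (c / (2 * PI))
      (sqrt 2 * sin a * cos x, sqrt 2 * sin a * sin x)) (2 * PI) c).
    * intros x.
      exact (proj1 (continuous_slice2 (fun r th => F (c / (2 * PI)) (r * cos th, r * sin th))
        (fun r th => continuous_ham_polar F _ r th HF) (sqrt 2 * sin a) x)).
    * intros x; now rewrite cos_plus, sin_plus, cos_2PI, sin_2PI, !Rmult_1_r, !Rmult_0_r,
        Rplus_0_r, Rminus_0_r.
- pose proof (RInt_affine (fun t => disk_integral (F t)) (/ (2 * PI)) 0 0 (2 * PI)
    (fun t => continuous_disk_integral F t HF)) as K.
  replace (/ (2 * PI) * 0 + 0) with 0 in K by ring.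
  replace (/ (2 * PI) * (2 * PI) + 0) with 1 in K by (field; lra).
  rewrite <- K.
  rewrite RInt_mult_r; [field; lra |]; intros c.
  apply (continuous_comp (fun c => / (2 * PI) * c + 0) (fun t => disk_integral (F t)));
    [| now apply continuous_disk_integral].
  apply (ex_derive_continuous (fun c => / (2 * PI) * c + 0)); auto_derive; lra.
Qed.

Lemma wedge_ham_form_integral F : hamiltonian F ->
  RInt3 (wedge_coef (ham_form F) contact) 0 (PI / 2) 0 (2 * PI) 0 (2 * PI) =
  PI * RInt (fun t => disk_integral (F t)) 0 1.
Proof.
intros HF; pose proof PI_RGT_0 as HPI; rewrite <- hopf_ham_integral by exact HF.
apply RInt3_ext; intros a b c Ha _ _.
(* Equality of integrands is needed at interior points only, which avoids eta = PI / 2, where cos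
   vanishes. *)
rewrite Rmin_left, Rmax_right in Ha by lra.
assert (Hc : 0 < cos a) by (apply cos_gt_0; lra).
rewrite wedge_coef_ham_form by lra; now rewrite hamf_hopf.
Qed.

(** The reflection eta -> PI / 2 - eta with exchanged angles reduces this to the integral for the
    first torus. *)
Lemma wedge_ham_form'_integral F : hamiltonian F ->
  RInt3 (wedge_coef (ham_form' F) contact) 0 (PI / 2) 0 (2 * PI) 0 (2 * PI) =
  PI * RInt (fun t => disk_integral (F t)) 0 1.
Proof.
intros HF; pose proof PI_RGT_0 as HPI; rewrite <- hopf_ham_integral by exact HF.
set (G := fun q : V3 => hopf_ham F q * (sin (fst q) * cos (fst q))).
assert (HG : forall q, continuous G q) by (intros q; now apply continuous_hopf_ham).
transitivity (RInt3 (fun q => G (PI / 2 - fst q, (snd (snd q), fst (snd q))))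
  0 (PI / 2) 0 (2 * PI) 0 (2 * PI)).
- apply RInt3_ext; intros a b c Ha _ _.
  rewrite Rmin_left, Rmax_right in Ha by lra.
  assert (Hs : 0 < sin a) by (apply sin_gt_0; lra).
  rewrite wedge_coef_ham_form' by lra; unfold G; cbn [fst snd].
  rewrite hamf_hopf; [| exact HF | rewrite cos_shift; exact Hs].
  rewrite sin_shift, cos_shift; apply (f_equal2 Rmult); [reflexivity | apply Rmult_comm].
- rewrite RInt3_swap23.
  2: { intros q; destruct (Ck_coordinates3 0) as [H0 [H1 H2]].
       apply (continuous_triple G V3 (fun p => PI / 2 - fst p) (fun p => snd (snd p))
         (fun p => fst (snd p)) q HG); apply (Ck_all_continuous 0); auto.
       apply Ck_minus; [exact open_all | apply Ck_const, open_all | exact H0]. }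
  cbn [fst snd]; unfold RInt3.
  set (H := fun a => RInt (fun b => RInt (fun c => G (a, (b, c))) 0 (2 * PI)) 0 (2 * PI)).
  assert (HH : forall a, continuous H a).
  { intros a; apply (continuous_RInt_param (fun a b => RInt (fun c => G (a, (b, c))) 0 (2 * PI))).
    intros a' b; now apply continuous_RInt_inner. }
  pose proof (RInt_affine H (-1) (PI / 2) 0 (PI / 2) HH) as K.
  replace (-1 * 0 + PI / 2) with (PI / 2) in K by ring.
  replace (-1 * (PI / 2) + PI / 2) with 0 in K by ring.
  (* The sign of the reversed bounds cancels the slope -1 of the reflection. *)
  assert (S : RInt H (PI / 2) 0 = - RInt H 0 (PI / 2)).
  { symmetry; exact (opp_RInt_swap (V := R_CompleteNormedModule) H 0 (PI / 2)
      (ex_RInt_cont H 0 (PI / 2) HH)). }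
  transitivity (RInt (fun y => H (-1 * y + PI / 2)) 0 (PI / 2)); [| transitivity (RInt H 0 (PI / 2)); [lra | reflexivity]].
  apply RInt_ext; intros a _; unfold H.
  now replace (-1 * a + PI / 2) with (PI / 2 - a) by ring.
Qed.

Lemma RInt_const_R (c a b : R) : RInt (fun _ => c) a b = (b - a) * c.
Proof. exact (RInt_const (V := R_CompleteNormedModule) a b c). Qed.

(** Since alpha /\ d alpha = 2 dV on the sphere, the value is twice the volume 2 PI^2. *)
Lemma wedge_contact_integral :
  RInt3 (wedge_coef contact contact) 0 (PI / 2) 0 (2 * PI) 0 (2 * PI) = 4 * (PI * PI).
Proof.
transitivity (RInt (fun a => 4 * (PI * PI) * (2 * sin a * cos a)) 0 (PI / 2)).
- apply RInt_ext; intros a _.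
  transitivity (RInt (fun b : R => 2 * PI * (2 * sin a * cos a)) 0 (2 * PI)).
  + apply RInt_ext; intros b _.
    transitivity (RInt (fun c : R => 2 * sin a * cos a) 0 (2 * PI)).
    * apply RInt_ext; intros c _; apply wedge_coef_contact.
    * refine (eq_trans (RInt_const_R _ _ _) _);
      match goal with |- ?x = ?y => change (@eq R x y) end; ring.
  + refine (eq_trans (RInt_const_R _ _ _) _);
      match goal with |- ?x = ?y => change (@eq R x y) end; ring.
- refine (eq_trans (RInt_FTC (fun a => 4 * (PI * PI) * (sin a * sin a))
    (fun a => 4 * (PI * PI) * (2 * sin a * cos a)) _ _ _ _) _).
  + intros a; auto_derive; [easy | ring].
  + intros a; apply (ex_derive_continuous (fun a => 4 * (PI * PI) * (2 * sin a * cos a))).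
    auto_derive; easy.
  + cbv beta; rewrite sin_PI2, sin_0.
    match goal with |- ?x = ?y => change (@eq R x y) end; ring.
Qed.

Lemma helicity_form_integral F1 F2 : hamiltonian F1 -> hamiltonian F2 ->
  S3_integral (wedge12 (helicity_form F1 F2) (ext_d (helicity_form F1 F2))) =
  2 * PI ^ 2 * (RInt (fun t => disk_integral (F1 t)) 0 1
    + RInt (fun t => disk_integral (F2 t)) 0 1 + 2 * PI ^ 2).
Proof.
intros H1 H2.
pose proof (one_form_helicity F1 F2 H1 H2) as OB.
pose proof one_form_contact as OC.
assert (O1 : one_form (ham_form F1)) by now apply one_form_ham_form.
assert (O2 : one_form (ham_form' F2)) by now apply one_form_swap, one_form_ham_form.
rewrite S3_integral_coef by assumption.
assert (CW : forall beta beta', one_form beta -> one_form beta' ->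
  forall q, continuous (wedge_coef beta beta') q).
{ intros beta beta' Hb Hb'; exact (Ck_all_continuous 0 _ (Ck_wedge_coef 0 _ _ Hb Hb')). }
pose proof (@continuous_scal_R V3) as CM; pose proof (@continuous_plus_R V3) as CP.
pose proof (CW _ _ OC OC) as C0.
pose proof (CP _ _ (CW _ _ OC O1) (CW _ _ O1 OC)) as C1.
pose proof (CP _ _ (CW _ _ OC O2) (CW _ _ O2 OC)) as C2.
transitivity (RInt3 (fun q => PI * PI * wedge_coef contact contact q
  + (PI * (wedge_coef contact (ham_form F1) q + wedge_coef (ham_form F1) contact q)
   + PI * (wedge_coef contact (ham_form' F2) q + wedge_coef (ham_form' F2) contact q)))
  0 (PI / 2) 0 (2 * PI) 0 (2 * PI)).
{ apply RInt3_ext; intros a b c _ _ _; now apply wedge_coef_helicity. }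
rewrite (RInt3_plus (fun q => PI * PI * wedge_coef contact contact q))
  by (apply CM || apply CP; auto).
rewrite (RInt3_plus (fun q => PI * (wedge_coef contact (ham_form F1) q
  + wedge_coef (ham_form F1) contact q))) by auto.
rewrite !RInt3_scal by auto.
rewrite (RInt3_plus (wedge_coef contact (ham_form F1))) by auto.
rewrite (RInt3_plus (wedge_coef contact (ham_form' F2))) by auto.
assert (S1 : RInt3 (wedge_coef contact (ham_form F1)) 0 (PI / 2) 0 (2 * PI) 0 (2 * PI) =
  RInt3 (wedge_coef (ham_form F1) contact) 0 (PI / 2) 0 (2 * PI) 0 (2 * PI)).
{ rewrite <- !S3_integral_coef by assumption; now apply S3_integral_wedge_sym. }
assert (S2 : RInt3 (wedge_coef contact (ham_form' F2)) 0 (PI / 2) 0 (2 * PI) 0 (2 * PI) =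
  RInt3 (wedge_coef (ham_form' F2) contact) 0 (PI / 2) 0 (2 * PI) 0 (2 * PI)).
{ rewrite <- !S3_integral_coef by assumption; now apply S3_integral_wedge_sym. }
rewrite S1, S2, wedge_contact_integral, wedge_ham_form_integral, wedge_ham_form'_integral
  by assumption.
ring.
Qed.

(** * The Calabi invariant *)

Lemma dirD_coordinates3 (q : V3) (v : V3) :
  dirD (fun q : V3 => fst q) q v = fst v /\
  dirD (fun q : V3 => fst (snd q)) q v = fst (snd v) /\
  dirD (fun q : V3 => snd (snd q)) q v = snd (snd v).
Proof.
assert (L : forall (l : V3 -> R), (forall p v (s : R), l (plus p (scal s v)) = l p + s * l v) ->
  dirD l q v = l v).
{ intros l Hl; apply is_derive_unique.
  apply (is_derive_ext (fun s => l q + s * l v)); [intros s; now rewrite Hl |].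
  auto_derive; [easy | ring]. }
split; [| split]; apply L; reflexivity.
Qed.

Lemma dirD_slice (g : V3 -> R) (t : R) (x w : V2) :
  dirD (fun y : V2 => g (t, y)) x w = dirD g (t, x) (0, w).
Proof.
apply Derive_ext; intros s.
change (g (t, plus x (scal s w)) = g (t + s * 0, plus x (scal s w))).
now rewrite Rmult_0_r, Rplus_0_r.
Qed.

Definition polar (q : V3) : V3 :=
  (fst q, (fst (snd q) * cos (snd (snd q)), fst (snd q) * sin (snd (snd q)))).

Lemma Ck_polar k (f : V3 -> R) : Ck k all3 f -> Ck k all3 (fun q => f (polar q)).
Proof.
intros Hf; destruct (Ck_coordinates3 k) as [H0 [H1 H2]].
destruct (Ck_sin_cos k _ _ open_all H2) as [HS HC].
apply (Ck_comp3 k all3 f); [exact open_all | exact Hf | exact H0 | |];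
  now apply Ck_mult; [exact open_all | |].
Qed.

Lemma dirD_polar (f : V3 -> R) (t r th : R) : Ck 1 all3 f ->
  dirD (fun q => f (polar q)) (t, (r, th)) e1 =
    cos th * dirD f (polar (t, (r, th))) e1 + sin th * dirD f (polar (t, (r, th))) e2 /\
  dirD (fun q => f (polar q)) (t, (r, th)) e2 =
    - (r * sin th) * dirD f (polar (t, (r, th))) e1
    + r * cos th * dirD f (polar (t, (r, th))) e2.
Proof.
intros Hf; destruct (Ck_coordinates3 1) as [H0 [H1 H2]].
destruct (Ck_sin_cos 1 _ _ open_all H2) as [HS HC].
assert (X : Ck 1 all3 (fun q => fst (snd q) * cos (snd (snd q))))
  by (now apply Ck_mult; [exact open_all | |]).
assert (Y : Ck 1 all3 (fun q => fst (snd q) * sin (snd (snd q))))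
  by (now apply Ck_mult; [exact open_all | |]).
destruct (is_derive_slices _ t r th X) as [_ [X1 X2]].
destruct (is_derive_slices _ t r th Y) as [_ [Y1 Y2]].
assert (EX1 : dirD (fun q : V3 => fst (snd q) * cos (snd (snd q))) (t, (r, th)) e1 = cos th).
{ apply is_derive_unique in X1; refine (eq_trans (eq_sym X1) _).
  apply is_derive_unique; simpl; auto_derive; [easy | ring]. }
assert (EX2 : dirD (fun q : V3 => fst (snd q) * cos (snd (snd q))) (t, (r, th)) e2 = - (r * sin th)).
{ apply is_derive_unique in X2; refine (eq_trans (eq_sym X2) _).
  apply is_derive_unique; simpl; auto_derive; [easy | ring]. }
assert (EY1 : dirD (fun q : V3 => fst (snd q) * sin (snd (snd q))) (t, (r, th)) e1 = sin th).
{ apply is_derive_unique in Y1; refine (eq_trans (eq_sym Y1) _).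
  apply is_derive_unique; simpl; auto_derive; [easy | ring]. }
assert (EY2 : dirD (fun q : V3 => fst (snd q) * sin (snd (snd q))) (t, (r, th)) e2 = r * cos th).
{ apply is_derive_unique in Y2; refine (eq_trans (eq_sym Y2) _).
  apply is_derive_unique; simpl; auto_derive; [easy | ring]. }
assert (K : forall v, dirD (fun q => f (polar q)) (t, (r, th)) v =
  dirD (fun q : V3 => fst q) (t, (r, th)) v * dirD f (polar (t, (r, th))) (1, (0, 0))
  + dirD (fun q : V3 => fst (snd q) * cos (snd (snd q))) (t, (r, th)) v
    * dirD f (polar (t, (r, th))) e1
  + dirD (fun q : V3 => fst (snd q) * sin (snd (snd q))) (t, (r, th)) v
    * dirD f (polar (t, (r, th))) e2).
{ intros v; apply is_derive_unique.
  exact (is_derive_comp3 all3 f _ _ _ (t, (r, th)) v open_all Hf H0 X Y I). }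
rewrite !K, EX1, EX2, EY1, EY2.
rewrite !(fun v => proj1 (dirD_coordinates3 (t, (r, th)) v)).
change (fst e1) with 0; change (fst e2) with 0; split; ring.
Qed.

(* [r A_x = (r cos th A)_r - (sin th A)_th] and [r B_y = (r sin th B)_r + (cos th B)_th]. *)
Lemma polar_divergence (A B : V3 -> R) (a b : R) :
  Ck 1 all3 A -> Ck 1 all3 B ->
  (forall t th : R, A (polar (t, (1, th))) = 0 /\ B (polar (t, (1, th))) = 0) ->
  RInt3 (polar3 (fun q => dirD A q e1 + dirD B q e2)) a b 0 1 0 (2 * PI) = 0.
Proof.
intros HA HB H1; destruct (Ck_coordinates3 1) as [_ [K1 K2]].
destruct (Ck_sin_cos 1 _ _ open_all K2) as [HS HC].
pose proof (Ck_polar 1 A HA) as PA; pose proof (Ck_polar 1 B HB) as PB.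
(* r times the divergence is M_r + N_th. M vanishes at r = 0 through its factor r and at r = 1 by
   the boundary condition, while N takes the same value at both ends of the angular interval. *)
pose (M := fun q : V3 => fst (snd q) *
  (cos (snd (snd q)) * A (polar q) + sin (snd (snd q)) * B (polar q))).
pose (N := fun q : V3 => cos (snd (snd q)) * B (polar q) - sin (snd (snd q)) * A (polar q)).
assert (CM : Ck 1 all3 M).
{ apply Ck_mult; [exact open_all | exact K1 |].
  apply Ck_plus; [exact open_all | |]; now apply Ck_mult; [exact open_all | |]. }
assert (CN : Ck 1 all3 N).
{ apply Ck_minus; [exact open_all | |]; now apply Ck_mult; [exact open_all | |]. }
transitivity (RInt3 (fun q => dirD M q e1 + dirD N q e2) a b 0 1 0 (2 * PI)).
- apply RInt3_ext; intros t r th _ _ _.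
  destruct (is_derive_slices M t r th CM) as [_ [M1 _]].
  destruct (is_derive_slices N t r th CN) as [_ [_ N2]].
  destruct (is_derive_slices _ t r th PA) as [_ [A1 A2]].
  destruct (is_derive_slices _ t r th PB) as [_ [B1 B2]].
  destruct (dirD_polar A t r th HA) as [EA1 EA2].
  destruct (dirD_polar B t r th HB) as [EB1 EB2].
  set (dA1 := dirD A (polar (t, (r, th))) e1) in *.
  set (dA2 := dirD A (polar (t, (r, th))) e2) in *.
  set (dB1 := dirD B (polar (t, (r, th))) e1) in *.
  set (dB2 := dirD B (polar (t, (r, th))) e2) in *.
  pose (a0 := A (polar (t, (r, th)))); pose (b0 := B (polar (t, (r, th)))).
  assert (EM : dirD M (t, (r, th)) e1 = cos th * a0 + sin th * b0
    + r * (cos th * (cos th * dA1 + sin th * dA2) + sin th * (cos th * dB1 + sin th * dB2))).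
  { apply is_derive_unique in M1; refine (eq_trans (eq_sym M1) _).
    rewrite <- EA1, <- EB1; apply is_derive_unique; unfold M; cbn [fst snd].
    set (fa := fun s : R => A (polar (t, (s, th)))) in *.
    set (fb := fun s : R => B (polar (t, (s, th)))) in *.
    change (is_derive (fun s : R => s * (cos th * fa s + sin th * fb s)) r
      (cos th * a0 + sin th * b0 + r * (cos th * dirD (fun q => A (polar q)) (t, (r, th)) e1
        + sin th * dirD (fun q => B (polar q)) (t, (r, th)) e1))).
    auto_derive; [split; [eexists; exact A1 | split; [eexists; exact B1 | exact I]] |].
    replace (Derive (fun x => fa x) r) with (dirD (fun q => A (polar q)) (t, (r, th)) e1)
      by (symmetry; apply is_derive_unique; exact A1).
    replace (Derive (fun x => fb x) r) with (dirD (fun q => B (polar q)) (t, (r, th)) e1)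
      by (symmetry; apply is_derive_unique; exact B1).
    change (fa r) with a0; change (fb r) with b0; ring. }
  assert (EN : dirD N (t, (r, th)) e2 = - sin th * b0 - cos th * a0
    + cos th * (- (r * sin th) * dB1 + r * cos th * dB2)
    - sin th * (- (r * sin th) * dA1 + r * cos th * dA2)).
  { apply is_derive_unique in N2; refine (eq_trans (eq_sym N2) _).
    rewrite <- EA2, <- EB2; apply is_derive_unique; unfold N; cbn [fst snd].
    set (fa := fun s : R => A (polar (t, (r, s)))) in *.
    set (fb := fun s : R => B (polar (t, (r, s)))) in *.
    change (is_derive (fun s : R => cos s * fb s - sin s * fa s) th
      (- sin th * b0 - cos th * a0 + cos th * dirD (fun q => B (polar q)) (t, (r, th)) e2
        - sin th * dirD (fun q => A (polar q)) (t, (r, th)) e2)).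
    auto_derive; [split; [eexists; exact B2 | split; [eexists; exact A2 | exact I]] |].
    replace (Derive (fun x => fa x) th) with (dirD (fun q => A (polar q)) (t, (r, th)) e2)
      by (symmetry; apply is_derive_unique; exact A2).
    replace (Derive (fun x => fb x) th) with (dirD (fun q => B (polar q)) (t, (r, th)) e2)
      by (symmetry; apply is_derive_unique; exact B2).
    change (fa th) with a0; change (fb th) with b0; ring. }
  rewrite EM, EN.
  change (polar3 (fun q => dirD A q e1 + dirD B q e2) (t, (r, th))) with ((dA1 + dB2) * r).
  pose proof (sin_cos_sqr th) as P.
  transitivity ((dA1 + dB2) * r * (sin th * sin th + cos th * cos th)); [rewrite P |]; ring.
- rewrite (RInt3_plus (fun q => dirD M q e1)).
  + assert (X1 : RInt3 (fun q => dirD M q e1) a b 0 1 0 (2 * PI) = 0).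
    { apply (RInt3_partial_y M); [exact CM |]; intros t th; unfold M; cbn [fst snd].
      destruct (H1 t th) as [-> ->]; ring. }
    assert (X2 : RInt3 (fun q => dirD N q e2) a b 0 1 0 (2 * PI) = 0).
    { apply (RInt3_partial_z N); [exact CN |]; intros t r; unfold N, polar; cbn [fst snd].
      now rewrite cos_2PI, sin_2PI, cos_0, sin_0. }
    rewrite X1, X2; apply Rplus_0_r.
  + exact (Ck_all_continuous 0 _ (Ck_dirD 0 all3 M e1 CM)).
  + exact (Ck_all_continuous 0 _ (Ck_dirD 0 all3 N e2 CN)).
Qed.

(** * Functions transported by a Hamiltonian flow *)

Lemma is_derive_components (f : R -> R * R) (t : R) (l : R * R) :
  is_derive (f : R -> V2) t l ->
  is_derive (fun s => fst (f s)) t (fst l) /\ is_derive (fun s => snd (f s)) t (snd l).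
Proof.
intros Hf; split.
- exact (filterdiff_comp (f : R -> V2) (fst : V2 -> R) _ _ Hf
    (filterdiff_linear (fst : V2 -> R) is_linear_fst)).
- exact (filterdiff_comp (f : R -> V2) (snd : V2 -> R) _ _ Hf
    (filterdiff_linear (snd : V2 -> R) is_linear_snd)).
Qed.

Definition flow1 (phi : R -> plane -> plane) (q : V3) : R := fst (phi (fst q) (snd q)).
Definition flow2 (phi : R -> plane -> plane) (q : V3) : R := snd (phi (fst q) (snd q)).
Definition transported (f : V3 -> R) (phi : R -> plane -> plane) (q : V3) : R :=
  f (fst q, (flow1 phi q, flow2 phi q)).

Lemma Ck_flow k phi : disk_isotopy phi -> Ck k all3 (flow1 phi) /\ Ck k all3 (flow2 phi).
Proof. intros [H1 H2 _ _ _ _]; split; [exact (H1 k) | exact (H2 k)]. Qed.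

Lemma flow_equation F phi (q : V3) : disk_isotopy phi -> generates F phi ->
  dirD (flow1 phi) q e0 = dirD (ham3 F) (fst q, (flow1 phi q, flow2 phi q)) e2 /\
  dirD (flow2 phi) q e0 = - dirD (ham3 F) (fst q, (flow1 phi q, flow2 phi q)) e1.
Proof.
intros Hphi [_ Hg]; destruct q as [t [x y]]; destruct (Ck_flow 1 phi Hphi) as [C1 C2].
destruct (is_derive_components _ _ _ (Hg t (x, y))) as [D1 D2].
destruct (is_derive_slices _ t x y C1) as [K1 _], (is_derive_slices _ t x y C2) as [K2 _].
apply is_derive_unique in K1, K2, D1, D2.
split.
- refine (eq_trans (eq_sym K1) (eq_trans D1
    (eq_trans (dirD_slice (ham3 F) t (phi t (x, y)) (0, 1)) _))).
  exact (f_equal (fun z : V2 => dirD (ham3 F) (t, z) e2) (surjective_pairing (phi t (x, y)))).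
- refine (eq_trans (eq_sym K2) (eq_trans D2 (f_equal Ropp
    (eq_trans (dirD_slice (ham3 F) t (phi t (x, y)) (1, 0)) _)))).
  exact (f_equal (fun z : V2 => dirD (ham3 F) (t, z) e1) (surjective_pairing (phi t (x, y)))).
Qed.

Lemma flow_area phi (q : V3) : disk_isotopy phi ->
  dirD (flow1 phi) q e1 * dirD (flow2 phi) q e2
  - dirD (flow1 phi) q e2 * dirD (flow2 phi) q e1 = 1.
Proof.
intros Hphi; destruct q as [t x]; refine (eq_trans _ (iso_area phi Hphi t x)).
pose proof (fun w => dirD_slice (flow1 phi) t x w) as S1.
pose proof (fun w => dirD_slice (flow2 phi) t x w) as S2.
refine (eq_trans _ (f_equal2 Rminus (f_equal2 Rmult (eq_sym (S1 (1, 0))) (eq_sym (S2 (0, 1))))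
  (f_equal2 Rmult (eq_sym (S2 (1, 0))) (eq_sym (S1 (0, 1)))))).
apply (f_equal2 Rminus); [reflexivity | apply Rmult_comm].
Qed.

Lemma Ck_transported k f phi : disk_isotopy phi -> Ck k all3 f ->
  Ck k all3 (transported f phi).
Proof.
intros Hphi Hf; destruct (Ck_flow k phi Hphi) as [U V].
apply (Ck_comp3 k all3 f); [exact open_all | exact Hf | | exact U | exact V].
apply Ck_coordinates3.
Qed.

Lemma dirD_transported f phi (q v : V3) : disk_isotopy phi -> Ck 1 all3 f ->
  dirD (transported f phi) q v =
    fst v * dirD f (fst q, (flow1 phi q, flow2 phi q)) e0
    + dirD (flow1 phi) q v * dirD f (fst q, (flow1 phi q, flow2 phi q)) e1
    + dirD (flow2 phi) q v * dirD f (fst q, (flow1 phi q, flow2 phi q)) e2.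
Proof.
intros Hphi Hf; destruct (Ck_flow 1 phi Hphi) as [U V].
rewrite <- (proj1 (dirD_coordinates3 q v)); apply is_derive_unique.
exact (is_derive_comp3 all3 f _ _ _ q v open_all Hf (proj1 (Ck_coordinates3 1)) U V I).
Qed.

(** The explicit time of [f] is held at [tau] while the flow runs, which separates transport from
    the time dependence of [f] itself. *)
Definition frozen (f : V3 -> R) (tau : R) (phi : R -> plane -> plane) (q : V3) : R :=
  f (tau, (flow1 phi q, flow2 phi q)).

Lemma Ck_frozen k f tau phi : disk_isotopy phi -> Ck k all3 f ->
  Ck k all3 (frozen f tau phi).
Proof.
intros Hphi Hf; destruct (Ck_flow k phi Hphi) as [U V].
apply (Ck_comp3 k all3 f (fun _ => tau)); [exact open_all | exact Hf | | exact U | exact V].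
apply Ck_const, open_all.
Qed.

Lemma dirD_frozen f tau phi (q v : V3) : disk_isotopy phi -> Ck 1 all3 f ->
  dirD (frozen f tau phi) q v =
    dirD (flow1 phi) q v * dirD f (tau, (flow1 phi q, flow2 phi q)) e1
    + dirD (flow2 phi) q v * dirD f (tau, (flow1 phi q, flow2 phi q)) e2.
Proof.
intros Hphi Hf; destruct (Ck_flow 1 phi Hphi) as [U V].
pose proof (is_derive_comp3 all3 f (fun _ => tau) _ _ q v open_all Hf
  (Ck_const 1 all3 tau open_all) U V I) as K.
assert (Z : dirD (fun _ : V3 => tau) q v = 0) by exact (Derive_const tau 0).
rewrite Z, Rmult_0_l, Rplus_0_l in K; apply is_derive_unique in K; exact K.
Qed.

(* [phi^t] is symplectic, so it conjugates the flow of [F] to that of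
   [F o phi^t] and the transport equation is a Poisson bracket. *)
Lemma transport_equation F phi f tau q :
  hamiltonian F -> disk_isotopy phi -> generates F phi -> Ck 1 all3 f ->
  dirD (frozen f tau phi) q e0 =
    dirD (frozen f tau phi) q e1 * dirD (transported (ham3 F) phi) q e2
    - dirD (frozen f tau phi) q e2 * dirD (transported (ham3 F) phi) q e1.
Proof.
intros HF Hphi Hgen Hf.
rewrite !dirD_transported, !dirD_frozen by (assumption || now apply Ck_ham3).
destruct (flow_equation F phi q Hphi Hgen) as [-> ->].
change (fst e1) with 0; change (fst e2) with 0.
pose proof (flow_area phi q Hphi) as J.
set (Fx := dirD (ham3 F) (fst q, (flow1 phi q, flow2 phi q)) e1).
set (Fy := dirD (ham3 F) (fst q, (flow1 phi q, flow2 phi q)) e2).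
set (fx := dirD f (tau, (flow1 phi q, flow2 phi q)) e1).
set (fy := dirD f (tau, (flow1 phi q, flow2 phi q)) e2).
set (ux := dirD (flow1 phi) q e1) in *; set (uy := dirD (flow1 phi) q e2) in *.
set (vx := dirD (flow2 phi) q e1) in *; set (vy := dirD (flow2 phi) q e2) in *.
transitivity ((fx * Fy - fy * Fx) * (ux * vy - uy * vx)); [rewrite J |]; ring.
Qed.

Lemma continuous_zero_right (h : R -> R) (a : R) :
  continuous h a -> (forall r, a < r -> h r = 0) -> h a = 0.
Proof.
intros Hc Hz; destruct (Req_dec (h a) 0) as [E | N]; [exact E | exfalso].
assert (Hp : 0 < Rabs (h a)) by now apply Rabs_pos_lt.
pose proof (Hc _ (locally_ball (h a) (mkposreal _ Hp))) as [d Hd].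
pose proof (cond_pos d) as Pd.
assert (K : ball (h a) (Rabs (h a)) (h (a + d / 2))).
{ apply (Hd (a + d / 2)); unfold ball; simpl; unfold AbsRing_ball, abs, minus, plus, opp; simpl.
  replace (a + d / 2 + - a) with (d / 2) by ring; rewrite Rabs_pos_eq; lra. }
assert (Z : h (a + d / 2) = 0) by (apply Hz; lra).
rewrite Z in K; change (Rabs (0 - h a) < Rabs (h a)) in K.
unfold Rminus in K; rewrite Rplus_0_l, Rabs_Ropp in K; lra.
Qed.

Lemma continuous_radial (f : V3 -> R) (t th r : R) : (forall q, continuous f q) ->
  continuous (fun r => f (polar (t, (r, th)))) r.
Proof.
intros Hf; apply (continuous_triple f R_UniformSpace (fun _ => t) (fun r => r * cos th)
  (fun r => r * sin th)); [exact Hf | apply continuous_const | |].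
- apply (ex_derive_continuous (fun r => r * cos th)); auto_derive; easy.
- apply (ex_derive_continuous (fun r => r * sin th)); auto_derive; easy.
Qed.

(** The boundary circle belongs to [disk]; the value there is reached by continuity along a ray
    coming from outside. *)
Lemma zero_on_boundary (f : V3 -> R) (t th : R) : (forall q, continuous f q) ->
  (forall x : plane, ~ disk x -> f (t, x) = 0) -> f (polar (t, (1, th))) = 0.
Proof.
intros Hf Hz; apply (continuous_zero_right (fun r => f (polar (t, (r, th)))));
  [now apply continuous_radial |].
intros r Hr; apply Hz; unfold disk; cbn [fst snd]; rewrite normsq2_polar; nra.
Qed.

Lemma ham_outside F t (x : plane) : hamiltonian F -> ~ disk x -> F t x = 0.
Proof.
intros [_ _ [rho [Hr HF]]] Hx; apply HF; unfold disk in Hx; nra.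
Qed.

Lemma transported_outside F phi t (x : plane) : hamiltonian F -> disk_isotopy phi ->
  ~ disk x -> transported (ham3 F) phi (t, x) = 0.
Proof.
intros HF Hphi Hx; unfold transported, flow1, flow2, ham3; cbn [fst snd].
rewrite (iso_outside phi Hphi t x Hx), <- surjective_pairing; now apply ham_outside.
Qed.

(** The bracket w_x H_y - w_y H_x is the divergence of the field (- w_y H, w_x H), which vanishes on
    the boundary circle because H does. *)
Lemma transport_integral F phi f tau T :
  hamiltonian F -> disk_isotopy phi -> generates F phi -> Ck 2 all3 f ->
  RInt3 (polar3 (fun q => dirD (frozen f tau phi) q e0)) 0 T 0 1 0 (2 * PI) = 0.
Proof.
intros HF Hphi Hgen Hf.
set (w := frozen f tau phi); set (H := transported (ham3 F) phi).
assert (Cw : Ck 2 all3 w) by now apply Ck_frozen.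
assert (CH : Ck 2 all3 H) by now apply Ck_transported, Ck_ham3.
assert (C1 : forall v, Ck 1 all3 (fun q => dirD w q v)) by (intros v; exact (Ck_dirD 1 all3 w v Cw)).
assert (CH1 : Ck 1 all3 H) by now apply Ck_pred.
assert (HB : forall t th : R, H (polar (t, (1, th))) = 0).
{ intros t th; apply zero_on_boundary; [exact (Ck_all_continuous 2 H CH) |].
  intros x Hx; now apply transported_outside. }
refine (eq_trans _ (polar_divergence (fun q => - dirD w q e2 * H q)
  (fun q => dirD w q e1 * H q) 0 T _ _ _)).
- assert (P : forall q, dirD w q e0 =
    dirD (fun q => - dirD w q e2 * H q) q e1 + dirD (fun q => dirD w q e1 * H q) q e2).
  2: { apply RInt3_ext; intros t r th _ _ _.
       exact (f_equal (fun z => z * r) (P (polar (t, (r, th))))). }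
  intros q.
  assert (E1 : dirD (fun q => - dirD w q e2 * H q) q e1 =
    - dirD (fun q => dirD w q e2) q e1 * H q + - dirD w q e2 * dirD H q e1).
  { pose proof (is_derive_line_mult 0 all3 (fun q => - dirD w q e2) H q e1
      (Ck_opp 1 all3 _ open_all (C1 e2)) CH1 I) as K.
    apply is_derive_unique in K; refine (eq_trans K _); f_equal; f_equal.
    apply is_derive_unique; apply (is_derive_opp (fun s : R => dirD w (plus q (scal s e1)) e2)).
    exact (is_derive_dirD 0 all3 (fun q => dirD w q e2) q e1 (C1 e2) I). }
  assert (E2 : dirD (fun q => dirD w q e1 * H q) q e2 =
    dirD (fun q => dirD w q e1) q e2 * H q + dirD w q e1 * dirD H q e2).
  { pose proof (is_derive_line_mult 0 all3 (fun q => dirD w q e1) H q e2 (C1 e1) CH1 I) as K.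
    apply is_derive_unique in K; exact K. }
  rewrite E1, E2, (dirD_comm all3 w q e2 e1 open_all Cw I).
  unfold w, H; rewrite (transport_equation F phi f tau q HF Hphi Hgen (Ck_pred 1 all3 f Hf)).
  ring.
- apply Ck_mult; [exact open_all | | exact CH1]; apply Ck_opp; [exact open_all | apply C1].
- apply Ck_mult; [exact open_all | apply C1 | exact CH1].
- intros t th; rewrite HB; split; ring.
Qed.

(** Invariance of the integral under an area preserving map, without any change of variables in the
    plane: its time derivative is the integral of a bracket, hence zero, and at time 0 the flow is
    the identity. *)
Lemma disk_integral_frozen F phi f tau T :
  hamiltonian F -> disk_isotopy phi -> generates F phi -> Ck 2 all3 f ->
  disk_integral (fun x => frozen f tau phi (T, x)) = disk_integral (fun x => f (tau, x)).
Proof.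
intros HF Hphi Hgen Hf.
assert (Cw : Ck 2 all3 (frozen f tau phi)) by now apply Ck_frozen.
assert (C0 : forall q, continuous (fun q => dirD (frozen f tau phi) q e0) q).
{ exact (Ck_all_continuous 1 _ (Ck_dirD 1 all3 _ e0 Cw)). }
pose proof (transport_integral F phi f tau T HF Hphi Hgen Hf) as K.
assert (CP : forall g, Ck 0 all3 g -> forall q, continuous (polar3 g) q).
{ intros g Hg; exact (Ck_all_continuous 0 _ (Ck_polar3 0 g Hg)). }
pose proof (Ck_dirD 1 all3 _ e0 Cw) as C1; apply Ck_pred in C1.
rewrite RInt3_rotate in K by (now apply CP).
assert (CW : forall q, continuous (polar3 (frozen f tau phi)) q) by (now apply CP, Ck_pred, Ck_pred).
assert (Cf : forall q, continuous (polar3 f) q) by (now apply CP, Ck_pred, Ck_pred).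
destruct (ex_RInt_slices _ 0 1 0 1 0 (2 * PI) CW) as [_ [W2 W3]].
destruct (ex_RInt_slices _ 0 1 0 1 0 (2 * PI) Cf) as [_ [G2 G3]].
assert (D : disk_integral (fun x => frozen f tau phi (T, x)) - disk_integral (fun x => f (tau, x)) = 0).
{ refine (eq_trans _ K).
  etransitivity; [symmetry; exact (RInt_minus _ _ 0 1 (W2 T) (G2 tau)) |].
  apply RInt_ext; intros r _.
  etransitivity; [symmetry; exact (RInt_minus _ _ 0 (2 * PI)
    (W3 T r) (G3 tau r)) |].
  apply RInt_ext; intros th _; unfold polar3; cbn [fst snd].
  set (x := (r * cos th, r * sin th)).
  change (frozen f tau phi (T, x) * r - f (tau, x) * r =
    RInt (fun s => dirD (frozen f tau phi) (s, x) e0 * r) 0 T).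
  assert (E0 : frozen f tau phi (0, x) = f (tau, x)).
  { unfold frozen, flow1, flow2; cbn [fst snd]; now rewrite (iso_start phi Hphi), <- surjective_pairing. }
  assert (ED : RInt (fun s => dirD (frozen f tau phi) (s, x) e0) 0 T =
    frozen f tau phi (T, x) - frozen f tau phi (0, x))
    by exact (proj1 (RInt_dirD _ 0 T 0 (r * cos th) (r * sin th) (Ck_pred 1 all3 _ Cw))).
  rewrite <- E0, <- Rmult_minus_distr_r, <- ED.
  symmetry; apply RInt_mult_r; intros s.
  apply (continuous_triple (fun p => dirD (frozen f tau phi) p e0) R_UniformSpace (fun s => s)
    (fun _ => r * cos th) (fun _ => r * sin th)); [exact C0 | | |];
    solve [apply continuous_id | apply continuous_const]. }
lra.
Qed.

(* [F + lambda (X_F)] with [lambda = (x dy - y dx) / 2]. *)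
Definition lagrangian (F : R -> plane -> R) (q : V3) : R :=
  ham3 F q - (fst (snd q) * dirD (ham3 F) q e1 + snd (snd q) * dirD (ham3 F) q e2) * / 2.

Lemma Ck_lagrangian k F : hamiltonian F -> Ck k all3 (lagrangian F).
Proof.
intros HF; destruct (Ck_coordinates3 k) as [_ [H1 H2]].
assert (D : forall v, Ck k all3 (fun q => dirD (ham3 F) q v))
  by (intros v; exact (Ck_dirD k all3 _ v (Ck_ham3 (S k) F HF))).
apply Ck_minus; [exact open_all | now apply Ck_ham3 |].
apply Ck_mult; [exact open_all | | apply Ck_const, open_all].
apply Ck_plus; [exact open_all | |]; now apply Ck_mult; [exact open_all | |].
Qed.

(** The field (x F, y F) has divergence 2 F + x F_x + y F_y and vanishes on the boundary circle, so
    - (x F_x + y F_y) / 2, which is lambda (X_F), has the same integral as F. *)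
Lemma lagrangian_integral F : hamiltonian F ->
  RInt (fun t => disk_integral (fun x => lagrangian F (t, x))) 0 1 =
  2 * RInt (fun t => disk_integral (F t)) 0 1.
Proof.
intros HF; destruct (Ck_coordinates3 1) as [_ [H1 H2]].
pose proof (Ck_ham3 1 F HF) as CF.
pose (A := fun q : V3 => fst (snd q) * ham3 F q).
pose (B := fun q : V3 => snd (snd q) * ham3 F q).
assert (CA : Ck 1 all3 A) by (now apply Ck_mult; [exact open_all | |]).
assert (CB : Ck 1 all3 B) by (now apply Ck_mult; [exact open_all | |]).
assert (DA : forall q, dirD A q e1 = ham3 F q + fst (snd q) * dirD (ham3 F) q e1).
{ intros q; apply is_derive_unique.
  pose proof (is_derive_line_mult 0 all3 (fun q : V3 => fst (snd q)) (ham3 F) q e1 H1 CF I) as K.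
  rewrite (proj1 (proj2 (dirD_coordinates3 q e1))) in K.
  change (fst (snd e1)) with 1 in K; rewrite Rmult_1_l in K; exact K. }
assert (DB : forall q, dirD B q e2 = ham3 F q + snd (snd q) * dirD (ham3 F) q e2).
{ intros q; apply is_derive_unique.
  pose proof (is_derive_line_mult 0 all3 (fun q : V3 => snd (snd q)) (ham3 F) q e2 H2 CF I) as K.
  rewrite (proj2 (proj2 (dirD_coordinates3 q e2))) in K.
  change (snd (snd e2)) with 1 in K; rewrite Rmult_1_l in K; exact K. }
assert (HB : forall t th : R, ham3 F (polar (t, (1, th))) = 0).
{ intros t th; apply zero_on_boundary; [exact (Ck_all_continuous 1 _ CF) |].
  intros x Hx; exact (ham_outside F t x HF Hx). }
assert (K : RInt3 (polar3 (fun q => dirD A q e1 + dirD B q e2)) 0 1 0 1 0 (2 * PI) = 0).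
{ apply polar_divergence; [exact CA | exact CB |]; intros t th; unfold A, B; rewrite HB.
  split; ring. }
assert (CP : forall g, Ck 0 all3 g -> forall q, continuous (polar3 g) q).
{ intros g Hg; exact (Ck_all_continuous 0 _ (Ck_polar3 0 g Hg)). }
assert (C1 : forall q, continuous (polar3 (fun q => dirD A q e1 + dirD B q e2)) q).
{ apply CP, Ck_plus; [exact open_all | exact (Ck_dirD 0 all3 A e1 CA) | exact (Ck_dirD 0 all3 B e2 CB)]. }
assert (C2 : forall q, continuous (polar3 (ham3 F)) q) by now apply CP, Ck_ham3.
pose proof (@continuous_scal_R V3) as CM.
change (RInt3 (polar3 (lagrangian F)) 0 1 0 1 0 (2 * PI) =
  2 * RInt3 (polar3 (ham3 F)) 0 1 0 1 0 (2 * PI)).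
transitivity (RInt3 (fun q => 2 * polar3 (ham3 F) q
  + - / 2 * polar3 (fun q => dirD A q e1 + dirD B q e2) q) 0 1 0 1 0 (2 * PI)).
- assert (P : forall q, lagrangian F q = 2 * ham3 F q + - / 2 * (dirD A q e1 + dirD B q e2)).
  { intros q; rewrite DA, DB; unfold lagrangian; field. }
  apply RInt3_ext; intros t r th _ _ _.
  refine (eq_trans (f_equal (fun z => z * r) (P (polar (t, (r, th))))) _).
  change ((2 * ham3 F (polar (t, (r, th))) + - / 2 *
    (dirD A (polar (t, (r, th))) e1 + dirD B (polar (t, (r, th))) e2)) * r =
    2 * (ham3 F (polar (t, (r, th))) * r) + - / 2 *
    ((dirD A (polar (t, (r, th))) e1 + dirD B (polar (t, (r, th))) e2) * r)); ring.
- rewrite (RInt3_plus (fun q => 2 * polar3 (ham3 F) q)) by auto.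
  rewrite !RInt3_scal by auto; rewrite K; ring.
Qed.

(** By Hamilton's equation lambda (X_F) along the flow is lambda of the velocity of phi^t. In this
    form the derivatives of F are replaced by time derivatives of the flow. *)
Lemma transported_lagrangian F phi q :
  hamiltonian F -> disk_isotopy phi -> generates F phi ->
  transported (lagrangian F) phi q = transported (ham3 F) phi q
    + (flow1 phi q * dirD (flow2 phi) q e0 - flow2 phi q * dirD (flow1 phi) q e0) * / 2.
Proof.
intros HF Hphi Hgen; destruct (flow_equation F phi q Hphi Hgen) as [-> ->].
unfold transported, lagrangian; cbn [fst snd]; ring.
Qed.

(* The [dx]-component of [phi^* lambda]. *)
Definition liouville (phi : R -> plane -> plane) (q : V3) : R :=
  (flow1 phi q * dirD (flow2 phi) q e1 - flow2 phi q * dirD (flow1 phi) q e1) * / 2.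

Lemma Ck_liouville k phi : disk_isotopy phi -> Ck k all3 (liouville phi).
Proof.
intros Hphi; destruct (Ck_flow k phi Hphi) as [U V].
destruct (Ck_flow (S k) phi Hphi) as [U' V'].
apply Ck_mult; [exact open_all | | apply Ck_const, open_all].
apply Ck_minus; [exact open_all | |]; apply Ck_mult; try exact open_all; try assumption.
- exact (Ck_dirD k all3 _ e1 V').
- exact (Ck_dirD k all3 _ e1 U').
Qed.

Lemma dirD_half_minor (f g f' g' : V3 -> R) q v :
  Ck 1 all3 f -> Ck 1 all3 g -> Ck 1 all3 f' -> Ck 1 all3 g' ->
  dirD (fun q => (f q * g' q - g q * f' q) * / 2) q v =
    (dirD f q v * g' q + f q * dirD g' q v - (dirD g q v * f' q + g q * dirD f' q v)) * / 2.
Proof.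
intros Hf Hg Hf' Hg'.
assert (M : Ck 1 all3 (fun q => f q * g' q - g q * f' q)).
{ apply Ck_minus; [exact open_all | |]; now apply Ck_mult; [exact open_all | |]. }
pose proof (is_derive_line_mult 0 all3 _ (fun _ => / 2) q v M (Ck_const 1 all3 (/ 2) open_all) I) as K.
apply is_derive_unique in K; refine (eq_trans K _).
rewrite dirD_minor by assumption.
assert (Z : dirD (fun _ : V3 => / 2) q v = 0) by exact (Derive_const (/ 2) 0).
rewrite Z; ring.
Qed.

(* Cartan's formula: [d (F + lambda (X_F))] pulled back by the flow is the
   time derivative of [phi^* lambda]. *)
Lemma cartan_formula F phi q :
  hamiltonian F -> disk_isotopy phi -> generates F phi ->
  dirD (transported (lagrangian F) phi) q e1 = dirD (liouville phi) q e0.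
Proof.
intros HF Hphi Hgen.
destruct (Ck_flow 1 phi Hphi) as [U V]; destruct (Ck_flow 2 phi Hphi) as [U' V'].
assert (DU : forall v, Ck 1 all3 (fun q => dirD (flow1 phi) q v))
  by (intros v; exact (Ck_dirD 1 all3 _ v U')).
assert (DV : forall v, Ck 1 all3 (fun q => dirD (flow2 phi) q v))
  by (intros v; exact (Ck_dirD 1 all3 _ v V')).
unfold liouville; rewrite dirD_half_minor by auto.
rewrite (dirD_ext_open all3 _ (fun q => transported (ham3 F) phi q +
  (flow1 phi q * dirD (flow2 phi) q e0 - flow2 phi q * dirD (flow1 phi) q e0) * / 2) q e1
  open_all I) by (intros q' _; now apply transported_lagrangian).
assert (CH : Ck 1 all3 (transported (ham3 F) phi)) by now apply Ck_transported, Ck_ham3.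
assert (CM : Ck 1 all3 (fun q =>
  (flow1 phi q * dirD (flow2 phi) q e0 - flow2 phi q * dirD (flow1 phi) q e0) * / 2)).
{ apply Ck_mult; [exact open_all | | apply Ck_const, open_all].
  apply Ck_minus; [exact open_all | |]; now apply Ck_mult; [exact open_all | |]. }
transitivity (dirD (transported (ham3 F) phi) q e1 + dirD (fun q =>
  (flow1 phi q * dirD (flow2 phi) q e0 - flow2 phi q * dirD (flow1 phi) q e0) * / 2) q e1).
{ apply is_derive_unique.
  exact (is_derive_plus _ _ _ _ _ (is_derive_dirD 0 all3 _ q e1 CH I)
    (is_derive_dirD 0 all3 _ q e1 CM I)). }
rewrite dirD_half_minor by auto.
rewrite (dirD_comm all3 (flow1 phi) q e0 e1 open_all U' I).
rewrite (dirD_comm all3 (flow2 phi) q e0 e1 open_all V' I).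
rewrite dirD_transported by (assumption || now apply Ck_ham3).
change (fst e1) with 0.
destruct (flow_equation F phi q Hphi Hgen) as [E1 E2].
(* Hamilton's equation now eliminates F_x and F_y; with the mixed second derivatives brought to a
   common order, an algebraic identity remains. *)
assert (E2' : dirD (ham3 F) (fst q, (flow1 phi q, flow2 phi q)) e1 = - dirD (flow2 phi) q e0)
  by (rewrite E2; ring).
rewrite E2', <- E1; field.
Qed.

(** * The action of the time-one map *)

Definition liouville_map (f : plane -> plane) (x : plane) : R :=
  (fst (f x) * dirD ((fun y => snd (f y)) : V2 -> R) x (1, 0)
   - snd (f x) * dirD ((fun y => fst (f y)) : V2 -> R) x (1, 0)) * / 2.

(** Passes to an expression in the map at one single time, so that what is built from it visibly
    depends on that map alone. *)
Lemma liouville_time phi (t : R) (x : plane) : liouville phi (t, x) = liouville_map (phi t) x.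
Proof.
pose proof (dirD_slice (flow1 phi) t x (1, 0)) as S1.
pose proof (dirD_slice (flow2 phi) t x (1, 0)) as S2.
exact (f_equal2 (fun a b => (fst (phi t x) * b - snd (phi t x) * a) * / 2) (eq_sym S1) (eq_sym S2)).
Qed.

Lemma liouville_map_ext (f g : plane -> plane) (x : plane) :
  (forall x, f x = g x) -> liouville_map f x = liouville_map g x.
Proof.
intros E; unfold liouville_map; rewrite E.
f_equal; f_equal; f_equal; apply Derive_ext; intros s; now rewrite E.
Qed.

(* The primitive of [f^* lambda - lambda] that vanishes outside the disk,
   by integration along horizontal lines. *)
Definition action (f : plane -> plane) (x : plane) : R :=
  RInt (fun s => liouville_map f (s, snd x) - liouville_map (fun y => y) (s, snd x)) (-2) (fst x).

(** On each horizontal line both sides vanish at abscissa -2, a point outside the disk where the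
    flow is at rest. By Cartan's formula the x-derivative on the left is the time integral of the
    derivative of [liouville], that is, its increment from time 0 to time 1. *)
Lemma action_time_integral F phi (x : plane) :
  hamiltonian F -> disk_isotopy phi -> generates F phi ->
  RInt (fun t => transported (lagrangian F) phi (t, x)) 0 1 = action (phi 1) x.
Proof.
intros HF Hphi Hgen; destruct x as [x y].
set (K := transported (lagrangian F) phi).
assert (CK : Ck 1 all3 K) by now apply Ck_transported, Ck_lagrangian.
assert (CL : Ck 1 all3 (liouville phi)) by now apply Ck_liouville.
assert (K0 : forall t, K (t, (-2, y)) = 0).
{ intros t; refine (eq_trans (transported_lagrangian F phi (t, (-2, y)) HF Hphi Hgen) _).
  assert (Ho : ~ disk (-2, y)) by (unfold disk, normsq2; cbn [fst snd]; nra).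
  pose proof (transported_outside F phi t (-2, y) HF Hphi Ho) as Z0.
  destruct (Ck_flow 1 phi Hphi) as [U V].
  assert (Z1 : dirD (flow1 phi) (t, (-2, y)) e0 = 0).
  { pose proof (proj1 (is_derive_slices (flow1 phi) t (-2) y U)) as D.
    apply is_derive_unique in D; refine (eq_trans (eq_sym D) _).
    refine (eq_trans (Derive_ext _ (fun _ => -2) t _) (Derive_const _ _)).
    intros s; exact (f_equal fst (iso_outside phi Hphi s (-2, y) Ho)). }
  assert (Z2 : dirD (flow2 phi) (t, (-2, y)) e0 = 0).
  { pose proof (proj1 (is_derive_slices (flow2 phi) t (-2) y V)) as D.
    apply is_derive_unique in D; refine (eq_trans (eq_sym D) _).
    refine (eq_trans (Derive_ext _ (fun _ => y) t _) (Derive_const _ _)).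
    intros s; exact (f_equal snd (iso_outside phi Hphi s (-2, y) Ho)). }
  refine (eq_trans (f_equal2 Rplus Z0 (f_equal2 Rmult (f_equal2 Rminus
    (f_equal2 Rmult eq_refl Z2) (f_equal2 Rmult eq_refl Z1)) eq_refl)) _); ring. }
transitivity (RInt (fun t => RInt (fun s => dirD K (t, (s, y)) e1) (-2) x) 0 1).
{ apply RInt_ext; intros t _; symmetry.
  refine (eq_trans (proj1 (proj2 (RInt_dirD K (-2) x t 0 y CK))) _).
  rewrite K0; apply Rminus_0_r. }
rewrite (RInt_fubini (fun t s => dirD K (t, (s, y)) e1)).
2: { intros t s; apply (continuous_triple (fun p => dirD K p e1) _ (fun w : R * R => fst w)
       (fun w => snd w) (fun _ => y)); [| apply continuous_fst | apply continuous_snd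
       | apply continuous_const].
     exact (Ck_all_continuous 0 _ (Ck_dirD 0 all3 K e1 CK)). }
apply RInt_ext; intros s _; cbn [snd].
transitivity (RInt (fun t => dirD (liouville phi) (t, (s, y)) e0) 0 1).
{ apply RInt_ext; intros t _; exact (cartan_formula F phi (t, (s, y)) HF Hphi Hgen). }
refine (eq_trans (proj1 (RInt_dirD (liouville phi) 0 1 0 s y CL)) _).
rewrite !liouville_time, (liouville_map_ext (phi 0) (fun y => y) (s, y) (iso_start phi Hphi)).
reflexivity.
Qed.

(** Area invariance replaces the Lagrangian by its transport along the flow, and Fubini then moves
    the time integral inside, where it is the action. The right side knows nothing but the time-one
    map. *)
Lemma calabi_action F phi :
  hamiltonian F -> disk_isotopy phi -> generates F phi ->
  2 * RInt (fun t => disk_integral (F t)) 0 1 = disk_integral (action (phi 1)).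
Proof.
intros HF Hphi Hgen; rewrite <- lagrangian_integral by exact HF.
set (K := transported (lagrangian F) phi).
assert (CK : Ck 0 all3 K) by now apply Ck_transported, Ck_lagrangian.
assert (CP : forall q, continuous (polar3 K) q) by exact (Ck_all_continuous 0 _ (Ck_polar3 0 K CK)).
transitivity (RInt3 (polar3 K) 0 1 0 1 0 (2 * PI)).
- apply RInt_ext; intros t _; symmetry.
  (* Freezing the explicit time at t and letting the flow run until the same t gives the transported
     function. *)
  exact (disk_integral_frozen F phi (lagrangian F) t t HF Hphi Hgen (Ck_lagrangian 2 F HF)).
- rewrite RInt3_rotate by exact CP.
  apply RInt_ext; intros r _; apply RInt_ext; intros th _.
  rewrite <- (action_time_integral F phi (r * cos th, r * sin th) HF Hphi Hgen).
  refine (RInt_mult_r (fun t => K (t, (r * cos th, r * sin th))) r 0 1 _); intros t.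
  apply (continuous_triple K R_UniformSpace (fun t => t) (fun _ => r * cos th) (fun _ => r * sin th));
    [exact (Ck_all_continuous 0 K CK) | apply continuous_id | apply continuous_const
    | apply continuous_const].
Qed.

Lemma action_ext (f g : plane -> plane) (x : plane) :
  (forall x, f x = g x) -> action f x = action g x.
Proof.
intros E; apply RInt_ext; intros s _; now rewrite (liouville_map_ext f g (s, snd x) E).
Qed.

(** Twice either Calabi integral is the disk integral of one and the same action, as both isotopies
    end in the same map. *)
Lemma calabi_unique F phi c :
  hamiltonian F -> disk_isotopy phi -> generates F phi -> is_calabi (phi 1) c ->
  c = RInt (fun t => disk_integral (F t)) 0 1.
Proof.
intros HF Hphi Hgen [F' [phi' [HF' [Hphi' [Hgen' [E ->]]]]]].
pose proof (calabi_action F phi HF Hphi Hgen) as K.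
pose proof (calabi_action F' phi' HF' Hphi' Hgen') as K'.
assert (A : disk_integral (action (phi' 1)) = disk_integral (action (phi 1))).
{ apply RInt_ext; intros r _; apply RInt_ext; intros th _.
  now rewrite (action_ext (phi' 1) (phi 1)). }
lra.
Qed.

Theorem theorem1p3
  (F1 F2 : R -> plane -> R) (phi1 phi2 : R -> plane -> plane) (c1 c2 : R)
  (hF1 : hamiltonian F1) (hF2 : hamiltonian F2)
  (hphi1 : disk_isotopy phi1) (hphi2 : disk_isotopy phi2)
  (hgen1 : generates F1 phi1) (hgen2 : generates F2 phi2)
  (hc1 : is_calabi (phi1 1) c1) (hc2 : is_calabi (phi2 1) c2) :
  is_helicity (double_suspension F1 F2)
    (2 * PI ^ 2 * (c1 + c2 + 2 * PI ^ 2)).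
Proof.
rewrite (calabi_unique F1 phi1 c1 hF1 hphi1 hgen1 hc1).
rewrite (calabi_unique F2 phi2 c2 hF2 hphi2 hgen2 hc2).
apply (helicity_well_defined _ (helicity_form F1 F2)).
- now apply one_form_helicity.
- now apply helicity_form_primitive.
- now apply helicity_form_integral.
Qed.
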